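(* Let $f,g\in\mathbb Q[x]$ be nonconstant. Then $$N^{\mathrm{new}}_{f,g}(B)\asymp_{f,g}B^{1/2}$$ if and only if there exist $c,\beta\in\mathbb Q$, $\alpha\in\mathbb Q^*$, $E\in\mathbb Q[U]\setminus\{0\}$, $G\in\mathbb Q[Z]\setminus\mathbb Q$ such that $$g(Y)=G((Y-c)^2),\qquad f(X)=G\left(\frac{X-\beta}{\alpha}\,E\left(\frac{X-\beta}{\alpha}\right)^2\right),$$ and, writing $\beta=b/d$ with $b\in\mathbb Z$, $(b,d)=1$ and $d>0$, and writing $d\alpha\in s\,\mathbb Q^{*2}$ with $s$ a squarefree integer, the congruence $$sz^2\equiv -b\pmod d$$ is soluble in $z\in\mathbb Z$.
   Context: $N^{\mathrm{new}}_{f,g}(B)$ is the number of $n\in\mathbb Z$ with $|n|\le B$ for which there exists $y\in\mathbb Q$ with $g(y)=f(n)$ and $y\ne h(n)$ for every $h\in\mathbb Q[X]$ satisfying $f=g\circ h$. The relation $\asymp_{f,g}$ means bounded above and below by positive constants (depending on $f,g$) times $B^{1/2}$ for all sufficiently large real $B$. *)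

(* Defs.v *)
From HB Require Import structures.
From mathcomp Require Import all_boot all_order all_algebra finmap.
From mathcomp Require Import all_classical all_reals.

Set Implicit Arguments.
Unset Strict Implicit.
Unset Printing Implicit Defensive.

Import Order.TTheory GRing.Theory Num.Theory.
Local Open Scope ring_scope.
Local Open Scope classical_set_scope.

Definition is_new (f g : {poly rat}) (n : int) : Prop :=
  exists y : rat, g.[y] = f.[n%:~R] /\
    forall h : {poly rat}, f = g \Po h -> y != h.[n%:~R].

Definition new_set (R : realType) (f g : {poly rat}) (B : R) : set int :=
  [set n : int | `|n%:~R : R| <= B /\ is_new f g n].

(* [fset_set] sends infinite sets to the empty set, but [new_set f g B] is
   finite, being contained in the interval [-B, B]; see [finite_new_set]. *)
Definition N_new (R : realType) (f g : {poly rat}) (B : R) : nat :=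
  #|` fset_set (new_set f g B)|%fset.

Definition asymp_sqrt (R : realType) (N : R -> nat) : Prop :=
  exists c C B0 : R, [/\ 0 < c, 0 < C &
    forall B : R, B0 <= B ->
      c * Num.sqrt B <= (N B)%:R <= C * Num.sqrt B].

(* [0] is not squarefree; [1] and [-1] are. *)
Definition squarefreez (s : int) : Prop :=
  forall m : int, (m ^+ 2 %| s)%Z -> m \is a GRing.unit.

Lemma finite_new_set (R : realType) (f g : {poly rat}) (B : R) :
  finite_set (new_set f g B).
Proof.
pose k := `|Num.floor B|%N.+1.
pose g0 (i : nat) : int := (i%:Z - k%:Z)%R.
apply: (@sub_finite_set _ _ (g0 @` `I_(k + k))); last first.
  exact/finite_image/finite_II.
move=> n [nB _].
have nk : `|n|%R < k%:Z.
  have : `|n|%R <= Num.floor B by rewrite floor_ge_int intr_norm.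
  by move=> /le_lt_trans; apply; rewrite /k -addn1 PoszD ltzD1 abszE ler_norm.
move: nk; rewrite ltr_norml => /andP[lo hi].
have h0 : 0 <= n + k%:Z by rewrite -lerBlDr sub0r ltW.
exists (absz (n + k%:Z)); last by rewrite /g0 gez0_abs // addrK.
by rewrite /= -ltz_nat gez0_abs // PoszD ltrD2r.
Qed.

(* Main.v *)
(** Clearing denominators turns the problem into counting integer points (n, Y)
    with G(Y) = F(n), G monic.  A p-adic version of the Bombieri-Pila argument
    covers all but o(sqrt B) of them by finitely many curves d(x, Y) = 0 of degree
    at most 2 in Y: on a residue class mod p where G' is invertible, Y is p-adically
    a polynomial in n, and the pigeonhole principle yields a polynomial A(x, Y) of
    degree 2 in Y vanishing on the whole class.  On a curve d = 0 either Y is a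
    rational function of n, so the points are old or finite in number, or the
    discriminant D(n) is a square.  If D is neither c T^2 nor c (x - beta) T^2, the
    number of such n is o(sqrt B): 2-descent gives v^2 = (n - theta) delta in Q[theta]
    with v of size sqrt n and finitely many delta, and two solutions whose v differ
    by a fixed u satisfy m^2 eps + 1/eps + 4 theta in Q for eps = delta/u^2 and
    m = n - n', which bounds m and n.  If D = c (x - beta) T^2, then n = beta + alpha t^2
    parametrizes the curve, so f(beta + alpha t^2) = g(P(t)) with P not even, and
    comparing g(P(t)) with g(P(-t)) puts f and g in the required form. *)

Require Import Defs.
From HB Require Import structures.
From mathcomp Require Import all_boot all_order all_algebra all_field finmap.
From mathcomp Require Import all_classical all_reals.
From mathcomp Require Import perm ring lra zify.

Set Implicit Arguments.
Unset Strict Implicit.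
Unset Printing Implicit Defensive.

Import Order.TTheory GRing.Theory Num.Theory.
Local Open Scope ring_scope.

(** * Counting integers up to a bound *)

(** Degree 2 in Y is the threshold because the determinant method leaves about B^(1/e) values of n
    on a curve of degree e in Y, which is o(sqrt B) as soon as e >= 3. Write B = T^20, so that sqrt
    B = T^10. A prime p >= T^8 exceeds B^(1/3) = T^(20/3) by enough to force the vanishing of a
    small A(n, Y) divisible by a high power of p, while p <= T^9 leaves only O(T^9) residue classes,
    each with boundedly many points. The interval [T^8, T^9] is wide enough for a crude Chebyshev
    estimate to supply the primes.

    The count of square values rests on windows of length about w sqrt n: each holds a number of
    solutions bounded independently of w, and w is then taken large.

    In the converse direction the congruence provides a progression of z and points with n quadratic
    in z. Only finitely many of them are old, because g(Y) - f has finitely many roots h in Q[X] and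
    a degree parity separates each h from the constructed y. *)

(* The box is [-Q^2, Q^2], so that its square root is the natural number Q and
   [small P] reads: P has o(sqrt B) solutions up to B. *)
Definition small (P : int -> Prop) : Prop :=
  forall K : nat, exists Q0 : nat, forall Q : nat, (Q0 <= Q)%N ->
  forall s : seq int, uniq s ->
  (forall n, n \in s -> P n /\ (`|n| <= Q ^ 2)%N) -> (K * size s <= Q)%N.

(** The additive constant leaves room for Q = 0 and for finitely many exceptions. *)
Definition sqrt_bounded (P : int -> Prop) : Prop :=
  exists C : nat, forall Q : nat, forall s : seq int, uniq s ->
  (forall n, n \in s -> P n /\ (`|n| <= Q ^ 2)%N) -> (size s <= C * Q + C)%N.

Lemma small_sub (P P' : int -> Prop) :
  (forall n, P n -> P' n) -> small P' -> small P.
Proof.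
move=> sub sP K; have [Q0 hQ] := sP K; exists Q0 => Q /hQ{}hQ s us hs.
by apply: hQ => // n /hs[/sub].
Qed.

Lemma smallU (P P' : int -> Prop) :
  small P -> small P' -> small (fun n => P n \/ P' n).
Proof.
move=> sP sP' K; have [Q1 h1] := sP (2 * K)%N; have [Q2 h2] := sP' (2 * K)%N.
exists (maxn Q1 Q2) => Q; rewrite geq_max => /andP[/h1{}h1 /h2{}h2] s us hs.
have e : (size [seq n <- s | `[< P n >]] + size [seq n <- s | ~~ `[< P n >]]
   = size s)%N by rewrite !size_filter count_predC.
have := h1 [seq n <- s | `[< P n >]]; have := h2 [seq n <- s | ~~ `[< P n >]].
rewrite !filter_uniq // => /(_ isT) + /(_ isT).
have H1 : forall n, n \in [seq n <- s | `[< P n >]] -> P n /\ (`|n| <= Q ^ 2)%N.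
  by move=> n; rewrite mem_filter => /andP[/asboolP Pn /hs[]].
have H2 : forall n, n \in [seq n <- s | ~~ `[< P n >]] ->
    P' n /\ (`|n| <= Q ^ 2)%N.
  by move=> n; rewrite mem_filter => /andP[/asboolPn Pn /hs[[]]].
by move=> /(_ H2) + /(_ H1); lia.
Qed.

Lemma small_finite (l : seq int) : small (fun n => n \in l).
Proof.
move=> K; exists (K * size l)%N => Q hQ s us hs; apply: leq_trans hQ.
by rewrite leq_mul2l uniq_leq_size ?orbT // => n /hs[].
Qed.

Lemma small_seq (T : eqType) (l : seq T) (P : T -> int -> Prop) :
  (forall x, x \in l -> small (P x)) ->
  small (fun n => exists2 x, x \in l & P x n).
Proof.
elim: l => [|a l IH] sP; first by apply: small_sub (small_finite [::]) => n [].
apply: small_sub (smallU (sP a (mem_head _ _)) (IH _)) => [n [x]|x xl].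
  by rewrite inE => /orP[/eqP->|xl] Px; [left|right; exists x].
by apply: sP; rewrite inE xl orbT.
Qed.

(** Serves to clear denominators in n. The multiples a n lie in the box of a Q, and the lost factor
    a is recovered by applying the hypothesis with [K * a]. *)
Lemma small_scale (a : nat) (P : int -> Prop) : (0 < a)%N ->
  small P -> small (fun n => P (a%:Z * n)).
Proof.
move=> a0 sP K; have [Q0 hQ] := sP (K * a)%N; exists Q0 => Q hQ0 s us hs.
have := hQ (a * Q)%N (leq_trans hQ0 (leq_pmull _ a0)) [seq a%:Z * n | n <- s].
rewrite size_map map_inj_uniq ?us; last first.
  by apply: mulfI; rewrite eqz_nat -lt0n.
move=> /(_ isT) h.
rewrite -(leq_pmul2l a0); apply: leq_trans (h _); first by rewrite mulnCA mulnA.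
move=> _ /mapP[n /hs[Pn hn] ->]; split=> //.
rewrite abszM absz_nat expnMn; apply: leq_mul => //.
by rewrite -mulnn leq_pmulr.
Qed.

Lemma sqrt_bounded_sub (P P' : int -> Prop) :
  (forall n, P n -> P' n) -> sqrt_bounded P' -> sqrt_bounded P.
Proof.
move=> sub [C hC]; exists C => Q s us hs.
by apply: hC => // n /hs[/sub].
Qed.

Lemma sqrt_boundedU (P P' : int -> Prop) : sqrt_bounded P -> sqrt_bounded P' ->
  sqrt_bounded (fun n => P n \/ P' n).
Proof.
move=> [C hC] [C' hC']; exists (C + C')%N => Q s us hs.
have e : (size [seq n <- s | `[< P n >]] + size [seq n <- s | ~~ `[< P n >]]
   = size s)%N by rewrite !size_filter count_predC.
have := hC Q [seq n <- s | `[< P n >]].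
have := hC' Q [seq n <- s | ~~ `[< P n >]].
rewrite !filter_uniq // => /(_ isT) + /(_ isT).
have H1 : forall n, n \in [seq n <- s | `[< P n >]] -> P n /\ (`|n| <= Q ^ 2)%N.
  by move=> n; rewrite mem_filter => /andP[/asboolP Pn /hs[]].
have H2 : forall n, n \in [seq n <- s | ~~ `[< P n >]] ->
    P' n /\ (`|n| <= Q ^ 2)%N.
  by move=> n; rewrite mem_filter => /andP[/asboolPn Pn /hs[[]]].
by move=> /(_ H2) + /(_ H1); rewrite mulnDl; lia.
Qed.

Lemma small_sqrt_bounded (P : int -> Prop) : small P -> sqrt_bounded P.
Proof.
move=> /(_ 1%N)[Q0 hQ]; exists (Q0 + 1)%N => Q s us hs.
have := hQ (maxn Q Q0); rewrite leq_maxr => /(_ isT s us) h.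
have /h : forall n, n \in s -> P n /\ (`|n| <= maxn Q Q0 ^ 2)%N.
  move=> n /hs[Pn hn]; split=> //; apply: leq_trans hn _.
  by rewrite leq_exp2r // leq_maxl.
by rewrite mulnDl; lia.
Qed.

Lemma finite_roots (A : idomainType) (p : {poly A}) : p != 0 ->
  exists l : seq A, (size l < size p)%N /\ forall x, root p x -> x \in l.
Proof.
have [n] := ubnP (size p); elim: n p => // n IH p; rewrite ltnS => sp p0.
have [[x rx]|nor] := pselect (exists x, root p x); last first.
  exists [::]; split=> [|x rx]; first by rewrite size_poly_gt0.
  by case: nor; exists x.
have /factor_theorem[q eq] := rx.
have q0 : q != 0 by apply: contraNneq p0 => q0; rewrite eq q0 mul0r.
have sq : size p = (size q).+1.
  by rewrite eq size_Mmonic ?monicXsubC // size_XsubC addn2.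
have [|l [sl hl]] := IH q _ q0; first by rewrite -sq.
exists (x :: l); split=> /= [|y]; first by rewrite sq ltnS.
rewrite eq rootM root_XsubC inE => /orP[/hl->|->//]; exact: orbT.
Qed.

Lemma finite_int_roots (p : {poly rat}) : p != 0 ->
  exists l : seq int, forall n : int, p.[n%:~R] = 0 -> n \in l.
Proof.
move=> /finite_roots[l [_ hl]]; exists [seq numq x | x <- l] => n /eqP/hl nl.
by apply/mapP; exists n%:~R => //; rewrite numq_int.
Qed.

Lemma small_roots (p : {poly rat}) : p != 0 ->
  small (fun n => p.[n%:~R] = 0).
Proof. by move=> /finite_int_roots[l hl]; apply: small_sub (small_finite l). Qed.

Lemma size_fibers (T U : eqType) (s : seq T) (c : T -> U) (V : seq U) (K : nat) :
  (forall x, x \in s -> c x \in V) ->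
  (forall v, v \in V -> (size [seq x <- s | c x == v] <= K)%N) ->
  (size s <= K * size V)%N.
Proof.
elim: V s => [|v V IH] s hc hK.
  by case: s hc {hK} => // x s /(_ x); rewrite inE eqxx => /(_ isT).
rewrite -(count_predC (fun x => c x == v)) -!size_filter /= mulnS leq_add //.
  by apply: hK; rewrite inE eqxx.
apply: IH => [x|w wV].
  by rewrite mem_filter /= => /andP[/negPf cx /hc]; rewrite inE cx.
apply: leq_trans (hK w _); last by rewrite inE wV orbT.
rewrite -filter_predI !size_filter; apply: sub_count => x /=.
by case/andP.
Qed.

Lemma pigeonhole (T U : finType) (A : {pred T}) (B : {pred U}) (h : T -> U) :
  (forall x, x \in A -> h x \in B) -> (#|B| < #|A|)%N ->
  exists x y, [/\ x \in A, y \in A, x != y & h x = h y].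
Proof.
move=> hAB; rewrite ltnNge => /negP lt; apply: contrapT => no; apply: lt.
have inj : {in A &, injective h}.
  move=> x y xA yA e; apply/eqP/negPn/negP => ne; apply: no.
  by exists x, y.
rewrite -(card_in_image inj); apply: subset_leq_card.
apply/fintype.subsetP => z /fintype.imageP[x xA ->].
exact: hAB.
Qed.

(** * Primes in [T^8, T^9] *)

Lemma central_bin_ge (m : nat) : (2 ^ m <= 'C(2 * m, m))%N.
Proof.
elim: m => // m IH.
rewrite -(leq_pmul2l (ltn0Sn m)).
have e1 : (m.+1 * 'C(2 * m.+1, m.+1) = 2 * m.+1 * 'C((2 * m).+1, m))%N.
  by rewrite mulnS -mul_bin_diag.
have e2 : (m.+1 * 'C((2 * m).+1, m) = (2 * m).+1 * 'C(2 * m, m))%N.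
  rewrite -(@bin_sub (2 * m).+1 m); last by lia.
  have -> : ((2 * m).+1 - m = m.+1)%N by lia.
  by rewrite -mul_bin_diag.
by rewrite e1 expnS; nia.
Qed.

(** By Legendre's formula the exponent is a sum of terms [2m/p^k] - 2 [m/p^k], each 0 or 1, and zero
    once p^k > 2m. *)
Lemma logn_central_bin (p m : nat) : prime p ->
  (logn p 'C(2 * m, m) <= trunc_log p (2 * m))%N.
Proof.
move=> pp; have p1 := prime_gt1 pp.
have b0 : (0 < 'C(2 * m, m))%N by rewrite bin_gt0; lia.
have := congr1 (logn p) (bin_fact (_ : m <= 2 * m)%N).
rewrite !lognM ?muln_gt0 ?fact_gt0 //.
have -> : (2 * m - m = m)%N by lia.
rewrite !logn_fact //.
(* The sum for m! is padded with zeros so that it can be compared term by term with the one for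
   (2m)!. *)
have ext : (\sum_(1 <= k < m.+1) m %/ p ^ k =
            \sum_(1 <= k < (2 * m).+1) m %/ p ^ k)%N.
  rewrite [RHS](big_cat_nat _ (n := m.+1)) //=; last by lia.
  rewrite -[LHS]addn0; congr (_ + _)%N; apply/esym.
  rewrite big_nat_cond big1 // => k /andP[/andP[mk _] _].
  by rewrite divn_small // (leq_trans mk) // ltnW // ltn_expl.
rewrite ext => /(_ (leq_pmull m (isT : 0 < 2)%N)) e.
set t := trunc_log p (2 * m).
have : (\sum_(1 <= k < (2 * m).+1) (2 * m) %/ p ^ k <=
  \sum_(1 <= k < (2 * m).+1) (m %/ p ^ k + m %/ p ^ k + (k <= t)%N))%N.
  rewrite big_nat_cond [X in (_ <= X)%N]big_nat_cond; apply: leq_sum => k _.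
  have pk : (0 < p ^ k)%N by rewrite expn_gt0 prime_gt0.
  case: (leqP k t) => kt.
    have := divn_eq m (p ^ k); have := ltn_pmod m pk.
    have := divn_eq (2 * m) (p ^ k); have := ltn_pmod (2 * m) pk.
    set q1 := (_ %/ _)%N; set r1 := (_ %% _)%N.
    set q2 := (m %/ _)%N; set r2 := (m %% _)%N.
    set P := (p ^ k)%N => h1 h2 h3 h4.
    rewrite leqNgt; apply/negP => h5.
    have : ((q2 + q2 + 2) * P <= q1 * P)%N by rewrite leq_mul2r; lia.
    by nia.
  rewrite divn_small // (leq_trans (trunc_log_ltn _ p1)) //.
  by rewrite leq_exp2l.
rewrite !big_split /= => h.
have h2 : (\sum_(1 <= k < (2 * m).+1) (k <= t)%N <= t)%N.
  apply: (@leq_trans (\sum_(1 <= k < t.+1) 1)%N); last first.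
    by rewrite sum_nat_const_nat muln1 subn1 leqnn.
  have [le|lt] := leqP t.+1 (2 * m).+1.
    rewrite (big_cat_nat _ (n := t.+1)) //=.
    rewrite -[X in (_ <= X)%N]addn0 leq_add //.
      by apply: leq_sum => k _; exact: leq_b1.
    rewrite big_nat_cond big1 // => k /andP[/andP[tk _] _].
    by rewrite leqNgt tk.
  rewrite [X in (_ <= X)%N](big_cat_nat _ (n := (2 * m).+1)) //=; last by lia.
  by rewrite (leq_trans (_ : _ <= \sum_(1 <= k < (2 * m).+1) 1)%N) ?leq_addr //;
    apply: leq_sum => k _; exact: leq_b1.
by lia.
Qed.

(** Each prime power exactly dividing the binomial coefficient is at most 2m, and only primes up to
    2m occur. *)
Lemma central_bin_le (m : nat) (l : seq nat) : (0 < m)%N ->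
  (forall p, prime p -> (p <= 2 * m)%N -> p \in l) ->
  ('C(2 * m, m) <= (2 * m) ^ size l)%N.
Proof.
move=> m0 hl; have b0 : (0 < 'C(2 * m, m))%N by rewrite bin_gt0; lia.
have sub : forall p, p \in primes 'C(2 * m, m) -> prime p /\ (p <= 2 * m)%N.
  move=> p; rewrite mem_primes b0 /= => /andP[pp pC]; split=> //.
  have : (p %| (2 * m)`!)%N.
    by rewrite -(bin_fact (_ : m <= 2 * m)%N) ?leq_pmull // dvdn_mulr.
  elim: (2 * m)%N => [|k IH]; first by rewrite Euclid_dvd1.
  rewrite factS Euclid_dvdM // => /orP[/dvdn_leq->//|/IH]; lia.
rewrite {1}(prod_prime_decomp b0) prime_decompE big_map /=.
apply: (@leq_trans ((2 * m) ^ size (primes 'C(2 * m, m)))).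
  have : forall p, p \in primes 'C(2 * m, m) ->
      (p ^ logn p 'C(2 * m, m) <= 2 * m)%N.
    move=> p /sub[pp _]; apply: leq_trans (trunc_logP (prime_gt1 pp) _); last by lia.
    by rewrite leq_exp2l ?prime_gt1 // logn_central_bin.
  elim: (primes _) => [|p ps IH] h /=; first by rewrite big_nil.
  rewrite big_cons expnS leq_mul ?h ?mem_head //.
  by apply: IH => q qps; apply: h; rewrite inE qps orbT.
rewrite leq_exp2l; last by lia.
by apply: uniq_leq_size (primes_uniq _) _ => p /sub[]; exact: hl.
Qed.

(** Chebyshev's argument: with 2m about T^9 and fewer than k primes in the interval, 2^m <=
    (2m)^(T^8 + k), which fails for large T. *)
Lemma primes_between (k : nat) : exists T0 : nat, forall T : nat, (T0 <= T)%N ->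
  exists l : seq nat, [/\ uniq l, size l = k &
    forall p, p \in l -> prime p /\ (T ^ 8 <= p <= T ^ 9)%N].
Proof.
exists (maxn 1024 k) => T; rewrite geq_max => /andP[hT kT].
pose m := (T ^ 9)./2.
have T8 : (T <= T ^ 8)%N by rewrite -{1}[T]expn1 leq_exp2l; lia.
have m2 : (2 * m <= T ^ 9)%N by rewrite /m; lia.
have m3 : (T ^ 9 <= 2 * m + 1)%N by rewrite /m; lia.
have T9 : (T ^ 9 = T ^ 8 * T)%N by rewrite expnSr.
have m0 : (0 < m)%N by nia.
pose l := [seq p <- iota (T ^ 8) (2 * m).+1 | prime p && (p <= 2 * m)%N].
have lP : forall p, p \in l -> prime p /\ (T ^ 8 <= p <= T ^ 9)%N.
  move=> p; rewrite mem_filter mem_iota => /andP[/andP[pp h1] /andP[h2 _]].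
  by split=> //; rewrite h2 (leq_trans h1).
have [kl|lk] := leqP k (size l).
  exists (take k l); split; first by rewrite take_uniq // filter_uniq // iota_uniq.
    by rewrite size_takel.
  by move=> p /mem_take /lP.
exfalso.
(* Every integer below T^8 is counted as if it were prime, which is affordable because 2m is about
   T^9. *)
have := central_bin_le (l := iota 0 (T ^ 8) ++ l) m0.
have hl : forall p, prime p -> (p <= 2 * m)%N -> p \in iota 0 (T ^ 8) ++ l.
  move=> p pp pm; rewrite mem_cat mem_iota mem_filter pp pm mem_iota /=.
  by case: ltnP => //= h; lia.
move=> /(_ hl); rewrite size_cat size_iota => h.
have {}h := leq_trans (central_bin_ge m) h.
set L := up_log 2 T.
have TL : (T <= 2 ^ L)%N by apply: up_logP.
have LT : (2 ^ L < 2 * T)%N.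
  have := up_log_bounds (isT : 1 < 2)%N (_ : 1 < T)%N.
  rewrite -/L => /(_ ltac:(lia)) /andP[h1 _].
  by case: L h1 TL => [|L] /=; rewrite ?expnS; lia.
have L10 : (10 <= L)%N.
  by rewrite -(@leq_exp2l 2) //; apply: leq_trans TL.
(* At L = 10 this reads 360 < 512, whence the threshold T >= 1024. It gives 36 L < T, against m <=
   18 L T^8. *)
have big : (36 * L < 2 ^ L.-1)%N.
  elim: L L10 {TL LT} => // L IH; rewrite leq_eqVlt => /orP[/eqP<- //|].
  rewrite ltnS => /[dup] L9 /IH /=.
  by case: L L9 {IH} => // L L9 /=; rewrite expnS; lia.
have : ((2 * m) ^ (T ^ 8 + size l) <= 2 ^ (9 * L * (2 * T ^ 8)))%N.
  apply: (@leq_trans ((2 ^ (9 * L)) ^ (T ^ 8 + size l))).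
    rewrite leq_exp2r; last by nia.
    by apply: leq_trans m2 _; rewrite mulnC expnM leq_exp2r.
  rewrite -expnM leq_exp2l // leq_mul2l; apply/orP; right; lia.
move=> /(leq_trans h); rewrite leq_exp2l //.
have : (36 * L < T)%N.
  apply: leq_trans big _; case: L L10 LT {TL} => // L _ /=; rewrite expnS; lia.
by nia.
Qed.

(** * The p-adic determinant method *)

Lemma horner_taylor2 (A : comNzRingType) (p : {poly A}) (a b : A) :
  exists r, p.[a + b] = p.[a] + p^`().[a] * b + r * b ^+ 2.
Proof.
elim/poly_ind: p => [|p c [r IH]]; first by exists 0; rewrite deriv0 !hornerE.
exists (r * (a + b) + p^`().[a]).
rewrite derivD derivM derivX derivC !(hornerD, hornerM, hornerX, hornerC) IH.
by ring.
Qed.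

Lemma horner_subdvd (p : {poly int}) (a b : int) : (a - b %| p.[a] - p.[b])%Z.
Proof.
have [r] := horner_taylor2 p b (a - b).
have -> : b + (a - b) = a by ring.
move=> ->; apply/dvdzP.
by exists (p^`().[b] + r * (a - b)); ring.
Qed.

(* Newton iteration; one polynomial phi serves the whole residue class. *)
Lemma newton_class (G F : {poly int}) (p n0 Y0 c : int) (m : nat) :
  (p %| c * G^`().[Y0] - 1)%Z ->
  exists phi : {poly int}, forall n Y : int,
    (p %| n - n0)%Z -> (p %| Y - Y0)%Z -> G.[Y] = F.[n] ->
    (p ^+ m.+1 %| Y - phi.[n - n0])%Z.
Proof.
move=> hc; elim: m => [|m [phi IH]].
  by exists Y0%:P => n Y _ ? _; rewrite hornerC expr1.
(* The constant c, inverse to G' modulo p, replaces 1/G': phi stays a polynomial, at the price of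
   gaining a single power of p per step. *)
exists (phi - c%:P * ((G \Po phi) - (F \Po ('X + n0%:P)))) => n Y pn pY e.
have /dvdzP[t ht] := IH n Y pn pY e.
have ey : phi.[n - n0] = Y + - (t * p ^+ m.+1) by rewrite -ht; ring.
have [r hr] := horner_taylor2 G Y (- (t * p ^+ m.+1)).
have /dvdzP[w hw] : (p %| c * G^`().[Y] - 1)%Z.
  have -> : c * G^`().[Y] - 1 =
    c * (G^`().[Y] - G^`().[Y0]) + (c * G^`().[Y0] - 1) by ring.
  by rewrite rpredD // dvdz_mull // (dvdz_trans pY) ?horner_subdvd.
rewrite !(hornerD, hornerN, hornerM, hornerC, horner_comp, hornerX) subrK ey hr e.
apply/dvdzP; exists (- w * t + c * r * t ^+ 2 * p ^+ m).
transitivity (t * p ^+ m.+1 * (- (c * G^`().[Y] - 1)) +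
   c * r * t ^+ 2 * p ^+ m.+1 ^+ 2); first by ring.
by rewrite hw !exprS; ring.
Qed.

(** Degree below D in x and at most 2 in y. The ring is arbitrary so that the same coefficients can
    be evaluated at integers and at the pair of polynomials X + n0, phi. *)
Definition bieval (A : comNzRingType) (D : nat) (a : 'I_D * 'I_3 -> int)
  (x y : A) : A := \sum_e (a e)%:~R * x ^+ e.1 * y ^+ e.2.

Lemma bieval_horner (D : nat) (a : 'I_D * 'I_3 -> int) (p q : {poly int})
  (x : int) : (bieval a p q).[x] = bieval a p.[x] q.[x].
Proof.
rewrite /bieval horner_sum; apply: eq_bigr => e _.
by rewrite -(rmorph_int (@polyC int)) !(hornerM, hornerC, horner_exp).
Qed.

Lemma card_dffun_exp (b : nat) (I : finType) (h : I -> nat) :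
  #|{dffun forall i : I, 'I_(b ^ h i)}| = (b ^ \sum_i h i)%N.
Proof.
rewrite card_dep_ffun foldrE big_map big_enum /= expn_sum.
by apply: eq_bigr => i _; rewrite card_ord.
Qed.

(** The hypothesis says exactly that no subtraction in the weights is truncated, even at the corner
    i = D - 1, j = 2. *)
Lemma sum_weights (D k : nat) : (0 < D)%N -> (20 * D + 40 * k < 24 * D + 20)%N ->
  (2 * \sum_(e : 'I_D * 'I_3) (24 * D - (20 * e.1 + 20 * k * e.2 + 1)) +
   (60 * D * (D - 1) + 120 * k * D + 6 * D) = 144 * D * D)%N.
Proof.
move=> D0 hD.
have : (\sum_(e : 'I_D * 'I_3) (24 * D - (20 * e.1 + 20 * k * e.2 + 1)) +
   \sum_(e : 'I_D * 'I_3) (20 * e.1 + 20 * k * e.2 + 1) = 72 * D * D)%N.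
  rewrite -big_split /= (eq_bigr (fun=> 24 * D)%N) => [|[i j] _ /=].
    by rewrite sum_nat_const card_prod !card_ord; lia.
  have iD := ltn_ord i.
    have j2 : (k * j <= k * 2)%N by rewrite leq_mul2l -ltnS ltn_ord orbT.
    by rewrite subnK //; nia.
have -> : (\sum_(e : 'I_D * 'I_3) (20 * e.1 + 20 * k * e.2 + 1) =
   60 * (\sum_(i < D) i) + 60 * k * D + 3 * D)%N.
  rewrite -(pair_bigA _ (fun (i : 'I_D) (j : 'I_3) => 20 * i + 20 * k * j + 1)%N) /=.
  rewrite (eq_bigr (fun i : 'I_D => 60 * i + (60 * k + 3))%N) => [|i _].
    by rewrite big_split /= -big_distrr /= sum_nat_const card_ord; lia.
  by rewrite !big_ord_recl big_ord0 /= /bump /=; lia.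
rewrite -(big_mkord predT (fun i => i)) bin2_sum.
by have := bin2 D; have := mul_bin_diag D 1; rewrite bin1 => h _ h2; nia.
Qed.

Lemma bieval_sub (A : comNzRingType) (D : nat) (a b : 'I_D * 'I_3 -> int)
  (x y : A) : bieval (fun e => a e - b e) x y = bieval a x y - bieval b x y.
Proof.
rewrite /bieval -sumrB; apply: eq_bigr => e _.
by rewrite rmorphB /= !mulrBl.
Qed.

Lemma bieval_dvd (D : nat) (a : 'I_D * 'I_3 -> int) (x y y' d : int) :
  (d %| y - y')%Z -> (d %| bieval a x y - bieval a x y')%Z.
Proof.
move=> h; rewrite /bieval -sumrB; apply: rpred_sum => e _.
by rewrite -mulrBr dvdz_mull // subrXX dvdz_mulr.
Qed.

(** The power x^r contributes p^r and the coefficient the remaining p^(N - r), so only N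
    coefficients carry a condition. *)
Lemma horner_small_dvd (P : {poly int}) (p x : int) (N : nat) :
  (forall r, (r < N)%N -> (p ^+ (N - r) %| P`_r)%Z) -> (p %| x)%Z ->
  (p ^+ N %| P.[x])%Z.
Proof.
move=> h /dvdzP[t ->]; rewrite horner_coef; apply: rpred_sum => r _.
have [rN|Nr] := ltnP r N.
  have /dvdzP[w ->] := h _ rN.
  apply/dvdzP; exists (w * t ^+ r).
  by rewrite exprMn -{2}(subnK (ltnW rN)) exprD; ring.
by rewrite dvdz_mull // exprMn dvdz_mull // dvdz_exp2l.
Qed.

(** The weights give every monomial the same size T^(24 D - 1), up to C^2. The factor T missing from
    T^(24 D) later absorbs 3 D C^2. *)
Lemma bieval_le (D k T C : nat) (a : 'I_D * 'I_3 -> int) (n Y : int) :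
  (0 < T)%N -> (20 * D + 40 * k < 24 * D + 20)%N -> (0 < C)%N ->
  (forall e, `|a e| <= T ^ (24 * D - (20 * e.1 + 20 * k * e.2 + 1)))%N ->
  (`|n| <= T ^ 20)%N -> (`|Y| <= C * T ^ (20 * k))%N ->
  (`|bieval a n Y| <= 3 * D * C ^ 2 * T ^ (24 * D - 1))%N.
Proof.
move=> T0 hD C0 ha hn hY; rewrite /bieval.
apply: (@leq_trans (\sum_(e : 'I_D * 'I_3) C ^ 2 * T ^ (24 * D - 1))); last first.
  by rewrite sum_nat_const card_prod !card_ord; apply/eq_leq; ring.
apply: (@leq_trans (\sum_(e : 'I_D * 'I_3) `|((a e)%:~R * n ^+ e.1 * Y ^+ e.2)%R|)).
  elim/big_ind2: _ => // x1 x2 y1 y2 h1 h2.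
  by apply: leq_trans (leq_add h1 h2); lia.
apply: leq_sum => -[i j] _; rewrite intz !abszM !abszX /=.
have iD := ltn_ord i; have j2 : (j <= 2)%N by rewrite -ltnS ltn_ord.
have kj : (k * j <= k * 2)%N by rewrite leq_mul2l j2 orbT.
apply: (@leq_trans (T ^ (24 * D - (20 * i + 20 * k * j + 1)) *
   (T ^ 20) ^ i * (C * T ^ (20 * k)) ^ j)).
  have mono x y u : (x <= y -> x ^ u <= y ^ u)%N.
    by case: u => // u; rewrite leq_exp2r.
  by rewrite !leq_mul ?mono // (ha (i, j)).
rewrite expnMn -!expnM mulnCA -mulnA -!expnD mulnC.
have -> : (24 * D - (20 * i + 20 * k * j + 1) + (20 * i + 20 * k * j) = 24 * D - 1)%N.
  by nia.
by rewrite mulnC leq_mul // leq_pexp2l.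
Qed.

(* With N = 3 D unknowns, the coefficient of x^i Y^j is sought below T^(h(i,j)),
   h(i,j) = 24 D - 20 i - 20 k j - 1, so that |A(n, Y)| < T^(24 D) <= p^N, while
   p^N | A(n, Y) on the class amounts to conditions mod p^(N - r), r < N.  The
   exponents of T are about 42 D^2 against 9 N^2 / 2 = 40.5 D^2. *)
Lemma class_auxiliary_polynomial (G F : {poly int}) (C k T p : nat)
  (n0 Y0 c : int) (D := (40 * k + 1)%N) :
  (0 < C)%N -> (3 * D * C ^ 2 < T)%N -> (T ^ 8 <= p <= T ^ 9)%N ->
  (p %| c * G^`().[Y0] - 1)%Z ->
  exists a : 'I_D * 'I_3 -> int, (exists e, a e != 0) /\
  forall n Y : int, (p %| n - n0)%Z -> (p %| Y - Y0)%Z -> G.[Y] = F.[n] ->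
    (`|n| <= T ^ 20)%N -> (`|Y| <= C * T ^ (20 * k))%N -> bieval a n Y = 0.
Proof.
move=> C0 TC pT hc; pose N := (3 * D)%N.
have D0 : (0 < D)%N by rewrite /D addn1.
have T2 : (1 < T)%N by have := expn_gt0 C 2; rewrite C0 /=; nia.
have p1 : (1 < p)%N.
  case/andP: pT => h _; apply: leq_trans h.
  by apply: (leq_trans T2); rewrite -{1}[T]expn1 leq_exp2l.
have hD : (20 * D + 40 * k < 24 * D + 20)%N by rewrite /D; lia.
have [phi hphi] := newton_class F n0 N.-1 hc.
have NE : N.-1.+1 = N by rewrite prednK // /N muln_gt0.
rewrite NE in hphi.
pose h (e : 'I_D * 'I_3) := (24 * D - (20 * e.1 + 20 * k * e.2 + 1))%N.
pose TA : finType := {dffun forall e, 'I_(T ^ h e)}.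
pose TU : finType := {dffun forall r : 'I_N, 'I_(p ^ (N - r))}.
pose psi (a : 'I_D * 'I_3 -> int) := bieval a ('X + n0%:P) phi.
have sg_lt (a : 'I_D * 'I_3 -> int) (r : 'I_N) :
  (`|((psi a)`_r %% (p ^ (N - r))%N)%Z| < p ^ (N - r))%N.
  have q0 : (0 < p ^ (N - r))%N by rewrite expn_gt0 (ltnW p1).
  by rewrite -ltz_nat gez0_abs ?modz_ge0 ?ltz_pmod // eqz_nat -lt0n.
pose coe (a : TA) : 'I_D * 'I_3 -> int := fun e => Posz (a e).
(* The pigeonhole compares coefficient vectors through the coefficients of A(X + n0, phi) modulo
   p^(N - r); a difference of two colliding vectors is the required A. *)
pose sg (a : TA) : TU := [ffun r : 'I_N => Ordinal (sg_lt (coe a) r)].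
have [|//|a [b [_ _ ab sab]]] := @pigeonhole TA TU predT predT sg.
  by [].
  rewrite [X in (X < _)%N](_ : _ = #|TU|) // [X in (_ < X)%N](_ : _ = #|TA|) //.
  rewrite /TU /TA !card_dffun_exp.
  have sumh := sum_weights D0 hD; rewrite -/h in sumh.
  have sumr : (2 * \sum_(r < N) (N - r) = N * (N + 1))%N.
    have : (\sum_(r < N) (N - r) + \sum_(r < N) r = N * N)%N.
      rewrite -big_split /= (eq_bigr (fun=> N)) ?sum_nat_const ?card_ord // => r _.
      by rewrite subnK // ltnW.
    rewrite -[X in (_ + X)%N](big_mkord predT (fun i => i)) bin2_sum.
    have := mul_bin_diag N 1; rewrite bin1 mulnC; have := bin2 N.
    by move=> _ h1; nia.
  case/andP: pT => _ pT9.
  apply: (@leq_ltn_trans ((T ^ 9) ^ \sum_(r < N) (N - r))).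
    by rewrite leq_exp2r // lt0n; apply/eqP => z; move: sumr; rewrite z /N; nia.
  (* As 40 k = D - 1, the exponents are 40.5 D^2 + 13.5 D on the left and 40.5 D^2 + 28.5 D on the
     right: the linear terms decide. *)
  rewrite -expnM ltn_exp2l //.
  change (2 * \sum_e h e + (60 * D * (D - 1) + 120 * k * D + 6 * D) =
    144 * D * D)%N in sumh.
  move: sumh sumr; rewrite /N.
  move: (\sum_e h e)%N (\sum_(r < 3 * D) (3 * D - r))%N => x y.
  by rewrite /D; nia.
exists (fun e => coe a e - coe b e); split.
  apply: contrapT => no; case/eqP: ab; apply/ffunP => e; apply/val_inj.
  apply/eqP; rewrite -eqz_nat -subr_eq0; apply/negPn/negP => ne.
  by apply: no; exists e.
move=> n Y pn pY e hn hY.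
set B := fun e => coe a e - coe b e.
have hB : (p%:Z ^+ N %| bieval B n Y)%Z.
  rewrite -[bieval B n Y](subrK (bieval B n phi.[n - n0])) rpredD //.
    by apply/bieval_dvd/hphi.
  have -> : bieval B n phi.[n - n0] = (psi B).[n - n0].
    by rewrite /psi bieval_horner !hornerE subrK.
  apply: horner_small_dvd => // r rN.
  have := congr1 val (congr1 (fun u : TU => u (Ordinal rN)) sab).
  rewrite !ffunE /= => /(congr1 Posz).
  have q0 : (p ^ (N - r))%N%:Z != 0 by rewrite eqz_nat -lt0n expn_gt0 (ltnW p1).
  rewrite !gez0_abs ?modz_ge0 // => /eqP.
  rewrite eqz_mod_dvd -[Posz (p ^ _)]natz natrX natz => hh.
  by rewrite /psi /B bieval_sub coefB.
have Ble : (`|bieval B n Y| <= 3 * D * C ^ 2 * T ^ (24 * D - 1))%N.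
  apply: (bieval_le (k := k)) => // [|e']; first exact: ltnW.
  rewrite /B /coe; have := ltn_ord (a e'); have := ltn_ord (b e').
  rewrite -/(h e'); lia.
apply/eqP; rewrite -absz_eq0 -leqn0 leqNgt; apply/negP => pos.
have : (p ^ N <= `|bieval B n Y|)%N.
  by apply: dvdn_leq => //; move: hB; rewrite dvdzE abszX.
rewrite leqNgt => /negP; apply; apply: leq_ltn_trans Ble _.
apply: (@leq_trans (T * T ^ (24 * D - 1))).
  by rewrite ltn_pmul2r // expn_gt0 ltnW.
rewrite -expnS; apply: (@leq_trans ((T ^ 8) ^ N)).
  by rewrite -expnM leq_exp2l // /N; lia.
by rewrite leq_exp2r ?muln_gt0 //; case/andP: pT.
Qed.

(** * Elimination of Y by resultants *)

Lemma size_det_leq (A : comNzRingType) (m E : nat) (M : 'M[{poly A}]_m) :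
  (forall i j, (size (M i j) <= E.+1)%N) -> (size (\det M) <= (m * E).+1)%N.
Proof.
move=> hM; rewrite /determinant; apply: leq_trans (size_sum _ _ _) _.
apply/bigmax_leqP => sg _; apply: leq_trans (size_polyMleq _ _) _.
have h1 (b : bool) : (size ((-1) ^+ b : {poly A}) <= 1)%N.
  by case: b; rewrite ?expr0 ?expr1 ?size_polyN size_poly1.
have : (size (\prod_i M i (sg i))%R <= (m * E).+1)%N.
  apply: leq_trans (size_poly_prod_leq _ _) _.
  have : (\sum_i size (M i (sg i))%R <= \sum_(i < m) E.+1)%N.
    by apply: leq_sum => i _; exact: hM.
  by rewrite sum_nat_const !card_ord mulnS; move: (\sum_i _)%N (m * E)%N; lia.
have := h1 (odd_perm sg).
set u := size _ => h2; set v := size _ => h3.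
by rewrite -ltnS; apply: leq_trans (leqSpred _) _; lia.
Qed.

Lemma size_resultant_leq (A : comNzRingType) (E : nat) (p q : {poly {poly A}}) :
  (forall i, (size (p`_i)%R <= E.+1)%N) -> (forall i, (size (q`_i)%R <= E.+1)%N) ->
  (size (resultant p q) <= ((size q).-1 + (size p).-1) * E + 1)%N.
Proof.
move=> hp hq; rewrite addn1; apply: size_det_leq => i j.
have sz (r : {poly {poly A}}) k m (b : bool) :
    (forall i, (size (r`_i)%R <= E.+1)%N) ->
    (size (r`_(k - m) *+ b)%R <= E.+1)%N.
  by move=> hr; case: b; rewrite ?mulr0n ?size_poly0 ?mulr1n.
by rewrite Sylvester_mxE; case: (fintype.split i) => k; apply: sz.
Qed.

(** The outer variable is Y and the coefficients lie in Q[x]; hence the evaluations of the form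
    [P.[Y%:P].[x]], here and below. *)
Definition bipoly (D : nat) (a : 'I_D * 'I_3 -> int) : {poly {poly rat}} :=
  \sum_e ((a e)%:~R *: 'X^(e.1))%:P * 'X^(e.2).

Lemma bipoly_horner (D : nat) (a : 'I_D * 'I_3 -> int) (n Y : int) :
  (bipoly a).[(Y%:~R)%:P].[n%:~R] = (bieval a n Y)%:~R.
Proof.
rewrite /bipoly /bieval !horner_sum rmorph_sum /=; apply: eq_bigr => e _.
rewrite hornerM hornerC hornerXn -rmorphXn /= hornerM hornerC hornerZ hornerXn.
by rewrite !rmorphM !rmorphXn /= intz.
Qed.

Lemma bipoly_coef (D : nat) (a : 'I_D * 'I_3 -> int) (e : 'I_D * 'I_3) :
  (bipoly a)`_(e.2)`_(e.1) = (a e)%:~R.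
Proof.
rewrite /bipoly coef_sum coef_sum (bigD1 e) //= big1 ?addr0 => [|e' ne].
  by rewrite coefCM coefXn eqxx mulr1 coefZ coefXn eqxx mulr1.
rewrite coefCM coefXn.
have [e2|] := eqVneq (e.2 : nat) e'.2; last by rewrite mulr0 coef0.
rewrite mulr1 coefZ coefXn.
have [e1|] := eqVneq (e.1 : nat) e'.1; last by rewrite mulr0.
by case/eqP: ne; apply/eqP/andP; split; apply/eqP/val_inj.
Qed.

Lemma size_bipoly (D : nat) (a : 'I_D * 'I_3 -> int) : (size (bipoly a) <= 3)%N.
Proof.
apply: leq_trans (size_sum _ _ _) _; apply/bigmax_leqP => e _.
apply: leq_trans (size_polyMleq _ _) _; rewrite size_polyXn size_polyC.
by have := ltn_ord e.2; case: (_ == _) => /=; lia.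
Qed.

Lemma size_bipoly_coef (D : nat) (a : 'I_D * 'I_3 -> int) (j : nat) :
  (size ((bipoly a)`_j)%R <= D)%N.
Proof.
rewrite /bipoly coef_sum; apply: leq_trans (size_sum _ _ _) _.
apply/bigmax_leqP => e _; rewrite coefCM coefXn.
case: (_ == _); last by rewrite mulr0 size_poly0.
rewrite mulr1; apply: leq_trans (size_scale_leq _ _) _.
by rewrite size_polyXn ltn_ord.
Qed.

Lemma size_uniq_int_roots (p : {poly rat}) (s : seq int) : p != 0 -> uniq s ->
  (forall n, n \in s -> p.[n%:~R] = 0) -> (size s < size p)%N.
Proof.
move=> p0 us hs; rewrite -(size_map (fun n : int => n%:~R : rat)).
apply: max_poly_roots => //; last by rewrite map_inj_uniq //; apply: intr_inj.
by apply/allP => _ /mapP[n /hs ns ->]; apply/eqP.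
Qed.

(** Over Q[x] a gcd constant in Y counts as trivial, so this says that Phi has no factor of degree 1
    or 2 in Y over the field Q(x). *)
Definition no_quadratic_factor (Phi : {poly {poly rat}}) : Prop :=
  forall A : {poly {poly rat}}, (1 < size A <= 3)%N -> coprimep A Phi.

(** All these n are zeros of the resultant in Y, a nonzero polynomial whose degree is bounded in
    terms of D and Phi. Hence one K serves the auxiliary polynomials of all residue classes. *)
Lemma quadratic_zeros_bound (Phi : {poly {poly rat}}) (D : nat) :
  (1 < size Phi)%N -> no_quadratic_factor Phi ->
  exists K : nat, forall (a : 'I_D * 'I_3 -> int) (s : seq int),
    (exists e, a e != 0) -> uniq s ->
    (forall n, n \in s -> exists Y : int, bieval a n Y = 0 /\
       Phi.[(Y%:~R)%:P].[n%:~R] = 0) -> (size s <= K)%N.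
Proof.
move=> sPhi hPhi.
pose E := (D + \max_(i < size Phi) size (Phi`_i)%R)%N.
have hE i : (size (Phi`_i)%R <= E.+1)%N.
  have [iP|Pi] := ltnP i (size Phi); last by rewrite nth_default ?size_poly0.
  apply: leqW; apply: leq_trans (leq_addl _ _).
  exact: (leq_bigmax (Ordinal iP)).
exists (((size Phi).-1 + 2) * E + 1)%N => a s [e ae] us hs.
have A0 : bipoly a != 0.
  by apply: contraNneq ae => A0; rewrite -(intr_eq0 rat) -bipoly_coef A0 !coef0.
have hA i : (size ((bipoly a)`_i)%R <= E.+1)%N.
  by apply/leqW/(leq_trans (size_bipoly_coef _ _))/leq_addr.
have [s1|s1] := leqP (size (bipoly a)) 1.
  have eA := size1_polyC s1; set p := (bipoly a)`_0 in eA.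
  have p0 : p != 0 by apply: contraNneq A0 => p0; rewrite eA p0.
  apply: ltnW; apply: leq_trans (size_uniq_int_roots p0 us _) _.
    move=> n /hs[Y [eY _]]; have := bipoly_horner a n Y.
    by rewrite eA hornerC eY.
  by apply: leq_trans (hA 0%N) _; nia.
have R0 : resultant (bipoly a) Phi != 0.
  rewrite resultant_eq0 -leqNgt.
  by have := hPhi (bipoly a); rewrite s1 size_bipoly => /(_ isT) /eqP ->.
have [[u v] _ euv] := resultant_in_ideal s1 sPhi.
apply: ltnW; apply: leq_trans (size_uniq_int_roots R0 us _) _.
  move=> n /hs[Y [eY ePhi]].
  have := congr1 (fun P => P.[(Y%:~R)%:P].[n%:~R]) euv.
  rewrite hornerC hornerD !hornerM hornerD !hornerM bipoly_horner eY ePhi.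
  by rewrite !mulr0 addr0.
apply: leq_trans (size_resultant_leq hA hE) _.
rewrite leq_add2r leq_mul2r leq_add2l; apply/orP; right.
by move: (size_bipoly a); case: (size (bipoly a)).
Qed.

(** * Sizes of points, choice of primes and the count over residue classes *)

Definition coef_norm (P : {poly int}) : nat := (\sum_(i < size P) `|(P`_i)%R|)%N.

Lemma horner_abs_le (P : {poly int}) (x : int) (X : nat) :
  (`|x| <= X)%N -> (0 < X)%N -> (`|(P.[x])%R| <= coef_norm P * X ^ (size P).-1)%N.
Proof.
move=> xX X0; rewrite horner_coef /coef_norm big_distrl /=.
apply: (@leq_trans (\sum_(i < size P) `|(P`_i * x ^+ i)%R|)).
  elim/big_ind2: _ => // x1 x2 y1 y2 h1 h2.
  by apply: leq_trans (leq_add h1 h2); lia.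
apply: leq_sum => i _; rewrite abszM abszX leq_mul //.
apply: (@leq_trans (X ^ i)); first by case: (nat_of_ord i) => // u; rewrite leq_exp2r.
by rewrite leq_pexp2l // -ltnS (leq_trans (ltn_ord i)) ?leqSpred.
Qed.

Lemma monic_root_le (P : {poly int}) (x : int) : P \is monic -> (1 < size P)%N ->
  (`|x| <= `|(P.[x])%R| + coef_norm P)%N.
Proof.
move=> mP sP; have [->//|x0] := eqVneq x 0.
have x1 : (0 < `|x|)%N by rewrite absz_gt0.
pose l := (size P).-1; have el : size P = l.+1 by rewrite prednK // ltnW.
have l0 : (0 < l)%N by rewrite -ltnS -el.
have e : x ^+ l = P.[x] - \sum_(i < l) P`_i * x ^+ i.
  rewrite horner_coef el big_ord_recr /= -/l -[P`_l]/(lead_coef P) (monicP mP).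
  by rewrite mul1r [X in _ = X - _]addrC addrK.
have hs : (`|(\sum_(i < l) P`_i * x ^+ i)%R| <= coef_norm P * `|x| ^ l.-1)%N.
  apply: (@leq_trans (\sum_(i < l) `|(P`_i * x ^+ i)%R|)).
    elim/big_ind2: _ => // x1' x2 y1 y2 h1 h2.
    by apply: leq_trans (leq_add h1 h2); lia.
  rewrite /coef_norm el big_ord_recr /= mulnDl big_distrl /=.
  apply: leq_trans (leq_addr _ _); apply: leq_sum => i _.
  rewrite abszM abszX leq_mul // leq_pexp2l //.
  by have := ltn_ord i; lia.
have : (`|x| ^ l <= (`|(P.[x])%R| + coef_norm P) * `|x| ^ l.-1)%N.
  rewrite -abszX e mulnDl; apply: (@leq_trans (`|(P.[x])%R| + coef_norm P * `|x| ^ l.-1)).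
    by move: hs; set u := (\sum_(i < l) _); lia.
  by rewrite leq_add2r leq_pmulr // expn_gt0 x1.
by rewrite -{1}(prednK l0) expnS leq_pmul2r // expn_gt0 x1.
Qed.

Lemma prod_primes_le (l : seq nat) (m : nat) : uniq l -> (0 < m)%N ->
  (forall p, p \in l -> prime p /\ (p %| m)%N) -> (\prod_(p <- l) p <= m)%N.
Proof.
move=> ul m0 hl; apply: dvdn_leq => //.
elim: l ul hl => [|p l IH] /=; first by rewrite big_nil dvd1n.
move=> /andP[pl ul] hl; rewrite big_cons Gauss_dvd; last first.
  have [pp _] := hl p (mem_head _ _).
  rewrite coprime_sym big_seq; elim/big_rec: _ => [|q y ql cy]; first exact: coprime1n.
  have [pq _] : prime q /\ (q %| m)%N by apply: hl; rewrite inE ql orbT.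
  rewrite coprimeMl cy andbT prime_coprime // dvdn_prime2 //.
  by apply: contraNneq pl => <-.
rewrite (hl p (mem_head _ _)).2 IH // => q ql.
by apply: hl; rewrite inE ql orbT.
Qed.

Lemma intr_Fp_eq0 (p : nat) (z : int) : prime p ->
  ((z%:~R : 'F_p) == 0) = (p %| z)%Z.
Proof.
move=> pp; have ch := pchar_Fp pp.
rewrite dvdzE absz_nat; case: z => n.
  by rewrite -pmulrn absz_nat (dvdn_pcharf ch).
by rewrite NegzE mulrNz oppr_eq0 -pmulrn abszN absz_nat (dvdn_pcharf ch).
Qed.

(** Modulo p the ys are distinct roots of G - z, whose degree survives reduction because G is
    monic. *)
Lemma size_roots_mod (p : nat) (G : {poly int}) (z : int) (ys : seq int) :
  prime p -> G \is monic -> (1 < size G)%N -> uniq ys ->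
  (forall x y, x \in ys -> y \in ys -> (p %| x - y)%Z -> x = y) ->
  (forall y, y \in ys -> (p %| G.[y] - z)%Z) -> (size ys <= size G)%N.
Proof.
move=> pp mG sG uy inj hy; set q := G - z%:P.
have sq : (size (- z%:P) < size G)%N.
  by rewrite size_polyN (leq_ltn_trans (size_polyC_leq1 _)).
have lq : lead_coef q = 1 by rewrite lead_coefDl // (monicP mG).
set q' := map_poly (intr : int -> 'F_p) q.
have szq : size q' = size G.
  by rewrite size_map_poly_id0 ?size_polyDl // lq rmorph1 oner_eq0.
have q0 : q' != 0 by rewrite -size_poly_gt0 szq ltnW.
rewrite -szq ltnW // -(size_map (intr : int -> 'F_p)); apply: max_poly_roots => //.
  apply/allP => _ /mapP[y /hy yp ->].
  by rewrite /root horner_map /= !hornerE intr_Fp_eq0.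
rewrite map_inj_in_uniq // => x y xs xs' /eqP.
by rewrite -subr_eq0 -rmorphB /= intr_Fp_eq0 //; exact: inj.
Qed.

Lemma point_bound (G F : {poly int}) : G \is monic -> (1 < size G)%N ->
  exists C : nat, (0 < C)%N /\ forall (T : nat) (n Y : int), (0 < T)%N ->
    G.[Y] = F.[n] -> (`|n| <= T ^ 20)%N -> (`|Y| <= C * T ^ (20 * (size F).-1))%N.
Proof.
move=> mG sG; exists (coef_norm F + coef_norm G + 1)%N; split; first by rewrite addn1.
move=> T n Y T0 e nT; apply: leq_trans (monic_root_le Y mG sG) _.
rewrite e; have T20 : (0 < T ^ 20)%N by rewrite expn_gt0 T0.
have := horner_abs_le F nT T20; rewrite -expnM => h.
rewrite !mulnDl -addnA leq_add // (leq_trans _ (leq_addr _ _)) //.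
by rewrite leq_pmulr // expn_gt0 T0.
Qed.

Lemma deriv_neq0 (A : numDomainType) (p : {poly A}) : (1 < size p)%N ->
  p^`() != 0.
Proof.
move=> sp; have l0 : lead_coef p != 0 by rewrite lead_coef_eq0 -size_poly_gt0 ltnW.
apply: contraNneq l0 => d0; have := congr1 (fun q : {poly A} => q`_(size p).-2) d0.
rewrite coef_deriv coef0 /lead_coef.
have -> : (size p).-2.+1 = (size p).-1 by case: (size p) sp => [|[]].
move=> /eqP; rewrite mulrn_eq0 => /orP[|//].
by case: (size p) sp => [|[]].
Qed.

(** Newton iteration says nothing where G'(Y) = 0, but such Y are finite in number and each has
    finitely many n. *)
Lemma small_critical_points (G F : {poly int}) : (1 < size G)%N ->
  (1 < size F)%N ->
  small (fun n => exists Y : int, G^`().[Y] = 0 /\ G.[Y] = F.[n]).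
Proof.
move=> sG sF; have dG0 := deriv_neq0 sG.
have [l [_ hl]] := finite_roots dG0.
apply: small_sub (small_seq (l := l) (P := fun Y n => G.[Y] = F.[n]) _).
  by move=> n [Y [/eqP/hl Yl e]]; exists Y.
move=> Y _; set q := map_poly (intr : int -> rat) (F - (G.[Y])%:P).
have q0 : q != 0.
  rewrite map_poly_eq0_id0 ?intr_eq0.
    rewrite -size_poly_gt0 size_polyDl ?size_polyN.
      by rewrite ltnW.
    exact: leq_ltn_trans (size_polyC_leq1 _) sF.
  rewrite lead_coef_eq0 -size_poly_gt0 size_polyDl ?size_polyN; first exact: ltnW.
  exact: leq_ltn_trans (size_polyC_leq1 _) sF.
apply: small_sub (small_roots q0) => n e.
by rewrite /q horner_map /= !hornerE e subrr.
Qed.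

(** One prime may divide P(Y), but s distinct primes above T^8 cannot all do so: their product would
    exceed |P(Y)|, which is O(T^(20 k g)) with g the degree of P. *)
Lemma prime_off_derivative (P : {poly int}) (C k : nat) : (0 < C)%N ->
  exists s T1 : nat, forall (T : nat) (l : seq nat) (Y : int), (T1 <= T)%N ->
    uniq l -> size l = s ->
    (forall p, p \in l -> prime p /\ (T ^ 8 <= p <= T ^ 9)%N) ->
    (`|Y| <= C * T ^ (20 * k))%N -> P.[Y] != 0 ->
    exists2 p, p \in l & ~~ (p %| P.[Y])%Z.
Proof.
move=> C0; set g := (size P).-1; set N := coef_norm P.
exists (20 * k * g + 1)%N, (N * C ^ g + 1)%N => T l Y hT ul sl hl hY PY.
apply: contrapT => no.
have T0 : (0 < T)%N by lia.
have : (\prod_(p <- l) p <= `|(P.[Y])%R|)%N.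
  apply: prod_primes_le; rewrite ?absz_gt0 // => p pl.
  split; first by case: (hl p pl).
  by apply/negPn/negP => h; apply: no; exists p => //; rewrite dvdzE absz_nat.
have : ((T ^ 8) ^ size l <= \prod_(p <- l) p)%N.
  elim: l hl {ul sl no} => [|p l IH] h; first by rewrite big_nil.
  rewrite big_cons [size _]/= [((T ^ 8) ^ _.+1)%N]expnS leq_mul //.
    by case: (h p (mem_head _ _)) => _ /andP[].
  by apply: IH => q ql; apply: h; rewrite inE ql orbT.
move=> h1 h2; have := horner_abs_le P hY.
rewrite muln_gt0 C0 expn_gt0 T0 => /(_ isT) h3.
have := leq_trans (leq_trans h1 h2) h3.
rewrite -/N -/g sl expnMn -!expnM mulnA => h4.
have : (T * T ^ (20 * k * g) <= N * C ^ g * T ^ (20 * k * g))%N.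
  apply: leq_trans h4; rewrite -expnS leq_pexp2l //; lia.
by rewrite leq_pmul2r ?expn_gt0 ?T0 //; lia.
Qed.

(** There are p <= T^9 classes of n, at most [size G] classes of Y above each, and at most K points
    in each pair of classes. *)
Lemma size_class_le (G F : {poly int}) (Phi : {poly {poly rat}}) (C k : nat) :
  G \is monic -> (1 < size G)%N -> (1 < size Phi)%N ->
  no_quadratic_factor Phi -> (0 < C)%N ->
  exists R T1 : nat, forall (T p : nat) (s : seq int) (Yf : int -> int),
    (T1 <= T)%N -> prime p -> (T ^ 8 <= p <= T ^ 9)%N -> uniq s ->
    (forall n, n \in s -> [/\ G.[Yf n] = F.[n],
       Phi.[((Yf n)%:~R)%:P].[n%:~R] = 0, (`|n| <= T ^ 20)%N,
       (`|Yf n| <= C * T ^ (20 * k))%N & ~~ (p %| G^`().[Yf n])%Z]) ->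
    (size s <= R * T ^ 9)%N.
Proof.
move=> mG sG sPhi hPhi C0.
pose D := (40 * k + 1)%N.
have [K hK] := quadratic_zeros_bound D sPhi hPhi.
exists (K * size G)%N, (3 * D * C ^ 2 + 1)%N => T p s Yf hT pp pT us hs.
rewrite addn1 in hT.
have p0 : p%:Z != 0 by rewrite eqz_nat -lt0n prime_gt0.
apply: (@leq_trans (K * size G * p)%N); last first.
  by rewrite leq_mul2l; case/andP: pT => _ ->; rewrite orbT.
have := @size_fibers _ _ s (fun n => (n %% p)%Z) [seq i%:Z | i <- iota 0 p]
   (K * size G)%N.
rewrite size_map size_iota; apply=> [n _|r _].
  apply/mapP; exists `|(n %% p)%Z|%N; last by rewrite gez0_abs ?modz_ge0.
  by rewrite mem_iota /= -ltz_nat gez0_abs ?modz_ge0 // ltz_pmod // ltz_nat prime_gt0.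
set s1 := [seq n <- s | _].
pose V := undup [seq (Yf n %% p)%Z | n <- s1].
have s1P n : n \in s1 -> n \in s /\ (n %% p)%Z = r.
  by rewrite mem_filter => /andP[/eqP].
apply: (@leq_trans (K * size V)%N).
  apply: (@size_fibers _ _ s1 (fun n => (Yf n %% p)%Z)) => [n ns|v _].
    by rewrite mem_undup; apply/mapP; exists n.
  set s2 := [seq n <- s1 | _].
  have s2P n : n \in s2 -> [/\ n \in s, (n %% p)%Z = r & (Yf n %% p)%Z = v].
    by rewrite mem_filter => /andP[/eqP <- /s1P[]].
  have us2 : uniq s2 by rewrite !filter_uniq.
  have [e|[n0 n0s]] : s2 = [::] \/ exists n, n \in s2.
    by case: s2 {s2P us2} => [|n ?]; [left|right; exists n; rewrite mem_head].
    by rewrite e.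
  have [n0s0 n0r n0v] := s2P _ n0s.
  have [_ _ _ _ ndvd] := hs _ n0s0.
  (* Any point of the class serves as the base point n0, Y0 of the Newton iteration. *)
  have [c hc] : exists c, (p %| c * G^`().[Yf n0] - 1)%Z.
    have : coprimez p G^`().[Yf n0].
      by rewrite coprimezE absz_nat prime_coprime // -[X in (X %| _)%N]absz_nat -dvdzE.
    case/coprimezP => -[u w] /= e; exists w.
    by apply/dvdzP; exists (- u); rewrite -e; ring.
  have [a [ane ha]] := class_auxiliary_polynomial F n0 C0 hT pT hc.
  apply: (hK a) => // n /[dup] ns2 /s2P[ns nr nv]; exists (Yf n).
  have [e1 e2 e3 e4 _] := hs n ns; split=> //; apply: ha => //.
    by rewrite -eqz_mod_dvd nr n0r.
  by rewrite -eqz_mod_dvd nv n0v.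
rewrite leq_mul2l; apply/orP; right.
have VP y : y \in V -> exists2 n, n \in s1 & y = (Yf n %% p)%Z.
  by rewrite mem_undup => /mapP.
have [e|[y0 /VP[n0 n0s _]]] : V = [::] \/ exists y, y \in V.
    by case: (V) => [|n ?]; [left|right; exists n; rewrite mem_head].
  by rewrite e.
apply: (size_roots_mod (p := p) (z := F.[n0])) => //; first exact: undup_uniq.
  move=> x y /VP[n1 _ ->] /VP[n2 _ ->]; rewrite -eqz_mod_dvd !modz_mod.
  by move=> /eqP.
move=> y /VP[n1 n1s ->].
have [[n0s' n0r] [n1s' n1r]] := (s1P _ n0s, s1P _ n1s).
have [e1 _ _ _ _] := hs _ n1s'.
have -> : G.[(Yf n1 %% p)%Z] - F.[n0] =
  (G.[(Yf n1 %% p)%Z] - G.[Yf n1]) + (F.[n1] - F.[n0]) by rewrite e1; ring.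
rewrite rpredD //.
  by apply: dvdz_trans (horner_subdvd _ _ _); rewrite -eqz_mod_dvd modz_mod.
by apply: dvdz_trans (horner_subdvd _ _ _); rewrite -eqz_mod_dvd n0r n1r.
Qed.

Lemma small_off_quadratics (G F : {poly int}) (Phi : {poly {poly rat}}) :
  G \is monic -> (1 < size G)%N -> (1 < size F)%N -> (1 < size Phi)%N ->
  no_quadratic_factor Phi ->
  small (fun n => exists Y : int,
    G.[Y] = F.[n] /\ Phi.[(Y%:~R)%:P].[n%:~R] = 0).
Proof.
move=> mG sG sF sPhi hPhi.
pose P n Y := [/\ G.[Y] = F.[n], Phi.[(Y%:~R)%:P].[n%:~R] = 0 & G^`().[Y] != 0].
suff sm : small (fun n => exists Y, P n Y).
  apply: small_sub (smallU sm (small_critical_points sG sF)) => n [Y [e1 e2]].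
  have [d0|d0] := eqVneq (G^`().[Y]) 0; [right|left]; exists Y; split=> //.
have [C [C0 hC]] := point_bound F mG sG.
have [R [T1 hR]] := size_class_le F (size F).-1 mG sG sPhi hPhi C0.
have [m [T2 hm]] := prime_off_derivative G^`() (size F).-1 C0.
have [T3 hT3] := primes_between m.
move=> K; pose T0 := (maxn (maxn T1 T2) (maxn T3 (K * R * m * 1024 + 2)))%N.
exists (T0 ^ 10 + 1)%N => Q hQ s us hs.
have exT : exists T, (Q <= T ^ 10)%N.
  by exists Q; rewrite -{1}[Q]expn1 leq_pexp2l //; lia.
have [T QT minT] := ex_minnP exT.
have T0T : (T0 < T)%N.
  rewrite ltnNge; apply/negP => le; move: hQ; apply/negP; rewrite -ltnNge addn1 ltnS.
  by apply: leq_trans QT _; rewrite leq_exp2r.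
(* By minimality (T - 1)^10 < Q, and T <= 2 (T - 1); hence the constant 2^10. *)
have TQ : (T ^ 10 <= 1024 * Q)%N.
  have : ~~ (Q <= T.-1 ^ 10)%N by apply/negP => /minT; lia.
  rewrite -ltnNge => /ltnW h; apply: leq_trans (leq_mul (leqnn 1024) h).
  rewrite -[1024%N]/((2 ^ 10)%N) -expnMn leq_exp2r //.
  have T02 : (2 <= T0)%N by rewrite /T0 !leq_max leq_addl !orbT.
  by have := leq_ltn_trans T02 T0T; case: (T) => [|[|t]] // _; rewrite /= mulnS; lia.
move: (T0T); rewrite /T0 !gtn_max => /andP[/andP[t1 t2] /andP[t3 t4]].
have [l [ul sl lP]] := hT3 T (ltnW t3).
have Tpos : (0 < T)%N by apply: leq_ltn_trans T0T.
pose Yf n := if pselect (exists Y, P n Y) is left h then projT1 (cid h) else 0.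
have YfP n : n \in s -> P n (Yf n) /\ (`|n| <= T ^ 20)%N.
  move=> /hs[ex nQ]; split; last first.
    by apply: leq_trans nQ _; rewrite -[20%N]/((10 * 2)%N) expnM leq_exp2r.
  by rewrite /Yf; case: pselect => // h; case: cid.
have Ybd n : n \in s -> (`|Yf n| <= C * T ^ (20 * (size F).-1))%N.
  by move=> /YfP[[e _ _] nT]; apply: hC nT.
(* The points are sorted by the first of the m primes that does not divide G'(Y). *)
pose pf n := nth 0%N l (find (fun p => ~~ (p%:Z %| G^`().[Yf n])%Z) l).
have pfP n : n \in s -> pf n \in l /\ ~~ ((pf n)%:Z %| G^`().[Yf n])%Z.
  move=> ns; have [[_ _ d0] _] := YfP n ns.
  have [p pl hp] := hm T l (Yf n) (ltnW t2) ul sl lP (Ybd n ns) d0.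
  have hh : has (fun p => ~~ (p%:Z %| G^`().[Yf n])%Z) l by apply/hasP; exists p.
  by split; [rewrite mem_nth // -has_find|exact: nth_find hh].
have : (size s <= R * T ^ 9 * size l)%N.
  apply: (size_fibers (c := pf)) => [n /pfP[]//|p pl].
  have [pp pT] := lP p pl.
  apply: (hR T p _ Yf (ltnW t1)) => //; first exact: filter_uniq.
  move=> n; rewrite mem_filter => /andP[/eqP ep ns].
  have [[e1 e2 _] e3] := YfP n ns; have [_ ndv] := pfP n ns.
  by split=> //; [exact: Ybd|rewrite -ep].
rewrite sl => h; rewrite -(leq_pmul2l (isT : 0 < 1024)%N).
apply: leq_trans TQ; rewrite expnS.
apply: (@leq_trans (1024 * (K * (R * T ^ 9 * m)))%N); first by rewrite !leq_mul.
have -> : (1024 * (K * (R * T ^ 9 * m)) = K * R * m * 1024 * T ^ 9)%N by ring.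
by rewrite leq_mul //; lia.
Qed.

(** * The gap principle *)

Lemma small_opp (P : int -> Prop) : small P -> small (fun n => P (- n)).
Proof.
move=> sP K; have [Q0 hQ] := sP K; exists Q0 => Q /hQ{}hQ s us hs.
rewrite -(size_map -%R); apply: hQ; first by rewrite map_inj_uniq //; exact: oppr_inj.
by move=> _ /mapP[n /hs[Pn nQ] ->]; rewrite abszN.
Qed.

Lemma small_of_nonneg (P : int -> Prop) :
  small (fun n => P n /\ 0 <= n) -> small (fun n => P (- n) /\ 0 <= n) -> small P.
Proof.
move=> h1 /small_opp h2; apply: small_sub (smallU h1 h2) => n Pn.
have [n0|n0] := leP 0 n; [by left|right].
by rewrite opprK oppr_ge0 ltW.
Qed.

Lemma algC_nat_bound (x : algC) : exists N : nat, `|x| <= N%:R.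
Proof. by exists (Num.bound `|x|); apply/ltW/archi_boundP. Qed.

Lemma algC_nat_bounds (I : finType) (f : I -> algC) :
  exists N : nat, forall i, `|f i| <= N%:R.
Proof.
have /choice[g hg] : forall i, exists N : nat, `|f i| <= N%:R.
  by move=> i; exact: algC_nat_bound.
exists (\max_i g i)%N => i; apply: le_trans (hg i) _.
by rewrite ler_nat; exact: leq_bigmax.
Qed.

(* Near n the windows [(w j)^2, (w (j + 1))^2) have length about 2 w sqrt n. *)
Lemma square_windows (w n : nat) : (0 < w)%N ->
  exists j, ((w * j) ^ 2 <= n < (w * j.+1) ^ 2)%N.
Proof.
move=> w0; elim: n => [|n [j /andP[h1 h2]]].
  by exists 0%N; rewrite muln0 muln1 /= expn_gt0 w0.
have [le|lt] := ltnP n.+1 ((w * j.+1) ^ 2); first by exists j; rewrite le andbT leqW.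
exists j.+1; rewrite lt /=; apply: leq_ltn_trans h2 _.
by rewrite ltn_exp2r // ltn_pmul2l.
Qed.

(** Apart from the fixed initial segment, [0, Q^2] meets at most Q / w + 1 windows. *)
Lemma size_square_windows (w c j1 Q : nat) (s : seq int) : (0 < w)%N -> uniq s ->
  (forall n, n \in s -> 0 <= n /\ (`|n| <= Q ^ 2)%N) ->
  (forall j t, (j1 <= j)%N -> uniq t -> {subset t <= s} ->
    (forall n, n \in t -> ((w * j) ^ 2 <= `|n| < (w * j.+1) ^ 2)%N) ->
    (size t <= c)%N) ->
  (w * size s <= w * (w * j1) ^ 2 + c * (Q + w))%N.
Proof.
move=> w0 us hs ht.
have /choice[J hJ] : forall n : int, exists j, ((w * j) ^ 2 <= `|n| < (w * j.+1) ^ 2)%N.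
  by move=> n; exact: square_windows.
have hsz : (size s <= (w * j1) ^ 2 + c * (Q %/ w).+1)%N.
  pose small_n := fun n : int => (`|n| < (w * j1) ^ 2)%N.
  rewrite -(count_predC small_n) -!size_filter leq_add //.
    rewrite -(size_iota 0 ((w * j1) ^ 2)) -(size_map absz); apply: uniq_leq_size.
      rewrite map_inj_in_uniq ?filter_uniq // => x y; rewrite !mem_filter.
      move=> /andP[_ /hs[x0 _]] /andP[_ /hs[y0 _]] e.
      by rewrite -(gez0_abs x0) e gez0_abs.
    by move=> _ /mapP[n + ->]; rewrite mem_filter mem_iota /= => /andP[].
  rewrite -(size_iota 0 (Q %/ w).+1); apply: (size_fibers (c := J)) => [n|j].
    rewrite mem_filter => /andP[_ /hs[n0 nQ]]; rewrite mem_iota /= add0n ltnS.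
    have /andP[h _] := hJ n; rewrite leq_divRL // mulnC.
    by rewrite -(@leq_exp2r _ _ 2) // (leq_trans h).
  rewrite mem_iota => _; set t := [seq n <- _ | _].
  have tP n : n \in t -> [/\ J n = j, ((w * j1) ^ 2 <= `|n|)%N & n \in s].
    by rewrite !mem_filter /= -leqNgt => /andP[/eqP -> /andP[]].
  have [e|[n0 /tP[Jn hn _]]] : t = [::] \/ exists n, n \in t.
      by case: (t) => [|n ?]; [left|right; exists n; rewrite mem_head].
    by rewrite e.
  apply: (ht j) => [|||n /tP[<- _ _]//]; last by move=> n /tP[].
    have /andP[_ h2] := hJ n0; have := leq_ltn_trans hn h2.
    by rewrite ltn_exp2r // ltn_pmul2l // ltnS Jn.
  by rewrite !filter_uniq.
apply: leq_trans (leq_mul (leqnn w) hsz) _.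
rewrite mulnDr leq_add2l mulnCA leq_mul2l mulnS mulnC addnC leq_add2r leq_trunc_div.
by rewrite orbT.
Qed.

(** Dividing v^2 - v'^2 = m del by v - v' = u gives v + v' = m del / u, so 2 v = u + m del / u; the
    identity is the square of this divided by del. *)
Lemma gap_identity (A : numFieldType) (th del u v v' n m : A) :
  u != 0 -> del != 0 -> v ^+ 2 = (n - th) * del ->
  v' ^+ 2 = (n - m - th) * del -> v - v' = u ->
  4 * (n - th) = m ^+ 2 * (del / u ^+ 2) + 2 * m + u ^+ 2 / del.
Proof.
move=> u0 d0 e e' eu.
have e2 : 2 * u * v = m * del + u ^+ 2.
  have -> : 2 * u * v = v ^+ 2 - v' ^+ 2 + (v - v') ^+ 2 - 2 * v * (v - v' - u).
    by ring.
  by rewrite e e' eu; ring.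
have e4 : 4 * u ^+ 2 * ((n - th) * del) = (m * del + u ^+ 2) ^+ 2.
  by rewrite -e2 -e; ring.
apply: (@mulIf _ (u ^+ 2 * del)); first by rewrite mulf_neq0 // expf_neq0.
transitivity (4 * u ^+ 2 * ((n - th) * del)); first by ring.
by rewrite e4; field; rewrite u0 d0.
Qed.

(* With m = n - n' and eps = del/u^2, two values of m^2 would give eps0 = eps1 and
   then th0 = th1. *)
Lemma gap_pair (th0 th1 del0 del1 u0 u1 : algC) : th0 != th1 ->
  del0 != 0 -> del1 != 0 ->
  exists N0 : nat, forall (n n' : int) (v0 v0' v1 v1' : algC), n != n' ->
    v0 ^+ 2 = (n%:~R - th0) * del0 -> v0' ^+ 2 = (n'%:~R - th0) * del0 ->
    v1 ^+ 2 = (n%:~R - th1) * del1 -> v1' ^+ 2 = (n'%:~R - th1) * del1 ->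
    v0 - v0' = u0 -> v1 - v1' = u1 -> (`|n| <= N0)%N.
Proof.
move=> th01 d0 d1; pose e0 := del0 / u0 ^+ 2; pose e1 := del1 / u1 ^+ 2.
pose kap := (4 * (th1 - th0) - u0 ^+ 2 / del0 + u1 ^+ 2 / del1) / (e0 - e1).
have [N hN] := algC_nat_bound (4 * `|th0| + `|kap| * `|e0| + 2 * `|kap| +
   `|u0 ^+ 2 / del0|).
exists N => n n' v0 v0' v1 v1' nn' h0 h0' h1 h1' hu0 hu1.
have m0 : n - n' != 0 by rewrite subr_eq0.
pose m : algC := (n - n')%:~R.
have mne : m != 0 by rewrite intr_eq0.
have en' : n'%:~R = n%:~R - m :> algC by rewrite /m rmorphB /= ; ring.
have une (v v' th del u : algC) : del != 0 -> v ^+ 2 = (n%:~R - th) * del ->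
    v' ^+ 2 = (n'%:~R - th) * del -> v - v' = u -> u != 0.
  move=> dn h h' <-; rewrite subr_eq0; apply: contraNneq mne => e.
  have : m * del = 0.
    have -> : m * del = (n%:~R - th) * del - (n'%:~R - th) * del by rewrite en'; ring.
    by rewrite -h -h' e subrr.
  by move=> /eqP; rewrite mulf_eq0 (negPf dn) orbF.
have un0 := une _ _ _ _ _ d0 h0 h0' hu0; have un1 := une _ _ _ _ _ d1 h1 h1' hu1.
rewrite en' in h0' h1'.
have g0 := gap_identity un0 d0 h0 h0' hu0.
have g1 := gap_identity un1 d1 h1 h1' hu1.
rewrite -/e0 in g0; rewrite -/e1 in g1.
(* The difference of the two gap identities is free of n and of the term 2 m. *)
have edif : m ^+ 2 * (e0 - e1) =
    4 * (th1 - th0) - u0 ^+ 2 / del0 + u1 ^+ 2 / del1.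
  have -> : m ^+ 2 * (e0 - e1) = (m ^+ 2 * e0 + 2 * m + u0 ^+ 2 / del0) -
      (m ^+ 2 * e1 + 2 * m + u1 ^+ 2 / del1) - u0 ^+ 2 / del0 + u1 ^+ 2 / del1.
    by ring.
  by rewrite -g0 -g1; ring.
have ene : e0 - e1 != 0.
  rewrite subr_eq0; apply: contraNneq th01 => ee.
  have q : u0 ^+ 2 / del0 = u1 ^+ 2 / del1.
    have -> : u0 ^+ 2 / del0 = e0^-1 by rewrite /e0 invf_div.
    by rewrite ee /e1 invf_div.
  move: edif; rewrite ee subrr mulr0 q => /esym /eqP.
  rewrite subrK mulf_eq0 pnatr_eq0 /= subr_eq0 => /eqP->//.
have mk : m ^+ 2 = kap by rewrite /kap -edif mulfK.
have m1 : 1 <= `|m|.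
  by rewrite /m -intr_norm ler1z -gtz0_ge1 normr_gt0.
have mle : `|m| <= `|kap|.
  by rewrite -mk normrX -[leLHS]expr1; apply: ler_weXn2l.
have : `|n%:~R : algC| <= N%:R.
  apply: le_trans (le_trans (real_ler_norm _) hN); last first.
    by rewrite !realD ?realM ?normr_real ?realn.
  apply: (@le_trans _ _ `|4 * (n%:~R : algC)|).
    by rewrite normrM ler_peMl // normr_nat ler1n.
  have -> : 4 * (n%:~R : algC) = 4 * th0 + kap * e0 + 2 * m + u0 ^+ 2 / del0.
    transitivity (4 * (n%:~R - th0) + 4 * th0); first by ring.
    by rewrite g0 mk; ring.
  apply: le_trans (ler_normD _ _) _; rewrite lerD2r.
  apply: le_trans (ler_normD _ _) _; rewrite lerD //; last first.
    by rewrite normrM normr_nat ler_wpM2l.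
  by apply: le_trans (ler_normD _ _) _; rewrite !normrM normr_nat.
by rewrite -intr_norm -[N%:R]/((Posz N)%:~R) ler_int; lia.
Qed.

(** Were a = |v - v'| and b = |v + v'| both above H, then 2 H |v| <= H (a + b) < 2 a b <= 2 H
    |v|. *)
Lemma near_up_to_sign (v v' H : algC) : 0 <= H ->
  `|v ^+ 2 - v' ^+ 2| ^+ 2 <= H ^+ 2 * `|v| ^+ 2 ->
  `|v - v'| <= H \/ `|v + v'| <= H.
Proof.
move=> H0; rewrite -exprMn ler_pXn2r ?nnegrE ?mulr_ge0 // subr_sqr normrM.
set a := `|v - v'|; set b := `|v + v'| => hab.
have hR : H \is Num.real by apply: ger0_real.
have [aH|Ha] := real_leP (normr_real (v - v')) hR; first by left.
have [bH|Hb] := real_leP (normr_real (v + v')) hR; first by right.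
exfalso; rewrite -/a -/b in Ha Hb.
have h2 : 2 * `|v| <= a + b.
  have -> : 2 * `|v| = `|(v - v') + (v + v')|.
    rewrite -[2 * `|v|]/(2%:R * `|v|) -{1}(normr_nat algC 2) -normrM.
    by congr `|_|; ring.
  exact: ler_normD.
have a0 : 0 < a by apply: le_lt_trans Ha.
have b0 : 0 < b by apply: le_lt_trans Hb.
have l1 : H * b < a * b by rewrite ltr_pM2r.
have l2 : H * a < a * b by rewrite mulrC ltr_pM2l.
have : H * (2 * `|v|) < a * b + a * b.
  apply: le_lt_trans (ler_wpM2l H0 h2) _.
  by rewrite mulrDr ltrD.
have -> : H * (2 * `|v|) = H * `|v| + H * `|v| by ring.
by move=> /lt_le_trans /(_ (lerD hab hab)); rewrite ltxx.
Qed.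

(** In a window |n - n'| <= 3 w^2 j and |n - th| >= (w j)^2 / 2, so |v^2 - v'^2|^2 = |n - n'|^2
    |del|^2 is at most 18 w^2 |del| |v|^2. *)
Lemma window_near (th del v v' : algC) (n n' : int) (w j N H : nat) :
  `|th| <= N%:R -> (2 * N < j)%N -> 18 * w%:R ^+ 2 * `|del| <= H%:R ^+ 2 ->
  ((w * j) ^ 2 <= `|n| < (w * j.+1) ^ 2)%N -> 0 <= n ->
  ((w * j) ^ 2 <= `|n'| < (w * j.+1) ^ 2)%N -> 0 <= n' -> (0 < w)%N ->
  v ^+ 2 = (n%:~R - th) * del -> v' ^+ 2 = (n'%:~R - th) * del ->
  `|v - v'| <= H%:R \/ `|v + v'| <= H%:R.
Proof.
move=> hth hj hH /andP[n1 n2] n0 /andP[n1' n2'] n0' w0 e e'.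
apply: near_up_to_sign; first exact: ler0n.
have -> : v ^+ 2 - v' ^+ 2 = (n - n')%:~R * del by rewrite e e' rmorphB /=; ring.
have -> : `|v| ^+ 2 = `|n%:~R - th| * `|del| by rewrite -normrX e normrM.
rewrite normrM.
set a := `|del|; set X := `|n%:~R - th|; set m := `|_%:~R|.
have a0 : 0 <= a by exact: normr_ge0.
have X0 : 0 <= X by exact: normr_ge0.
have hm : m <= (3 * w ^ 2 * j)%:R.
  rewrite /m -intr_norm -[(3 * _ * _)%:R]/((Posz (3 * w ^ 2 * j))%:~R) ler_int.
  have j1 : (0 < j)%N by lia.
  have : ((w * j.+1) ^ 2 <= (w * j) ^ 2 + 3 * w ^ 2 * j)%N.
    by rewrite !expnMn -!mulnn; nia.
  by lia.
have hX : ((w * j) ^ 2)%:R <= 2 * X.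
  have h1 : `|n%:~R : algC| <= X + N%:R.
    rewrite -{1}[n%:~R](subrK th); apply: le_trans (ler_normD _ _) _.
    by rewrite lerD2l.
  have h2 : (2 * N <= (w * j) ^ 2)%N by rewrite expnMn -!mulnn; nia.
  have h3 : ((w * j) ^ 2)%:R <= `|n%:~R : algC|.
    by rewrite -intr_norm -[(_ ^ _)%:R]/((Posz ((w * j) ^ 2))%:~R) ler_int; lia.
  have h4 : 2 * N%:R <= ((w * j) ^ 2)%:R :> algC by rewrite -natrM ler_nat.
  rewrite -(lerD2r ((w * j) ^ 2)%:R).
  have -> : ((w * j) ^ 2)%:R + ((w * j) ^ 2)%:R = 2 * ((w * j) ^ 2)%:R :> algC.
    by ring.
  apply: le_trans (ler_wpM2l _ (le_trans h3 h1)) _; first exact: ler0n.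
  by rewrite mulrDr lerD2l.
have key : m ^+ 2 * a <= H%:R ^+ 2 * X.
  apply: (@le_trans _ _ (9 * w%:R ^+ 2 * (2 * X) * a)).
    rewrite ler_wpM2r //.
    apply: (@le_trans _ _ ((3 * w ^ 2 * j)%:R ^+ 2)).
      by rewrite ler_pXn2r ?nnegrE // normr_ge0.
    have -> : (3 * w ^ 2 * j)%:R ^+ 2 = 9 * w%:R ^+ 2 * ((w * j) ^ 2)%:R :> algC.
      by rewrite !(natrM, natrX); ring.
    by rewrite ler_wpM2l // mulr_ge0 ?exprn_ge0.
  have -> : 9 * w%:R ^+ 2 * (2 * X) * a = (18 * w%:R ^+ 2 * a) * X by ring.
  by rewrite ler_wpM2r.
have -> : (m * a) ^+ 2 = (m ^+ 2 * a) * a by ring.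
by rewrite mulrA ler_wpM2r.
Qed.

(* Inside a window each v i is within a constant of + or - the first one; two
   points with the same sign pattern have bounded, hence finitely many possible,
   difference, which [gap_pair] forbids far out. *)
Lemma gap_window (r : nat) (th : 'I_r -> algC) (i0 i1 : 'I_r)
  (Lam : {ffun 'I_r -> algC} -> Prop) (del : {ffun 'I_r -> algC}) (w : nat) :
  th i0 != th i1 ->
  (forall v v', Lam v -> Lam v' -> Lam [ffun i => v i - v' i]) ->
  (forall H : nat, exists l : seq {ffun 'I_r -> algC}, forall v, Lam v ->
    (forall i, `|v i| <= H%:R) -> v \in l) ->
  (forall i, del i != 0) -> (0 < w)%N ->
  exists j1 : nat, forall (j : nat) (t : seq int), (j1 <= j)%N -> uniq t ->
    (forall n, n \in t -> [/\ ((w * j) ^ 2 <= `|n| < (w * j.+1) ^ 2)%N, 0 <= n &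
      exists v, Lam v /\ forall i, v i ^+ 2 = (n%:~R - th i) * del i]) ->
    (size t <= 2 ^ r)%N.
Proof.
move=> th01 subL finL del0 w0.
have [Nt hNt] := algC_nat_bounds th; have [Nd hNd] := algC_nat_bounds del.
pose H := (18 * w ^ 2 * Nd + 1)%N.
have hH i : 18 * w%:R ^+ 2 * `|del i| <= H%:R ^+ 2.
  apply: (@le_trans _ _ (18 * w ^ 2 * Nd)%:R).
    by rewrite natrM natrM natrX ler_wpM2l // mulr_ge0 ?exprn_ge0.
  by rewrite -natrX ler_nat /H -mulnn; nia.
have [U hU] := finL (2 * H)%N.
have /choice[M hM] : forall u : {ffun 'I_r -> algC}, exists N0 : nat,
  forall (n n' : int) (v0 v0' v1 v1' : algC), n != n' ->
    v0 ^+ 2 = (n%:~R - th i0) * del i0 -> v0' ^+ 2 = (n'%:~R - th i0) * del i0 ->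
    v1 ^+ 2 = (n%:~R - th i1) * del i1 -> v1' ^+ 2 = (n'%:~R - th i1) * del i1 ->
    v0 - v0' = u i0 -> v1 - v1' = u i1 -> (`|n| <= N0)%N.
  by move=> u; apply: gap_pair.
(* U lists the possible differences of two points with the same signs; B bounds |n| for all of them
   at once. *)
pose B := (\max_(u <- U) M u)%N.
exists (maxn (B + 1) (2 * Nt + 1)) => j t; rewrite geq_max => /andP[jB jN] ut ht.
have [->//|[n0 n0t]] : t = [::] \/ exists n, n \in t.
  by case: (t) => [|n ?]; [left|right; exists n; rewrite mem_head].
pose good n (v : {ffun 'I_r -> algC}) :=
  Lam v /\ forall i, v i ^+ 2 = (n%:~R - th i) * del i.
have /choice[vf hvf] : forall n : int, exists v, n \in t -> good n v.
  move=> n; have [/ht[_ _ [v hv]]|_] := boolP (n \in t); first by exists v.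
  by exists [ffun=> 0].
pose sg n := [ffun i => `|vf n i - vf n0 i| <= H%:R].
have sgN n i : n \in t -> sg n i = false -> `|vf n i + vf n0 i| <= H%:R.
  move=> nt; rewrite ffunE => f.
  have [w1 z1 _] := ht n nt; have [w2 z2 _] := ht n0 n0t.
  have [_ e1] := hvf n nt; have [_ e2] := hvf n0 n0t.
  have jN' : (2 * Nt < j)%N by rewrite -addn1.
  have [|//] := window_near (hNt i) jN' (hH i) w1 z1 w2 z2 w0 (e1 i) (e2 i).
  by rewrite f.
have inj : {in t &, injective sg}.
  move=> n n' nt n't e; apply/eqP/negPn/negP => ne.
  have [[L1 e1] [L2 e2]] := (hvf n nt, hvf n' n't).
  have dU : [ffun i => vf n i - vf n' i] \in U.
    apply: hU => [|i]; first exact: subL.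
    rewrite ffunE natrM [2%:R](_ : _ = 1 + 1) // mulrDl !mul1r.
    case b : (sg n i); have b' := b; rewrite e in b'.
      have -> : vf n i - vf n' i = (vf n i - vf n0 i) + (vf n0 i - vf n' i) by ring.
      apply: le_trans (ler_normD _ _) _; rewrite lerD //; first by rewrite ffunE in b.
      by rewrite distrC; rewrite ffunE in b'.
    have -> : vf n i - vf n' i = (vf n i + vf n0 i) - (vf n' i + vf n0 i) by ring.
    by apply: le_trans (ler_normB _ _) _; rewrite lerD // sgN.
  have nB : (`|n| <= B)%N.
    apply: leq_trans (leq_bigmax_seq _ dU isT).
    by apply: (hM _ n n' _ _ _ _ ne (e1 i0) (e2 i0) (e1 i1) (e2 i1)); rewrite ffunE.
  have [/andP[w1 _] _ _] := ht n nt.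
  have : (j <= (w * j) ^ 2)%N by rewrite expnMn -!mulnn; nia.
  by lia.
rewrite -(size_map sg) -card_bool -[r in (_ ^ r)%N]card_ord -card_ffun.
have /card_uniqP <- : uniq [seq sg n | n <- t] by rewrite map_inj_in_uniq.
exact: max_card.
Qed.

(** [Lam] abstracts the conjugate vectors of a lattice: closed under differences, with finite
    bounded parts. This covers both Z[theta] and Z x Z. *)
Lemma gap_small (r : nat) (th : 'I_r -> algC) (i0 i1 : 'I_r)
  (Lam : {ffun 'I_r -> algC} -> Prop) (Del : seq {ffun 'I_r -> algC}) :
  th i0 != th i1 ->
  (forall v v', Lam v -> Lam v' -> Lam [ffun i => v i - v' i]) ->
  (forall H : nat, exists l : seq {ffun 'I_r -> algC}, forall v, Lam v ->
    (forall i, `|v i| <= H%:R) -> v \in l) ->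
  (forall del, del \in Del -> forall i, del i != 0) ->
  small (fun n => exists2 del, del \in Del & exists v, Lam v /\
    forall i, v i ^+ 2 = (n%:~R - th i) * del i).
Proof.
move=> th01 subL finL Del0.
have nonneg (th' : 'I_r -> algC) (del : {ffun 'I_r -> algC}) :
    th' i0 != th' i1 -> (forall i, del i != 0) ->
    small (fun n => (exists v, Lam v /\
      forall i, v i ^+ 2 = (n%:~R - th' i) * del i) /\ 0 <= n).
  (* The bound 2^r per window is independent of w, so this w brings the main term 2^r Q / w below Q
     / (2 K). *)
  move=> th01' del0 K; pose w := (2 * K * 2 ^ r + 1)%N.
  have w0 : (0 < w)%N by rewrite /w addn1.
  have [j1 hj1] := gap_window th01' subL finL del0 w0.
  exists (2 * (K * (w * j1) ^ 2 + K * 2 ^ r))%N => Q hQ s us hs.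
  have := @size_square_windows w (2 ^ r) j1 Q s w0 us.
  have h1 : forall n, n \in s -> 0 <= n /\ (`|n| <= Q ^ 2)%N.
    by move=> n /hs[[_ n0] nQ].
  have h2 : forall j t, (j1 <= j)%N -> uniq t -> {subset t <= s} ->
    (forall n, n \in t -> ((w * j) ^ 2 <= `|n| < (w * j.+1) ^ 2)%N) ->
    (size t <= 2 ^ r)%N.
    move=> j t jj ut ts ht; apply: (hj1 j) => // n nt.
    have [[ex n0] _] := hs n (ts n nt).
    by split=> //; exact: ht.
  move=> /(_ h1 h2) h; rewrite -(leq_pmul2l w0).
  apply: (@leq_trans (K * (w * (w * j1) ^ 2 + 2 ^ r * (Q + w)))%N).
    by rewrite mulnCA leq_mul2l h orbT.
  have ew : w = (2 * (K * 2 ^ r) + 1)%N by rewrite /w mulnA.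
  have e1 := leq_mul (leqnn w) hQ.
  have e2 : (2 * (K * 2 ^ r) * Q <= w * Q)%N by rewrite ew leq_mul // leq_addr.
  move: e1 e2; move: ((w * j1) ^ 2)%N (2 ^ r)%N => x y; clear; nia.
apply: small_seq => del /Del0 d0; apply: small_of_nonneg; first exact: nonneg.
(* For negative arguments, (- n - th) del = (n - (- th)) (- del). *)
apply: (@small_sub _ (fun n => (exists v, Lam v /\
    forall i, v i ^+ 2 = (n%:~R - - th i) * [ffun i => - del i] i) /\ 0 <= n)).
  move=> n [[v [Lv e]] n0]; split=> //; exists v; split=> // i.
  by rewrite e ffunE rmorphN /=; ring.
apply: nonneg => [|i]; first by rewrite (inj_eq oppr_inj).
by rewrite ffunE oppr_eq0.
Qed.

(** * Square values of polynomials *)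

Lemma coprime_mul_square (a b c : nat) : (0 < c)%N -> coprime a b ->
  (a * b = c ^ 2)%N -> exists e, (a = e ^ 2)%N.
Proof.
move=> c0 cab e2; pose e := gcdn a c; exists e.
have e0 : (0 < e)%N by rewrite gcdn_gt0 c0 orbT.
have /dvdnP[a' ea] : (e %| a)%N by exact: dvdn_gcdl.
have /dvdnP[c' ec] : (e %| c)%N by exact: dvdn_gcdr.
have cop : coprime a' c'.
  have : (gcdn a' c' * e = 1 * e)%N by rewrite muln_gcdl -ea -ec mul1n.
  by move=> /eqP; rewrite eqn_pmul2r.
have e3 : (a' * b = e * c' ^ 2)%N.
  apply/eqP; rewrite -(eqn_pmul2r e0); apply/eqP.
  by rewrite mulnAC -ea e2 ec expnMn -!mulnn; ring.
have d1 : (a' %| e)%N.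
  have : (a' %| e * c' ^ 2)%N by rewrite -e3 dvdn_mulr.
  by rewrite Gauss_dvdl // coprimeXr.
have d2 : (e %| a')%N.
  have : (e %| a' * b)%N by rewrite e3 dvdn_mulr.
  by rewrite Gauss_dvdl // (coprime_dvdl _ cab) // dvdn_gcdl.
by rewrite {1}ea; have /eqP-> : a' == e by rewrite eqn_dvd d1 d2.
Qed.

Notation pZtoQ := (map_poly (intr : int -> rat)).

Lemma pZtoQ_horner (P : {poly int}) (n : int) : (pZtoQ P).[n%:~R] = (P.[n])%:~R.
Proof. by rewrite horner_map. Qed.

Lemma int_Bezout (S D : {poly int}) : coprimep (pZtoQ S) (pZtoQ D) ->
  exists (U V : {poly int}) (rho : int), rho != 0 /\ U * S + V * D = rho%:P.
Proof.
move=> /Bezout_coprimepP[[u v] /=].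
rewrite -size_poly_eq1 => /size_poly1P[c c0 e].
have [U [a a0 eu]] := rat_poly_scale u; have [V [b b0 ev]] := rat_poly_scale v.
exists ((b * denq c)%:P * U), ((a * denq c)%:P * V), (a * b * numq c).
split; first by rewrite !mulf_neq0 // numq_eq0.
apply: (@map_inj_poly _ _ (intr : int -> rat)); [exact: intr_inj|by []|].
have e1 : (a%:~R : rat)%:P * u = pZtoQ U.
  by rewrite eu mul_polyC scalerA mulfV ?intr_eq0 // scale1r.
have e2 : (b%:~R : rat)%:P * v = pZtoQ V.
  by rewrite ev mul_polyC scalerA mulfV ?intr_eq0 // scale1r.
rewrite rmorphD !rmorphM /= !map_polyC /= -e1 -e2 ?rmorphM /= ?polyCM.
by rewrite numqE polyCM -e; ring.
Qed.

(** The gcd of S(n) and D(n) divides the Bezout constant rho; the cofactors are coprime with a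
    square product, hence squares up to sign. So gam is the gcd with the sign of S(n). *)
Lemma split_square_value (S D : {poly int}) : coprimep (pZtoQ S) (pZtoQ D) ->
  exists rho : nat, (0 < rho)%N /\ forall n w : int,
    S.[n] * D.[n] = w ^+ 2 -> S.[n] != 0 -> D.[n] != 0 ->
    exists gam e : int, (`|gam| <= rho)%N /\ S.[n] = gam * e ^+ 2.
Proof.
move=> /int_Bezout[U [V [rho [rho0 eB]]]]; exists `|rho|%N.
split=> [|n w e S0 D0]; first by rewrite absz_gt0.
have w0 : (0 < `|w|)%N.
  rewrite absz_gt0; apply: contra_eq_neq e => ->.
  by rewrite expr0n mulf_neq0.
set s := `|S.[n]|%N; set d := `|D.[n]|%N.
have s0 : (0 < s)%N by rewrite absz_gt0.
pose g := gcdn s d.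
have g0 : (0 < g)%N by rewrite gcdn_gt0 s0.
have grho : (g %| `|rho|)%N.
  have -> : rho = U.[n] * S.[n] + V.[n] * D.[n].
    by have := congr1 (horner^~ n) eB; rewrite !hornerE => <-.
  have gz (x : int) : (g %| `|x|)%N = (g%:Z %| x)%Z by rewrite dvdzE absz_nat.
  by rewrite gz rpredD // dvdz_mull // -gz ?dvdn_gcdl ?dvdn_gcdr.
have /dvdnP[a ea] : (g %| s)%N by exact: dvdn_gcdl.
have /dvdnP[b eb] : (g %| d)%N by exact: dvdn_gcdr.
have cab : coprime a b.
  have : (gcdn a b * g = 1 * g)%N by rewrite muln_gcdl -ea -eb mul1n.
  by move=> /eqP; rewrite eqn_pmul2r.
have esd : (s * d = `|w| ^ 2)%N by rewrite /s /d -abszM e abszX.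
have /dvdnP[c ec] : (g %| `|w|)%N.
  rewrite -(@dvdn_pexp2r _ _ 2) // -esd ea eb mulnACA -mulnn.
  by rewrite dvdn_mull.
have eab : (a * b = c ^ 2)%N.
  apply/eqP; rewrite -(@eqn_pmul2r (g ^ 2)) ?expn_gt0 ?g0 //; apply/eqP.
  by rewrite -expnMn -ec -esd ea eb -mulnn mulnACA.
have c0 : (0 < c)%N by move: w0; rewrite ec muln_gt0 => /andP[].
have [f ef] := coprime_mul_square c0 cab eab.
exists (Num.sg S.[n] * g%:Z), f%:Z; split.
  by rewrite abszM absz_nat absz_sg S0 mul1n dvdn_leq // absz_gt0.
rewrite {1}[S.[n]]numEsg -abszE -/s ea ef PoszM -mulrA; congr (_ * _).
by rewrite mulrC -[(f ^ 2)%N%:Z]natz natrX natz.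
Qed.

(* Pigeonhole in the lattice of all v with gam e | v(n), of index about n^(r/2). *)
Lemma small_lattice_vector (S : {poly int}) (rho : nat) : (1 < size S)%N ->
  (0 < rho)%N -> exists C : nat, (0 < C)%N /\ forall n gam e : int,
    (`|gam| <= rho)%N -> S.[n] = gam * e ^+ 2 -> S.[n] != 0 -> n != 0 ->
    exists (v : {poly int}) (A : nat), [/\ v != 0, (size v < size S)%N,
      (forall i, (`|(v`_i)%R| <= A)%N), (A ^ 2 <= C * `|n|)%N &
      (S.[n] %| v.[n] ^+ 2)%Z].
Proof.
move=> sS rho0; pose C := (rho * (coef_norm S + 1))%N.
have C0 : (0 < C)%N by rewrite muln_gt0 rho0 addn1.
exists C; split=> // n gam e hg eS S0 n0.
have N0 : (0 < `|n|)%N by rewrite absz_gt0.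
pose r := (size S).-1; have er : size S = r.+1 by rewrite prednK // ltnW.
have r0 : (0 < r)%N by rewrite -ltnS -er.
(* With w = 1 this is the integer square root of C |n|. *)
have [A /andP[hA hA1]] := square_windows (C * `|n|) (ltn0Sn 0).
rewrite !mul1n in hA hA1.
have [m em] : exists m, m = `|(gam * e)%R|%N by exists `|(gam * e)%R|%N.
have m0 : (0 < m)%N.
  by rewrite em absz_gt0; apply: contraNneq S0; rewrite eS expr2 mulrA => ->; rewrite mul0r.
(* There are more coefficient vectors than residues: m^2 = |gam| |S(n)| <= (C |n|)^r < (A + 1)^(2
   r). *)
have mH : (m < A.+1 ^ r)%N.
  rewrite -(@ltn_exp2r _ _ 2) // -expnM mulnC expnM.
  apply: leq_ltn_trans (_ : (C * `|n|) ^ r < _)%N; last by rewrite ltn_exp2r.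
  have -> : (m ^ 2 = `|gam| * `|(S.[n])%R|)%N.
    by rewrite eS expr2 em !abszM -mulnn; ring.
  apply: leq_trans (leq_mul hg (horner_abs_le S (leqnn _) N0)) _.
  rewrite -/r expnMn mulnA leq_mul2r; apply/orP; right.
  apply: (@leq_trans C); first by rewrite leq_mul2l leq_addr orbT.
  by rewrite -{1}[C]expn1 leq_pexp2l.
pose T : finType := {ffun 'I_r -> 'I_A.+1}.
pose P (a : T) : {poly int} :=
  \poly_(i < r) (Posz (nth 0%N [seq val (a k) | k <- enum 'I_r] i)).
have Pc (a : T) (i : 'I_r) : (P a)`_i = Posz (a i).
  by rewrite coef_poly ltn_ord (nth_map i) ?size_enum_ord // nth_ord_enum.
have lt (a : T) : (`|((P a).[n] %% m)%Z| < m)%N.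
  by rewrite -ltz_nat gez0_abs ?modz_ge0 ?ltz_pmod // eqz_nat -lt0n.
have [|//|a [b [_ _ ab e1]]] :=
  @pigeonhole T 'I_m predT predT (fun a => Ordinal (lt a)).
  by [].
  rewrite [X in (X < _)%N](_ : _ = #|'I_m|) // [X in (_ < X)%N](_ : _ = #|T|) //.
  by rewrite card_ffun !card_ord.
exists (P a - P b), A; split=> //.
- rewrite subr_eq0; apply: contraNneq ab => e2; apply/eqP/ffunP => i; apply/val_inj.
  by have := congr1 (fun p : {poly int} => p`_i) e2; rewrite !Pc => -[].
- rewrite er ltnS; apply: leq_trans (size_polyD _ _) _.
  by rewrite size_polyN geq_max !size_poly.
- move=> i; have [ir|ri] := ltnP i r.
    rewrite coefB (Pc a (Ordinal ir)) (Pc b (Ordinal ir)).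
    by have := ltn_ord (a (Ordinal ir)); have := ltn_ord (b (Ordinal ir)); lia.
  by rewrite coefB !coef_poly !ltnNge ri subr0.
have dm : (m%:Z %| (P a - P b).[n])%Z.
  rewrite hornerD hornerN -eqz_mod_dvd; apply/eqP.
  have := congr1 (fun x : 'I_m => Posz x) e1.
  have mz : m%:Z != 0 by rewrite eqz_nat -lt0n.
  by rewrite /= !gez0_abs ?modz_ge0.
apply: (@dvdz_trans (m%:Z ^+ 2)); last by rewrite dvdz_exp2r.
rewrite dvdzE abszX absz_nat em eS expr2 !abszM.
by rewrite expnMn -!mulnn -mulnA dvdn_mull.
Qed.

(** With t = v(n)^2 / S(n), the polynomial v^2 - t S vanishes at n, so it is (x - n) q. Then del is
    minus the remainder of q modulo S, and S(x) = 0 leaves the identity. *)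
Lemma descent_identity (S v : {poly int}) (n : int) : S \is monic ->
  (S.[n] %| v.[n] ^+ 2)%Z ->
  exists del : {poly int}, (size del < size S)%N /\
    forall (A : comNzRingType) (x : A), (map_poly intr S).[x] = 0 ->
      (map_poly intr v).[x] ^+ 2 = (n%:~R - x) * (map_poly intr del).[x].
Proof.
move=> mS /dvdzP[t et].
have : root (v ^+ 2 - t%:P * S) n.
  by rewrite /root hornerD hornerN horner_exp hornerM hornerC et subrr.
move=> /factor_theorem[q eq].
rewrite {1}(Pdiv.RingMonic.rdivp_eq mS q) in eq.
exists (- Pdiv.Ring.rmodp q S); split.
  by rewrite size_polyN Pdiv.Ring.ltn_rmodpN0 // monic_neq0.
move=> A x Sx.
have := congr1 (fun p : {poly int} => (map_poly (intr : int -> A) p).[x]) eq.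
rewrite !(rmorphB, rmorphD, rmorphM, rmorphXn, rmorphN) /=.
rewrite !(hornerD, hornerN, horner_exp, hornerM) Sx !mulr0 subr0 add0r expr2 => ->.
by rewrite map_polyX map_polyC /= hornerX hornerC; ring.
Qed.

Lemma small_abs_le (N : nat) : small (fun n => (`|n| <= N)%N).
Proof.
apply: small_sub (small_finite [seq i%:Z - N%:Z | i <- iota 0 (2 * N).+1]) => n nN.
by apply/mapP; exists `|(n + N%:Z)%R|%N; [rewrite mem_iota /=|]; lia.
Qed.

Notation pZtoC := (map_poly (intr : int -> algC)).

Lemma pZtoC_ratr (p : {poly int}) : pZtoC p = map_poly ratr (pZtoQ p).
Proof. by rewrite -map_poly_comp; apply: eq_map_poly => x /=; rewrite ratr_int. Qed.

(** The inverse of the Vandermonde matrix recovers the integer coefficients from the values, so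
    bounded values mean bounded coefficients. *)
Lemma bounded_values_finite (r : nat) (th : 'I_r -> algC) : injective th ->
  forall H : nat, exists l : seq {ffun 'I_r -> algC}, forall p : {poly int},
    (size p <= r)%N -> (forall i, `|(pZtoC p).[th i]| <= H%:R) ->
    [ffun i => (pZtoC p).[th i]] \in l.
Proof.
move=> injth H; pose V := Vandermonde r (\row_j th j).
have uV : V \in unitmx.
  rewrite unitmxE det_Vandermonde unitfE; apply/prodf_neq0 => i _.
  apply/prodf_neq0 => j ij; rewrite !mxE subr_eq0 (inj_eq injth).
  by apply: contraTneq ij => ->; rewrite ltnn.
pose W := invmx V.
have [N hN] := algC_nat_bounds (fun i => \sum_j H%:R * `|W j i|).
pose ev (a : {ffun 'I_r -> 'I_(2 * N).+1}) : {ffun 'I_r -> algC} :=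
  [ffun i => \sum_k ((a k)%:Z - N%:Z)%:~R * th i ^+ k].
exists [seq ev a | a <- enum {ffun 'I_r -> 'I_(2 * N).+1}] => p sp hp.
have hor i : (pZtoC p).[th i] = \sum_(k < r) (p`_k)%:~R * th i ^+ k.
  rewrite (@horner_coef_wide _ r) ?(leq_trans (size_poly _ _)) //.
  by apply: eq_bigr => k _; rewrite coef_map.
pose c : 'rV[algC]_r := \row_k (p`_k)%:~R.
have cV : c *m V = \row_i (pZtoC p).[th i].
  by apply/rowP => i; rewrite !mxE hor; apply: eq_bigr => k _; rewrite !mxE.
have pN (k : 'I_r) : (`|(p`_k)%R| <= N)%N.
  have -> : ((`|(p`_k)%R| <= N)%N) = (`|(p`_k)%:~R : algC| <= N%:R).
    by rewrite -intr_norm -[N%:R]/((Posz N)%:~R) ler_int; apply/idP/idP; lia.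
  have -> : (p`_k)%:~R = (c *m V *m W) 0 k by rewrite /W mulmxK // mxE.
  rewrite cV mxE; apply: le_trans (hN k); apply: le_trans (real_ler_norm _); last first.
    by apply: rpred_sum => j _; rewrite rpredM ?normr_real ?realn.
  apply: le_trans (ler_norm_sum _ _ _) _; apply: ler_sum => j _.
  by rewrite mxE normrM ler_wpM2r.
apply/mapP; exists [ffun k : 'I_r => inord `|(p`_k + N%:Z)%R|%N].
  by rewrite mem_enum.
apply/ffunP => i; rewrite !ffunE hor; apply: eq_bigr => k _; rewrite ffunE inordK.
  by congr (_%:~R * _); have := pN k; lia.
by have := pN k; lia.
Qed.

Lemma small_irreducible_values (S : {poly int}) (rho : nat) : S \is monic ->
  irreducible_poly (pZtoQ S) -> (2 < size S)%N -> (0 < rho)%N ->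
  small (fun n => S.[n] != 0 /\ exists gam e : int, (`|gam| <= rho)%N /\
    S.[n] = gam * e ^+ 2).
Proof.
move=> mS irrS sS rho0.
have szQ p : size (pZtoQ p) = size p by rewrite size_map_inj_poly //; exact: intr_inj.
have [rs ers] := closed_field_poly_normal (pZtoC S).
rewrite (monicP (monic_map _ mS)) scale1r in ers.
have urs : uniq rs.
  rewrite -separable_prod_XsubC -ers pZtoC_ratr separable_map separable_poly.unlock.
  have dS0 : (pZtoQ S)^`() != 0 by rewrite deriv_neq0 // szQ ltnW.
  rewrite irreducible_poly_coprime //; apply/negP => /(dvdp_leq dS0).
  by rewrite leqNgt lt_size_deriv // -size_poly_gt0 szQ ltnW // ltnW.
have srs : size S = (size rs).+1.
  rewrite -(size_prod_XsubC rs id) /= -ers size_map_poly_id0 //.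
  by rewrite (monicP mS) oner_eq0.
set r := size rs in srs.
have r2 : (1 < r)%N by rewrite -ltnS -srs.
pose th (i : 'I_r) := rs`_i.
have thinj : injective th.
  by move=> i j /eqP; rewrite nth_uniq // => /eqP/val_inj.
have throot i : (pZtoC S).[th i] = 0.
  by apply/eqP; rewrite -/(root _ _) ers root_prod_XsubC mem_nth.
pose Lam (v : {ffun 'I_r -> algC}) := exists p : {poly int},
  (size p <= r)%N /\ v = [ffun i => (pZtoC p).[th i]].
have sS' : (1 < size S)%N := ltn_trans (ltnSn 1) sS.
have [C [C0 hC]] := small_lattice_vector sS' rho0.
have [Nt hNt] := algC_nat_bounds th.
have [Np hNp] := algC_nat_bounds (fun i => \sum_(k < r) `|th i| ^+ k).
(* The bound on del: |n| / 2 <= |n - th i| for large n, while |v(th i)|^2 <= A^2 Np^2 <= C |n|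
   Np^2. *)
have [l hl] := bounded_values_finite thinj (2 * C * Np ^ 2).
pose Del := [seq d : {ffun 'I_r -> algC} <- l | [forall i, d i != 0]].
have th01 : th (Ordinal (ltnW r2)) != th (Ordinal r2) by rewrite (inj_eq thinj).
have Lsub v v' : Lam v -> Lam v' -> Lam [ffun i => v i - v' i].
  move=> [p [sp ->]] [p' [sp' ->]]; exists (p - p'); split.
    by rewrite (leq_trans (size_polyD _ _)) // size_polyN geq_max sp.
  by apply/ffunP => i; rewrite !ffunE rmorphB /= hornerD hornerN.
have Lfin (H : nat) : exists l : seq {ffun 'I_r -> algC}, forall v, Lam v ->
    (forall i, `|v i| <= H%:R) -> v \in l.
  have [l' hl'] := bounded_values_finite thinj H; exists l' => v [p [sp ->]] hv.
  by apply: hl' => // i; have := hv i; rewrite ffunE.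
have Del0 d : d \in Del -> forall i, d i != 0.
  by rewrite mem_filter => /andP[/forallP].
apply: small_sub (smallU (gap_small th01 Lsub Lfin Del0) (small_abs_le (2 * Nt))).
move=> n [Sn [gam [e [hg eS]]]].
have [nN|nN] := leqP `|n| (2 * Nt); [by right|left].
have n0 : n != 0 by apply: contraTneq nN => ->; rewrite absz0.
have [v [A [v0 sv hA A2 dS]]] := hC n gam e hg eS Sn n0.
have [d [sd hd]] := descent_identity mS dS.
have hdi i : (pZtoC v).[th i] ^+ 2 = (n%:~R - th i) * (pZtoC d).[th i].
  exact: hd (throot i).
(* A nonzero v of degree below that of the irreducible S shares no root with it. *)
have vi0 i : (pZtoC v).[th i] != 0.
  apply: (@coprimep_root _ (pZtoC S)); last by rewrite /root throot.
  rewrite !pZtoC_ratr coprimep_map irreducible_poly_coprime //.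
  apply/negP => /dvdp_leq; rewrite -size_poly_gt0 !szQ size_poly_gt0 => /(_ v0).
  by rewrite leqNgt sv.
have di0 i : (pZtoC d).[th i] != 0.
  apply: contra_neq (vi0 i) => z.
  by have /eqP := hdi i; rewrite z mulr0 expf_eq0 /= => /eqP.
have sv' : (size v <= r)%N by rewrite -ltnS -srs.
have nat_int (x : int) : `|x%:~R : algC| = (`|x|%N)%:R.
  by rewrite -intr_norm -abszE.
have vle i : `|(pZtoC v).[th i]| <= A%:R * Np%:R.
  rewrite (@horner_coef_wide _ r) ?(leq_trans (size_poly _ _)) //.
  apply: le_trans (ler_norm_sum _ _ _) _.
  apply: (@le_trans _ _ (\sum_(k < r) A%:R * `|th i| ^+ k)).
    apply: ler_sum => k _; rewrite normrM normrX ler_wpM2r ?exprn_ge0 //.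
    by rewrite coef_map nat_int ler_nat.
  rewrite -mulr_sumr ler_wpM2l ?ler0n //; apply: le_trans (hNp i).
  by apply: real_ler_norm; apply: rpred_sum => k _; rewrite rpredX ?normr_real.
have dle i : `|(pZtoC d).[th i]| <= (2 * C * Np ^ 2)%:R.
  have npos : (0 : algC) < (`|n|%N)%:R by rewrite ltr0n absz_gt0.
  rewrite -(ler_pM2r npos).
  have nth : (`|n|%N)%:R <= 2 * `|n%:~R - th i|.
    have h1 : (`|n|%N)%:R <= `|n%:~R - th i| + Nt%:R.
      rewrite -nat_int -{1}[n%:~R](subrK (th i)); apply: le_trans (ler_normD _ _) _.
      by rewrite lerD2l.
    have h2 : 2 * Nt%:R <= (`|n|%N)%:R :> algC by rewrite -natrM ler_nat ltnW.
    rewrite -(lerD2r (`|n|%N)%:R).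
    have -> : (`|n|%N)%:R + (`|n|%N)%:R = 2 * (`|n|%N)%:R :> algC by ring.
    apply: le_trans (ler_wpM2l _ h1) _; first exact: ler0n.
    by rewrite mulrDr lerD2l.
  apply: le_trans (ler_wpM2l (normr_ge0 _) nth) _.
  rewrite mulrCA -normrM [X in `|X|]mulrC -hdi normrX.
  apply: (@le_trans _ _ (2 * (A%:R * Np%:R) ^+ 2)).
    rewrite ler_wpM2l ?ler0n // ler_pXn2r ?nnegrE ?mulr_ge0 ?ler0n //.
  rewrite -natrM -natrX -!natrM ler_nat expnMn.
  have -> : (2 * C * Np ^ 2 * `|n| = 2 * ((C * `|n|) * Np ^ 2))%N by ring.
  by rewrite leq_mul2l /= leq_mul2r A2 orbT.
have sd' : (size d <= r)%N by rewrite -ltnS -srs.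
exists [ffun i => (pZtoC d).[th i]].
  rewrite mem_filter hl // andbT; apply/forallP => i.
  by rewrite ffunE di0.
exists [ffun i => (pZtoC v).[th i]]; split.
  by exists v.
by move=> i; rewrite !ffunE hdi.
Qed.

Lemma int_box_finite (I : finType) (N : nat) : exists l : seq {ffun I -> int},
  forall f : {ffun I -> int}, (forall i, `|f i| <= N)%N -> f \in l.
Proof.
exists [seq [ffun i => (a i : nat)%:Z - N%:Z] | a : {ffun I -> 'I_(2 * N).+1}].
move=> f hf; apply/mapP; exists [ffun i => inord `|(f i + N%:Z)%R|%N].
  by rewrite mem_enum.
apply/ffunP => i; rewrite !ffunE inordK; first by move: (f i) (hf i) => z; lia.
by move: (f i) (hf i) => z; lia.
Qed.

(** The split case of the descent: Q x Q replaces Q[theta], the pair e1, e2 replaces v, and del = 1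
    / gam runs through a finite set. *)
Lemma small_linear_pair (b1 b2 : int) (rho : nat) : b1 != b2 ->
  small (fun n => [/\ n != b1, n != b2 & exists gam1 gam2 e1 e2 : int,
    [/\ (`|gam1| <= rho)%N, (`|gam2| <= rho)%N,
        n - b1 = gam1 * e1 ^+ 2 & n - b2 = gam2 * e2 ^+ 2]]).
Proof.
move=> b12; pose pr (A : Type) (x y : A) (i : 'I_2) := if i == ord0 then x else y.
pose toC (f : {ffun 'I_2 -> int}) : {ffun 'I_2 -> algC} := [ffun i => (f i)%:~R].
pose th (i : 'I_2) : algC := (pr _ b1 b2 i)%:~R.
pose Lam v := exists f, v = toC f.
have th01 : th ord0 != th ord_max by rewrite eqr_int.
have Lsub v v' : Lam v -> Lam v' -> Lam [ffun i => v i - v' i].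
  move=> [f ->] [f' ->]; exists [ffun i => f i - f' i].
  by apply/ffunP => i; rewrite !ffunE rmorphB.
have Lfin (H : nat) : exists l : seq {ffun 'I_2 -> algC}, forall v, Lam v ->
    (forall i, `|v i| <= H%:R) -> v \in l.
  have [l hl] := int_box_finite 'I_2 H; exists [seq toC f | f <- l] => v [f ->] hv.
  apply/map_f/hl => i; have := hv i; rewrite ffunE -intr_norm.
  by rewrite -[H%:R]/((Posz H)%:~R) ler_int; move: (f i) => z; lia.
have [l hl] := int_box_finite 'I_2 rho.
(* The filter removes the entries with gam = 0, whose inverse is 0 by convention. *)
pose Del : seq {ffun 'I_2 -> algC} :=
  [seq d : {ffun 'I_2 -> algC} <-
    [seq [ffun i => (f i)%:~R^-1] | f : {ffun 'I_2 -> int} <- l] |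
    [forall i, d i != 0]].
have Del0 d : d \in Del -> forall i, d i != 0.
  by rewrite mem_filter => /andP[/forallP].
apply: small_sub (gap_small th01 Lsub Lfin Del0) => n.
move=> [nb1 nb2 [gam1 [gam2 [e1 [e2 [h1 h2 h3 h4]]]]]].
have g1 : gam1 != 0 by apply: contraNneq nb1 => z; rewrite -subr_eq0 h3 z mul0r.
have g2 : gam2 != 0 by apply: contraNneq nb2 => z; rewrite -subr_eq0 h4 z mul0r.
pose f : {ffun 'I_2 -> int} := [ffun i => pr _ gam1 gam2 i].
exists [ffun i => (f i)%:~R^-1].
  rewrite mem_filter; apply/andP; split.
    by apply/forallP => i; rewrite !ffunE invr_eq0 intr_eq0 /pr; case: ifP.
  by apply: map_f; apply: hl => i; rewrite ffunE /pr; case: ifP.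
exists (toC [ffun i => pr _ e1 e2 i]); split; first by eexists.
have key (b gam e : int) : gam != 0 -> n - b = gam * e ^+ 2 ->
    (e%:~R : algC) ^+ 2 = (n%:~R - b%:~R) * gam%:~R^-1.
  move=> g0 eb; rewrite -rmorphB /= eb rmorphM rmorphXn /= mulrAC mulfV ?mul1r //.
  by rewrite intr_eq0.
by move=> i; rewrite !ffunE /th /pr; case: ifP => _; apply: key.
Qed.

Lemma rat_sqrt_int (x : rat) (z : int) : z%:~R = x ^+ 2 ->
  exists w : int, x = w%:~R.
Proof.
move=> e; exists (numq x).
have d0 : (denq x)%:~R != 0 :> rat by rewrite intr_eq0 denq_neq0.
have e1 : z * denq x ^+ 2 = numq x ^+ 2.
  apply: (intr_inj (R := rat)); rewrite rmorphM !rmorphXn /= e.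
  by rewrite -exprMn -[X in X * _]divq_num_den mulfVK.
have dv : (`|denq x| %| `|numq x|)%N.
  by rewrite -(@dvdn_pexp2r _ _ 2) // -!abszX -e1 abszM dvdn_mull.
have d1 : denq x = 1.
  have := coprime_num_den x; rewrite /coprime gcdnC (gcdn_idPl dv).
  by have := denq_gt0 x; lia.
by rewrite -[LHS]divq_num_den d1 divr1.
Qed.

Lemma irreducible_factor (p : {poly rat}) : (1 < size p)%N ->
  exists q : {poly rat}, irreducible_poly q /\ q %| p.
Proof.
have [n] := ubnP (size p); elim: n p => // n IH p; rewrite ltnS => sp p1.
have [irr|nirr] := pselect (irreducible_poly p); first by exists p.
have [q [q1 qp nqp]] :
    exists q : {poly rat}, [/\ size q != 1%N, q %| p & ~~ (q %= p)].
  apply: contrapT => no; apply: nirr; split=> // q q1 qp.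
  by apply/negPn/negP => nqp; apply: no; exists q.
have p0 : p != 0 by rewrite -size_poly_gt0 ltnW.
have q0 : q != 0 by apply: contraTneq qp => ->; rewrite dvd0p.
have sq : (size q < size p)%N.
  by rewrite ltn_neqAle dvdp_leq // andbT; move: nqp; rewrite -(dvdp_size_eqp qp).
have [||r [irr rq]] := IH q.
- exact: leq_trans sq sp.
- by rewrite ltn_neqAle eq_sym q1 size_poly_gt0.
by exists r; split=> //; exact: dvdp_trans rq qp.
Qed.

Lemma irreducible_comp_scale (p : {poly rat}) (a : rat) : a != 0 ->
  irreducible_poly p -> irreducible_poly (p \Po (a *: 'X)).
Proof.
move=> a0 [p1 hp]; have sX b : b != 0 -> size (b *: 'X : {poly rat}) = 2%N.
  by move=> b0; rewrite size_scale // size_polyX.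
split=> [|q q1 qp]; first by rewrite size_comp_poly2 ?sX.
have ai0 : a^-1 != 0 by rewrite invr_eq0.
have := dvdp_comp_poly (a^-1 *: 'X) qp.
have -> : (p \Po (a *: 'X)) \Po (a^-1 *: 'X) = p.
  by rewrite -comp_polyA comp_polyZ comp_polyX scalerA mulfV // scale1r comp_polyXr.
move=> qp'; have := hp _ _ qp'; rewrite size_comp_poly2 ?sX // => /(_ q1).
rewrite -(dvdp_size_eqp qp') -(dvdp_size_eqp qp) !size_comp_poly2 ?sX //.
Qed.

Lemma scaled_factor_values (S D : {poly rat}) (S' : {poly int}) (a : nat) (k : rat) :
  (0 < a)%N -> k != 0 -> pZtoQ S' = k *: (S \Po (a%:R^-1 *: 'X)) ->
  coprimep S D ->
  exists rho : nat, (0 < rho)%N /\ forall (n : int) (w : rat),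
    (S * D).[n%:~R] = w ^+ 2 -> (S * D).[n%:~R] != 0 ->
    S'.[a%:Z * n] != 0 /\ exists gam e : int, (`|gam| <= rho)%N /\
      S'.[a%:Z * n] = gam * e ^+ 2.
Proof.
move=> a0 k0 eS' cSD; pose L : {poly rat} := a%:R^-1 *: 'X.
have ar0 : a%:R != 0 :> rat by rewrite pnatr_eq0 -lt0n.
have Ln (n : int) : L.[(a%:Z * n)%:~R] = n%:~R.
  by rewrite /L hornerZ hornerX rmorphM /= mulKf.
have [Q [b b0 eD]] := rat_poly_scale (k^-1 *: (D \Po L)).
have br0 : b%:~R != 0 :> rat by rewrite intr_eq0.
(* The factor k^-1 cancels k and b enters squared, so S' D' at a n is b^2 times S D at n: squares
   remain squares. *)
pose D' : {poly int} := b *: Q.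
have eD' : pZtoQ D' = b%:~R ^+ 2 * k^-1 *: (D \Po L).
  by rewrite map_polyZ -[RHS]scalerA eD scalerA expr2 -mulrA mulfV // mulr1.
have cop : coprimep (pZtoQ S') (pZtoQ D').
  rewrite eS' eD' coprimepZl // coprimepZr ?mulf_neq0 ?expf_neq0 ?invr_eq0 //.
  exact: coprimep_comp_poly.
have [rho [rho0 h]] := split_square_value cop.
exists rho; split=> // n w e nz.
have vS : (S'.[a%:Z * n])%:~R = k * S.[n%:~R].
  by rewrite -pZtoQ_horner eS' hornerZ horner_comp Ln.
have vD : (D'.[a%:Z * n])%:~R = b%:~R ^+ 2 * k^-1 * D.[n%:~R].
  by rewrite -pZtoQ_horner eD' hornerZ horner_comp Ln.
have vSD : (S'.[a%:Z * n] * D'.[a%:Z * n])%:~R = (b%:~R * w) ^+ 2.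
  rewrite rmorphM /= vS vD exprMn -e hornerM.
  by field.
have [w' ew'] := rat_sqrt_int vSD.
move: nz; rewrite hornerM mulf_eq0 negb_or => /andP[S0 D0].
have S'0 : S'.[a%:Z * n] != 0 by rewrite -(intr_eq0 rat) vS mulf_neq0.
split=> //; apply: (h _ w') => //.
  by apply: (intr_inj (R := rat)); rewrite vSD ew' rmorphXn.
by rewrite -(intr_eq0 rat) vD !mulf_neq0 ?expf_neq0 ?invr_eq0.
Qed.

Lemma coef_comp_scale (p : {poly rat}) (c : rat) (i : nat) :
  (p \Po (c *: 'X))`_i = p`_i * c ^+ i.
Proof.
rewrite coef_comp_poly (eq_bigr (fun j : 'I_(size p) => p`_j * c ^+ j * (i == j)%:R)).
  have [ip|pi] := ltnP i (size p).
    rewrite (bigD1 (Ordinal ip)) //= eqxx mulr1 big1 ?addr0 // => j ne.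
    rewrite (_ : (i == j) = false) ?mulr0 //.
    by apply: contra_neqF ne => /eqP ij; apply/val_inj.
  rewrite (nth_default _ pi) mul0r big1 // => j _.
  by rewrite (_ : (i == j) = false) ?mulr0 //; have := ltn_ord j; lia.
by move=> j _; rewrite exprZn coefZ coefXn mulrA.
Qed.

Definition integral_poly (a : nat) (p : {poly rat}) : Prop :=
  forall i, exists z : int, z%:~R = a%:R * p`_i.

Lemma integral_poly_exists (p : {poly rat}) :
  exists a : nat, (0 < a)%N /\ integral_poly a p.
Proof.
have [q [b b0 eq]] := rat_poly_scale p; exists `|b|%N; split=> [|i].
  by rewrite absz_gt0.
exists (Num.sg b * q`_i); rewrite eq coefZ coef_map /= rmorphM /=.
have -> : (`|b|%N)%:R = (Num.sg b)%:~R * b%:~R :> rat.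
  by rewrite -rmorphM /= -[(`|b|%N)%:R]/((Posz `|b|)%:~R) abszE normrEsg.
by rewrite -mulrA mulVKf // intr_eq0.
Qed.

Lemma integral_polyM (a b : nat) (p : {poly rat}) : integral_poly a p ->
  integral_poly (b * a) p.
Proof.
by move=> h i; have [z e] := h i; exists (b%:Z * z); rewrite rmorphM /= e natrM mulrA.
Qed.

(** With r the degree, below the top the coefficients become a^(r - i - 1) times the integers a
    p_i. *)
Lemma monic_integral_scale (p : {poly rat}) (a : nat) : (0 < a)%N ->
  p \is monic -> integral_poly a p ->
  exists P : {poly int}, [/\ P \is monic, size P = size p &
    pZtoQ P = a%:R ^+ (size p).-1 *: (p \Po (a%:R^-1 *: 'X))].
Proof.
move=> a0 mp /choice[z hz]; set r := (size p).-1.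
have ar0 : a%:R != 0 :> rat by rewrite pnatr_eq0 -lt0n.
have er : size p = r.+1.
  by rewrite prednK // size_poly_gt0 monic_neq0.
pose P : {poly int} :=
  \poly_(i < r.+1) (if i == r then 1 else a%:Z ^+ (r - i).-1 * z i).
have Pr : P`_r = 1 by rewrite coef_poly ltnSn eqxx.
have sP : size P = r.+1.
  by apply: size_poly_eq; rewrite eqxx oner_eq0.
exists P; split; [by rewrite monicE lead_coefE sP Pr|by rewrite sP er|].
apply/polyP => i; rewrite coef_map coef_poly coefZ coef_comp_scale.
case: ltnP => [ir|ri]; last by rewrite nth_default ?er // mul0r mulr0.
have [->|ne] := eqVneq i r.
  by rewrite -[p`_r]/(lead_coef p) (monicP mp) mul1r exprVn mulfV ?expf_neq0.
rewrite /= rmorphM rmorphXn /= hz.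
have -> : a%:R ^+ r = a%:R ^+ (r - i).-1 * a%:R * a%:R ^+ i :> rat.
  by rewrite -exprSr -exprD; congr (_ ^+ _); lia.
by rewrite exprVn; field; rewrite expf_neq0.
Qed.

Definition rat_square (x : rat) : Prop := exists w : rat, x = w ^+ 2.

Lemma small_square_of_factor (S D : {poly rat}) (P : int -> Prop) : S * D != 0 ->
  small P ->
  (forall n, rat_square (S * D).[n%:~R] -> (S * D).[n%:~R] != 0 -> P n) ->
  small (fun n => rat_square (S * D).[n%:~R]).
Proof.
move=> SD0 sP h; apply: small_sub (smallU sP (small_roots SD0)) => n sq.
have [z|nz] := eqVneq ((S * D).[n%:~R]) 0; first by right.
by left; apply: h.
Qed.

Lemma small_irreducible_square (S D : {poly rat}) : irreducible_poly S ->
  (2 < size S)%N -> coprimep S D -> D != 0 ->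
  small (fun n => rat_square (S * D).[n%:~R]).
Proof.
move=> irrS sS cSD D0.
have S0 : S != 0 by rewrite -size_poly_gt0 (ltn_trans _ sS).
have lS0 : lead_coef S != 0 by rewrite lead_coef_eq0.
pose S1 := (lead_coef S)^-1 *: S.
have mS1 : S1 \is monic by rewrite monicE lead_coefZ mulVf.
have [a [a0 aS1]] := integral_poly_exists S1.
have ar0 : a%:R != 0 :> rat by rewrite pnatr_eq0 -lt0n.
have [P [mP sP eP]] := monic_integral_scale a0 mS1 aS1.
set k := _ ^+ _ in eP.
have k0 : k / lead_coef S != 0 by rewrite mulf_neq0 ?expf_neq0 ?invr_eq0.
have eP' : pZtoQ P = (k / lead_coef S) *: (S \Po (a%:R^-1 *: 'X)).
  by rewrite eP comp_polyZ scalerA.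
have [rho [rho0 h]] := scaled_factor_values a0 k0 eP' cSD.
have irrP : irreducible_poly (pZtoQ P).
  have ai0 : a%:R^-1 != 0 :> rat by rewrite invr_eq0.
  have [i1 i2] := irreducible_comp_scale ai0 irrS.
  rewrite eP'; split=> [|q q1]; first by rewrite size_scale.
  rewrite dvdpZr // => qd; apply: eqp_trans (i2 q q1 qd) _.
  by rewrite eqp_sym; exact: eqp_scale.
have sP2 : (2 < size P)%N by rewrite sP size_scale // invr_eq0.
apply: small_square_of_factor
  (small_scale a0 (small_irreducible_values mP irrP sP2 rho0)) _.
  by rewrite mulf_neq0.
by move=> n [w e] nz; apply: h e nz.
Qed.

Lemma size2_linear (p : {poly rat}) : size p = 2%N ->
  exists c beta, c != 0 /\ p = c *: ('X - beta%:P).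
Proof.
move=> sp; have l0 : lead_coef p != 0 by rewrite lead_coef_eq0 -size_poly_gt0 sp.
rewrite lead_coefE sp /= in l0.
exists p`_1, (- p`_0 / p`_1); split=> //; apply/polyP => i.
rewrite coefZ coefB coefX coefC; case: i => [|[|i]] /=; rewrite ?mulr0 ?subr0 ?mulr1 //.
  by rewrite sub0r mulrN mulrC divfK // opprK.
by rewrite nth_default // sp.
Qed.

Lemma linear_factor_values (S D : {poly rat}) (c beta : rat) (a : nat) (b : int) :
  (0 < a)%N -> b%:~R = a%:R * beta -> c != 0 -> S = c *: ('X - beta%:P) ->
  coprimep S D ->
  exists rho : nat, (0 < rho)%N /\ forall (n : int) (w : rat),
    (S * D).[n%:~R] = w ^+ 2 -> (S * D).[n%:~R] != 0 ->
    a%:Z * n != b /\ exists gam e : int, (`|gam| <= rho)%N /\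
      a%:Z * n - b = gam * e ^+ 2.
Proof.
move=> a0 eb c0 eS cSD; have ar0 : a%:R != 0 :> rat by rewrite pnatr_eq0 -lt0n.
have eL : pZtoQ ('X - b%:P) = (a%:R / c) *: (S \Po (a%:R^-1 *: 'X)).
  rewrite eS comp_polyZ comp_polyB comp_polyX comp_polyC rmorphB /= map_polyX map_polyC /=.
  rewrite scalerA mulfVK // scalerBr scalerA mulfV // scale1r eb.
  by rewrite polyCM mul_polyC.
have k0 : a%:R / c != 0 by rewrite mulf_neq0 ?invr_eq0.
have [rho [rho0 h]] := scaled_factor_values a0 k0 eL cSD.
exists rho; split=> // n w e nz; have := h n w e nz.
by rewrite hornerXsubC subr_eq0.
Qed.

Lemma small_linear_square (S1 S2 D : {poly rat}) : size S1 = 2%N -> size S2 = 2%N ->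
  coprimep S1 (S2 * D) -> coprimep S2 (S1 * D) -> D != 0 ->
  small (fun n => rat_square (S1 * (S2 * D)).[n%:~R]).
Proof.
move=> s1 s2 c1 c2 D0.
have [k1 [beta1 [k10 e1]]] := size2_linear s1.
have [k2 [beta2 [k20 e2]]] := size2_linear s2.
have [S10 S20] : S1 != 0 /\ S2 != 0 by rewrite -!size_poly_gt0 s1 s2.
pose a := (`|denq beta1| * `|denq beta2|)%N.
have a0 : (0 < a)%N by rewrite muln_gt0 !absz_gt0 !denq_neq0.
pose b1 := numq beta1 * denq beta2; pose b2 := numq beta2 * denq beta1.
have ea : a%:R = (denq beta1)%:~R * (denq beta2)%:~R :> rat.
  by rewrite -rmorphM /= -[a%:R]/((Posz a)%:~R) /a PoszM !gez0_abs // ltW ?denq_gt0.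
have eb1 : b1%:~R = a%:R * beta1 by rewrite ea rmorphM /= numqE; ring.
have eb2 : b2%:~R = a%:R * beta2 by rewrite ea rmorphM /= numqE; ring.
have ar0 : a%:R != 0 :> rat by rewrite pnatr_eq0 -lt0n.
have b12 : b1 != b2.
  apply/eqP => eb; have eb' : beta1 = beta2.
    by apply: (mulfI ar0); rewrite -eb1 -eb2 eb.
  move: c1; rewrite coprimepMr => /andP[c12 _].
  have := coprimep_root (x := beta1) c12.
  rewrite e1 e2 /root !hornerZ !hornerXsubC eb' subrr !mulr0 => /(_ (eqxx _)).
  by rewrite eqxx.
have [rho1 [_ h1]] := linear_factor_values a0 eb1 k10 e1 c1.
have [rho2 [_ h2]] := linear_factor_values a0 eb2 k20 e2 c2.
apply: small_square_of_factor
  (small_scale a0 (small_linear_pair (maxn rho1 rho2) b12)) _.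
  by rewrite !mulf_neq0.
move=> n [w e] nz; have [nb1 [g1 [f1 [l1 ef1]]]] := h1 n w e nz.
rewrite mulrCA in e nz; have [nb2 [g2 [f2 [l2 ef2]]]] := h2 n w e nz.
split=> //; exists g1, g2, f1, f2; split=> //.
  by rewrite leq_max l1.
by rewrite leq_max l2 orbT.
Qed.

(** A repeated irreducible factor p is removed first: where p(n) != 0, D(n) and D(n) / p(n)^2 are
    squares together. A squarefree D outside the two excluded shapes has an irreducible factor of
    degree at least 2, or two coprime linear ones. *)
Lemma small_square_values (D : {poly rat}) : D != 0 ->
  (forall c T, D <> c *: T ^+ 2) ->
  (forall c beta T, D <> c *: (('X - beta%:P) * T ^+ 2)) ->
  small (fun n => rat_square D.[n%:~R]).
Proof.
have [m] := ubnP (size D); elim: m D => // m IH D; rewrite ltnS => sD D0 h1 h2.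
have [s1|s1] := leqP (size D) 1.
  by case: (h1 D`_0 1); rewrite expr1n alg_polyC; exact: size1_polyC.
have [[p [irrp /dvdpP[D' eD]]]|nosq] :=
    pselect (exists p, irreducible_poly p /\ p ^+ 2 %| D).
  have p0 : p != 0 by rewrite -size_poly_gt0 ltnW //; case: irrp.
  have D'0 : D' != 0 by apply: contraNneq D0 => z; rewrite eD z mul0r.
  have sD' : (size D' < m)%N.
    apply: leq_trans sD; rewrite eD expr2 !size_mul ?mulf_neq0 //.
    have : (0 < size D')%N by rewrite size_poly_gt0.
    case: irrp => [p1 _] x0.
    have num (x y : nat) : (1 < y -> 0 < x -> x < (x + (y + y).-1).-1)%N by lia.
    exact: num p1 x0.
  have sm : small (fun n => rat_square D'.[n%:~R]).
    apply: IH => // [c T e|c beta T e].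
      by apply: (h1 c (T * p)); rewrite eD e exprMn -scalerAl.
    by apply: (h2 c beta (T * p)); rewrite eD e exprMn -scalerAl -mulrA.
  apply: small_sub (smallU sm (small_roots p0)) => n [w e].
  have [z|nz] := eqVneq p.[n%:~R] 0; [by right|left].
  exists (w / p.[n%:~R]); rewrite expr_div_n -e eD hornerM horner_exp mulfK //.
  by rewrite expf_neq0.
have cop p E : irreducible_poly p -> D = p * E -> coprimep p E.
  move=> irrp eD; rewrite irreducible_poly_coprime //; apply/negP => pE.
  apply: nosq; exists p; split=> //.
  by rewrite eD expr2 dvdp_mul2l ?pE // -size_poly_gt0 ltnW //; case: irrp.
have [p [irrp /dvdpP[E]]] := irreducible_factor s1; rewrite mulrC => eD.
have E0 : E != 0 by apply: contraNneq D0 => z; rewrite eD z mulr0.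
have [p1 _] := irrp.
have [p2|p2] := ltnP 2 (size p).
  by rewrite eD; apply: small_irreducible_square => //; exact: cop.
have sp : size p = 2%N by apply/eqP; rewrite eqn_leq p2.
have [sE|sE] := leqP (size E) 1.
  have [c [beta [c0 ep]]] := size2_linear sp.
  case: (h2 (c * E`_0) beta 1); rewrite eD expr1n mulr1 {1}(size1_polyC sE) ep.
  by rewrite mulrC mul_polyC scalerA mulrC.
have [q [irrq /dvdpP[F]]] := irreducible_factor sE; rewrite mulrC => eE.
have F0 : F != 0 by apply: contraNneq E0 => z; rewrite eE z mulr0.
have eD' : D = q * (p * F) by rewrite eD eE mulrCA.
have [q1 _] := irrq.
have pp0 : p != 0 by rewrite -size_poly_gt0 sp.
have [q2|q2] := ltnP 2 (size q).
  by rewrite eD'; apply: small_irreducible_square; rewrite ?mulf_neq0 //; exact: cop.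
have sq : size q = 2%N by apply/eqP; rewrite eqn_leq q2.
rewrite eD eE; apply: small_linear_square => //; last exact: cop.
by rewrite -eE; exact: cop.
Qed.

(** * Covering by curves of degree 2 *)

Lemma monic_rat_root_int (P : {poly int}) (x : rat) (z : int) : P \is monic ->
  (1 < size P)%N -> (pZtoQ P).[x] = z%:~R -> exists Y : int, x = Y%:~R.
Proof.
move=> mP sP e; pose q := P - z%:P.
have mq : q \is monic.
  rewrite monicE lead_coefDl ?(monicP mP) // size_polyN.
  exact: leq_ltn_trans (size_polyC_leq1 _) sP.
have : (ratr x : algC) \is a Num.int.
  apply: Cint_rat_Aint; first exact: Crat_rat.
  apply: (@root_monic_Aint (pZtoC q)); last 2 first.
  - exact: monic_map.
  - by apply/polyOverP => i; rewrite coef_map /=.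
  rewrite pZtoC_ratr /root horner_map /= fmorph_eq0.
  by rewrite rmorphB /= map_polyC /= hornerD hornerN hornerC e subrr.
move=> /intrP[Y eY]; exists Y; apply: (fmorph_inj (ratr : rat -> algC)).
by rewrite /= ratr_int.
Qed.

(** With g1, f1 the quotients by the leading coefficient of g, and l its degree, Y = a y solves the
    monic integral equation a^l g1(Y / a) = a^l f1(n), so it is an integer. Substituting Y / a in
    Phi is invertible and creates no factor of small degree. *)
Lemma small_points_off_quadratics (f g : {poly rat}) (Phi : {poly {poly rat}}) :
  (1 < size f)%N -> (1 < size g)%N -> (1 < size Phi)%N ->
  no_quadratic_factor Phi ->
  small (fun n => exists y : rat, g.[y] = f.[n%:~R] /\ Phi.[y%:P].[n%:~R] = 0).
Proof.
move=> sf sg sPhi hPhi.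
have lg0 : lead_coef g != 0 by rewrite lead_coef_eq0 -size_poly_gt0 ltnW.
have lgi : (lead_coef g)^-1 != 0 by rewrite invr_eq0.
pose g1 := (lead_coef g)^-1 *: g; pose f1 := (lead_coef g)^-1 *: f.
have mg1 : g1 \is monic by rewrite monicE lead_coefZ mulVf.
have [a1 [a10 h1]] := integral_poly_exists g1.
have [a2 [a20 h2]] := integral_poly_exists f1.
pose a := (a2 * a1)%N; have a0 : (0 < a)%N by rewrite muln_gt0 a20.
have ag : integral_poly a g1 by exact: integral_polyM.
have /choice[z hz] : integral_poly a f1 by rewrite /a mulnC; exact: integral_polyM.
have ar0 : a%:R != 0 :> rat by rewrite pnatr_eq0 -lt0n.
have [G [mG sG eG]] := monic_integral_scale a0 mg1 ag.
have sg1 : size g1 = size g by rewrite size_scale.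
rewrite sg1 in sG eG; set l := (size g).-1 in eG.
have l0 : (0 < l)%N by rewrite -ltnS prednK // ltnW.
pose F : {poly int} := \poly_(i < size f) (a%:Z ^+ l.-1 * z i).
have eF : pZtoQ F = a%:R ^+ l *: f1.
  apply/polyP => i; rewrite coef_map coef_poly [RHS]coefZ.
  case: ltnP => fi; last by rewrite nth_default ?mulr0 // size_scale.
  by rewrite /= rmorphM rmorphXn /= hz -{2}(prednK l0) exprSr mulrA.
have sF : size F = size f.
  have <- : size (pZtoQ F) = size F by rewrite size_map_inj_poly //; exact: intr_inj.
  by rewrite eF !size_scale // expf_neq0.
pose aP : {poly rat} := a%:R%:P; pose aV : {poly rat} := a%:R^-1%:P.
have aPV : aP * aV = 1 by rewrite /aP /aV -polyCM mulfV.
pose L : {poly {poly rat}} := aV *: 'X; pose L' : {poly {poly rat}} := aP *: 'X.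
have LL' : L' \Po L = 'X.
  by rewrite comp_polyZ comp_polyX scalerA aPV scale1r.
have L'L : L \Po L' = 'X.
  by rewrite comp_polyZ comp_polyX scalerA mulrC aPV scale1r.
have aP0 : aP != 0 by rewrite polyC_eq0.
have aV0 : aV != 0 by rewrite polyC_eq0 invr_eq0.
have sL : size L = 2%N by rewrite size_scale // size_polyX.
have sL' : size L' = 2%N by rewrite size_scale // size_polyX.
have nq : no_quadratic_factor (Phi \Po L).
  move=> A sA; have -> : A = (A \Po L') \Po L.
    by rewrite -comp_polyA LL' comp_polyXr.
  by apply/coprimep_comp_poly/hPhi; rewrite size_comp_poly2.
have sPL : (1 < size (Phi \Po L))%N by rewrite size_comp_poly2.
have sG' : (1 < size G)%N by rewrite sG.
have sF' : (1 < size F)%N by rewrite sF.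
apply: small_sub (small_off_quadratics mG sG' sF' sPL nq) => n [y [e ePhi]].
have eval : (pZtoQ G).[a%:R * y] = (F.[n])%:~R.
  rewrite -pZtoQ_horner eF eG [LHS]hornerZ horner_comp (hornerZ _ 'X) hornerX mulKf //.
  by rewrite [RHS]hornerZ /g1 /f1 !hornerZ e.
have [Y eY] := monic_rat_root_int mG sG' eval.
exists Y; split.
  by apply: (intr_inj (R := rat)); rewrite -eval eY pZtoQ_horner.
rewrite horner_comp hornerZ hornerX -eY /aV -polyCM mulKf //.
Qed.

(** Factors of degree at most 2 in Y are split off by gcds and collected in [ds], until the cofactor
    has none left or is itself of degree at most 2. *)
Lemma quadratic_cover (f g : {poly rat}) (Phi : {poly {poly rat}}) :
  (1 < size f)%N -> (1 < size g)%N -> Phi != 0 ->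
  exists ds : seq {poly {poly rat}},
    (forall d, d \in ds -> d != 0 /\ (size d <= 3)%N) /\
    small (fun n => exists y : rat, [/\ g.[y] = f.[n%:~R],
      Phi.[y%:P].[n%:~R] = 0 & forall d, d \in ds -> d.[y%:P].[n%:~R] != 0]).
Proof.
move=> sf sg; have [m] := ubnP (size Phi).
elim: m Phi => // m IH Phi; rewrite ltnS => sP P0.
have [s3|s3] := leqP (size Phi) 3.
  exists [:: Phi]; split; first by move=> d; rewrite inE => /eqP->.
  apply: small_sub (small_finite [::]) => n [y [_ e /(_ Phi)]].
  by rewrite inE eqxx e eqxx => /(_ isT).
have [nq|hq] := pselect (no_quadratic_factor Phi).
  exists [::]; split=> //.
  have sPhi : (1 < size Phi)%N by apply: leq_trans s3.
  apply: small_sub (small_points_off_quadratics sf sg sPhi nq) => n [y [e1 e2 _]].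
  by exists y.
have [A [sA nA]] :
    exists A : {poly {poly rat}}, (1 < size A <= 3)%N /\ ~~ coprimep A Phi.
  apply: contrapT => no; apply: hq => A sA.
  by apply/negPn/negP => nA; apply: no; exists A.
case/andP: sA => sA1 sA3.
pose d := gcdp A Phi.
have d0 : d != 0 by rewrite gcdp_eq0 negb_and P0 orbT.
have d1 : (1 < size d)%N by rewrite ltn_neqAle eq_sym nA size_poly_gt0 d0.
have d3 : (size d <= 3)%N.
  by apply: leq_trans sA3; rewrite leq_gcdpl // -size_poly_gt0 ltnW.
(* Over Q[x] divisibility holds up to a multiplier c in Q[x]; a zero of Phi is still a zero of e
   d. *)
have /Pdiv.Idomain.dvdpP[[c e] /= c0 ece] : d %| Phi by exact: dvdp_gcdr.
have e0 : e != 0.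
  apply: contraNneq P0 => z; move/eqP: ece.
  by rewrite z mul0r -mul_polyC mulf_eq0 polyC_eq0 (negPf c0).
have se : (size e < m)%N.
  apply: leq_trans sP; have := congr1 (fun p : {poly {poly rat}} => size p) ece.
  have num (x y z : nat) : (x = (y + z).-1 -> 1 < z -> 0 < y -> y < x)%N by lia.
  rewrite size_scale // size_mul // => /num; apply=> //.
  by rewrite size_poly_gt0.
have [ds [hds sm]] := IH e se e0.
exists (d :: ds); split.
  by move=> d'; rewrite inE => /orP[/eqP->|/hds].
apply: small_sub sm => n [y [e1 e2 e3]]; exists y; split=> //; last first.
  by move=> d' d'ds; apply: e3; rewrite inE d'ds orbT.
have := congr1 (fun p : {poly {poly rat}} => p.[y%:P].[n%:~R]) ece.
rewrite hornerZ hornerM e2 mulr0 !hornerM => /esym/eqP.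
rewrite mulf_eq0 (negPf (e3 d _)) ?inE ?eqxx // orbF => /eqP//.
Qed.

(** In lowest terms a1 / b1, clearing denominators in g(a1 / b1) = f gives a polynomial N. If N != 0
    its zeros are finite in number; if N = 0 then b1 divides a1^l, so b1 is constant and a / b is a
    right factor. *)
Lemma rational_function_zeros (f g a b : {poly rat}) : (1 < size g)%N -> b != 0 ->
  (exists l : seq rat, forall x, b.[x] != 0 -> g.[a.[x] / b.[x]] = f.[x] -> x \in l) \/
  (exists h : {poly rat}, a = b * h /\ f = g \Po h).
Proof.
move=> sg b0; pose d := gcdp a b.
have d0 : d != 0 by rewrite gcdp_eq0 negb_and b0 orbT.
have /dvdpP[a1 ea] : d %| a by exact: dvdp_gcdl.
have /dvdpP[b1 eb] : d %| b by exact: dvdp_gcdr.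
have cop : coprimep a1 b1.
  have h : (a != 0) || (b != 0) by rewrite b0 orbT.
  by have := coprimep_div_gcd h; rewrite -/d {1}ea {1}eb !mulpK.
have b10 : b1 != 0 by apply: contraNneq b0 => z; rewrite eb z mul0r.
pose l := (size g).-1; have el : size g = l.+1 by rewrite prednK // ltnW.
pose N := \sum_(i < l.+1) g`_i *: (a1 ^+ i * b1 ^+ (l - i)) - f * b1 ^+ l.
have evN x : b1.[x] != 0 -> N.[x] = b1.[x] ^+ l * (g.[a1.[x] / b1.[x]] - f.[x]).
  move=> bx; rewrite hornerD hornerN hornerM horner_exp mulrBr [f.[x] * _]mulrC.
  congr (_ - _); rewrite horner_sum (horner_coef g) el mulr_sumr; apply: eq_bigr => i _.
  rewrite hornerZ hornerM !horner_exp.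
  have -> : b1.[x] ^+ l = b1.[x] ^+ (l - i) * b1.[x] ^+ i.
    by rewrite -exprD subnK // -ltnS.
  by rewrite expr_div_n; field; rewrite expf_neq0.
have [N0|N0] := eqVneq N 0; last first.
  left; have [L [_ hL]] := finite_roots N0; exists L => x bx e.
  apply: hL; rewrite /root.
  have [b1x dx] : b1.[x] != 0 /\ d.[x] != 0.
    by move: bx; rewrite eb hornerM mulf_eq0 negb_or => /andP[].
  rewrite evN // -e ea eb !hornerM invfM mulrACA mulfV // mulr1 subrr mulr0.
  by [].
right; have dv : b1 %| a1 ^+ l.
  have lg0 : g`_l != 0.
    by rewrite /l -lead_coefE lead_coef_eq0 -size_poly_gt0 ltnW.
  rewrite -(dvdpZr _ _ lg0).
  have : N = \sum_(i < l) g`_i *: (a1 ^+ i * b1 ^+ (l - i)) + g`_l *: a1 ^+ l - f * b1 ^+ l.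
    by rewrite /N big_ord_recr /= subnn expr0 mulr1.
  rewrite N0 => e.
  have -> : g`_l *: a1 ^+ l = f * b1 ^+ l - \sum_(i < l) g`_i *: (a1 ^+ i * b1 ^+ (l - i)).
    by apply/eqP; rewrite -subr_eq0; apply/eqP; rewrite [RHS]e; ring.
  have l0 : (0 < l)%N by rewrite -ltnS -el.
  rewrite dvdp_sub //; first by rewrite dvdp_mull // -(prednK l0) exprS dvdp_mulr.
  apply: (big_ind (fun p : {poly rat} => b1 %| p)) => [|x y|i _];
    [exact: dvdp0|exact: dvdp_add|].
  rewrite -mul_polyC dvdp_mull // dvdp_mull //.
  by rewrite -(subnSK (ltn_ord i)) exprS dvdp_mulr.
have /size_poly1P[c c0 eb1] : size b1 == 1%N.
  by rewrite -coprimepp; apply: coprimep_dvdl dv _; rewrite coprimep_expr // coprimep_sym.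
exists (c^-1 *: a1); split.
  by rewrite {1}ea eb eb1 mul_polyC -scalerAl -scalerAr scalerA mulfV // scale1r mulrC.
have : c ^+ l *: (g \Po (c^-1 *: a1) - f) = N.
  rewrite scalerBr comp_polyE el scaler_sumr /N eb1 -polyC_exp [f * _]mulrC mul_polyC.
  congr (_ - _); apply: eq_bigr => i _.
  rewrite exprZn -polyC_exp [_ * _%:P]mulrC mul_polyC !scalerA; congr (_ *: _).
  have -> : c ^+ l = c ^+ (l - i) * c ^+ i by rewrite -exprD subnK // -ltnS.
  by rewrite exprVn; field; rewrite expf_neq0.
rewrite N0 => /eqP; rewrite scaler_eq0 expf_eq0 (negPf c0) andbF /= subr_eq0.
by move=> /eqP.
Qed.

(** * New points on a curve of degree 2 in Y *)

Definition new_point (f g : {poly rat}) (n : int) (y : rat) : Prop :=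
  g.[y] = f.[n%:~R] /\ forall h : {poly rat}, f = g \Po h -> y != h.[n%:~R].

Lemma small_new_rational_function (f g a b : {poly rat}) : (1 < size g)%N ->
  b != 0 -> small (fun n => exists y, [/\ new_point f g n y, b.[n%:~R] != 0 &
    y = a.[n%:~R] / b.[n%:~R]]).
Proof.
move=> sg b0; have [[l hl]|[h [ea ef]]] := rational_function_zeros f a sg b0.
  apply: small_sub (small_finite [seq numq x | x <- l]) => n [y [[e _] bn ey]].
  apply/mapP; exists n%:~R; last by rewrite numq_int.
  by apply: hl => //; rewrite -ey.
apply: small_sub (small_finite [::]) => n [y [[_ new] bn ey]].
have := new h ef; rewrite ey ea hornerM mulrAC mulfV // mul1r eqxx.
by [].
Qed.

Lemma sqrt_bounded_integer_square (k m : int) : k != 0 ->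
  sqrt_bounded (fun n => exists r : int, r ^+ 2 = k * n - m).
Proof.
move=> k0; exists (`|k| + `|m| + 1)%N => Q s us hs.
have /choice[rf hr] : forall n : int, exists r : nat, n \in s -> (r%:Z) ^+ 2 = k * n - m.
  move=> n; have [/hs[[r e] _]|_] := boolP (n \in s); last by exists 0%N.
  by exists `|r|%N => _; rewrite abszE real_normK ?num_real.
have inj : {in s &, injective rf}.
  move=> x y xs ys e; have := hr x xs; rewrite e hr // => /(canLR (subrK _)).
  by rewrite subrK => /(mulfI k0).
have := @uniq_leq_size _ [seq rf n | n <- s]
  (iota 0 ((`|k| + `|m| + 1) * Q + `|m| + 1)).
rewrite map_inj_in_uniq // size_map size_iota => /(_ us) h.
apply: leq_trans (h _) _; last by lia.
move=> _ /mapP[n ns ->]; rewrite mem_iota /= add0n addn1 ltnS.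
have [_ nQ] := hs n ns; rewrite -(@leq_exp2r _ _ 2) // .
have : (rf n ^ 2 = `|(k * n - m)%R|)%N by rewrite -hr // abszX absz_nat.
move=> ->; apply: (@leq_trans (`|k| * Q ^ 2 + `|m|)%N).
  have : (`|(k * n)%R| <= `|k| * Q ^ 2)%N by rewrite abszM leq_mul2l nQ orbT.
  by move: (k * n) (Q ^ 2)%N (`|k|)%N => u v w; lia.
by rewrite -!mulnn; nia.
Qed.

Lemma sqrt_bounded_param (alpha beta : rat) : alpha != 0 ->
  sqrt_bounded (fun n => exists t : rat, n%:~R = beta + alpha * t ^+ 2).
Proof.
move=> a0.
pose k := denq beta * denq alpha * numq alpha.
pose m := numq beta * denq alpha * numq alpha.
have k0 : k != 0 by rewrite !mulf_neq0 ?denq_neq0 ?numq_eq0.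
apply: sqrt_bounded_sub
  (sqrt_bounded_integer_square (denq beta * m) (_ : denq beta * k != 0)).
  (* The extra factor [denq beta] makes the linear form in n equal to the square of this x. *)
  move=> n [t e]; pose x := (denq beta)%:~R * (numq alpha)%:~R * t.
  have ex : (denq beta * k * n - denq beta * m)%:~R = x ^+ 2.
    rewrite rmorphB !rmorphM /= e /x !numqE; ring.
  have [r er] := rat_sqrt_int ex; exists r; apply: (intr_inj (R := rat)).
  by rewrite ex er rmorphXn.
by rewrite mulf_neq0 ?denq_neq0.
Qed.

(** The last clause, a single integer represented by beta + alpha t^2, is the source of the
    congruence. *)
Definition sqrt_param (f g : {poly rat}) : Prop :=
  exists (alpha beta : rat) (P : {poly rat}), [/\ alpha != 0,
    f \Po (alpha *: 'X^2 + beta%:P) = g \Po P, P \Po (- 'X) != P &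
    exists (n : int) (t : rat), n%:~R = beta + alpha * t ^+ 2].

Lemma horner_quadratic (d : {poly {poly rat}}) (y x : rat) : (size d <= 3)%N ->
  d.[y%:P].[x] = (d`_0).[x] + (d`_1).[x] * y + (d`_2).[x] * y ^+ 2.
Proof.
move=> sd; rewrite (@horner_coef_wide _ 3 d) // !big_ord_recl big_ord0 /= /bump /=.
by rewrite expr0 mulr1 expr1 addr0 !(hornerD, hornerM, horner_exp, hornerC) addrA.
Qed.

Lemma quadratic_analysis (f g : {poly rat}) (d : {poly {poly rat}}) :
  (1 < size f)%N -> (1 < size g)%N -> d != 0 -> (size d <= 3)%N ->
  let X n := exists y, new_point f g n y /\ d.[y%:P].[n%:~R] = 0 in
  small X \/ sqrt_param f g /\ sqrt_bounded X.
Proof.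
move=> sf sg d0 sd X.
set d0' := d`_0; set d1 := d`_1; set d2 := d`_2.
have XE n y : d.[y%:P].[n%:~R] = 0 ->
   d0'.[n%:~R] + d1.[n%:~R] * y + d2.[n%:~R] * y ^+ 2 = 0.
  by rewrite horner_quadratic.
have [z2|n2] := eqVneq d2 0.
  left; have [z1|n1] := eqVneq d1 0.
    have n0 : d0' != 0.
      apply: contraNneq d0 => z0; apply/eqP/polyP => i; rewrite coef0.
      case: i => [|[|[|i]]]; [exact: z0|exact: z1|exact: z2|].
      by rewrite nth_default // (leq_trans sd).
    apply: small_sub (small_roots n0) => n [y [_ /XE]].
    by rewrite z1 z2 !horner0 !mul0r !addr0.
  apply: small_sub
    (smallU (small_new_rational_function f (- d0') sg n1) (small_roots n1)).
  move=> n [y [pt /XE e]]; have [z|nz] := eqVneq d1.[n%:~R] 0; [by right|left].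
  exists y; split=> //; rewrite hornerN; apply: (mulIf nz); rewrite divfK //.
  by apply/eqP; rewrite -subr_eq0 -e z2 horner0 opprK; apply/eqP; ring.
(* On the curve Dl(n) = (b y + d1)^2 with b = 2 d2; if Dl is a square, y is one of two rational
   functions of n. *)
pose Dl := d1 ^+ 2 - 4%:P * d0' * d2.
pose b : {poly rat} := 2%:P * d2.
have b0 : b != 0 by rewrite mulf_neq0 // polyC_eq0.
have bE (x : rat) : b.[x] = 2 * d2.[x] by rewrite hornerM hornerC.
have DlE n y : d.[y%:P].[n%:~R] = 0 ->
    Dl.[n%:~R] = (b.[n%:~R] * y + d1.[n%:~R]) ^+ 2.
  move=> /XE e; rewrite bE /Dl !(hornerD, hornerN, horner_exp, hornerM, hornerC).
  apply/eqP; rewrite -subr_eq0 -(mulr0 (- 4 * d2.[n%:~R])) -e; apply/eqP; ring.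
have [[T eT]|nsq] := pselect (exists T, Dl = T ^+ 2).
  left; apply: small_sub (smallU (smallU
     (small_new_rational_function f (T - d1) sg b0)
     (small_new_rational_function f (- T - d1) sg b0)) (small_roots n2)).
  move=> n [y [pt e]]; have [z|nz] := eqVneq d2.[n%:~R] 0; [by right|left].
  have bn : b.[n%:~R] != 0 by rewrite bE mulf_neq0.
  have := DlE n y e; rewrite eT horner_exp => /esym/eqP; rewrite eqf_sqr.
  case/orP => /eqP eq; [left|right]; exists y; split=> //; apply: (mulfI bn);
    by rewrite mulrCA mulfV // mulr1 !hornerD ?hornerN -eq; ring.
have Dl0 : Dl != 0 by apply/eqP => z; apply: nsq; exists 0; rewrite expr0n.
have sub n : X n -> rat_square Dl.[n%:~R].
  by move=> [y [_ e]]; exists (b.[n%:~R] * y + d1.[n%:~R]); exact: DlE.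
(* Here c is not a square, so c T(n)^2 is one only at the zeros of T. *)
have [[c [T eD]]|ncT] := pselect (exists c T, Dl = c *: T ^+ 2).
  left; have T0 : T != 0.
    by apply: contraNneq Dl0 => z; rewrite eD z expr0n scaler0.
  apply: small_sub (small_roots T0) => n /sub[w]; rewrite eD hornerZ horner_exp => e.
  apply/eqP/negPn/negP => Tn; apply: nsq; exists ((w / T.[n%:~R]) *: T).
  rewrite eD exprZn; congr (_ *: _).
  by rewrite expr_div_n -e mulfK // expf_neq0.
have [[c [beta [T eD]]]|ncbT] :=
    pselect (exists c beta T, Dl = c *: (('X - beta%:P) * T ^+ 2)); last first.
  left; apply: small_sub sub (small_square_values Dl0 _ _) => [c T e|c beta T e].
    by apply: ncT; exists c, T.
  by apply: ncbT; exists c, beta, T.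
have c0 : c != 0 by apply: contraNneq Dl0 => z; rewrite eD z scale0r.
have T0 : T != 0.
  by apply: contraNneq Dl0 => z; rewrite eD z expr0n mulr0 scaler0.
(* From (b y + d1)^2 = c (n - beta) T(n)^2, the quotient t = (b y + d1) / T(n) gives n = beta + t^2
   / c and y = (t T(n) - d1(n)) / b(n). *)
pose alpha := c^-1; have a0 : alpha != 0 by rewrite invr_eq0.
pose L : {poly rat} := alpha *: 'X^2 + beta%:P.
have LE t : L.[t] = beta + alpha * t ^+ 2.
  by rewrite /L hornerD hornerZ hornerXn hornerC addrC.
have Leven : L \Po (- 'X) = L.
  by rewrite /L comp_polyD comp_polyZ comp_polyC comp_Xn_poly sqrrN.
have sL : size L = 3%N.
  rewrite /L size_polyDl size_scale ?size_polyXn //.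
  by rewrite (leq_ltn_trans (size_polyC_leq1 _)).
pose a := 'X * (T \Po L) - (d1 \Po L).
pose bL := b \Po L.
have bL0 : bL != 0 by rewrite comp_poly_eq0 ?sL.
have key n y : new_point f g n y -> d.[y%:P].[n%:~R] = 0 ->
    d2.[n%:~R] != 0 -> T.[n%:~R] != 0 -> exists t, n%:~R = L.[t] /\ bL.[t] != 0 /\
    g.[a.[t] / bL.[t]] = (f \Po L).[t].
  move=> [e _] /DlE eDl d2n Tn; pose w := b.[n%:~R] * y + d1.[n%:~R].
  exists (w / T.[n%:~R]); set t := w / _.
  have nt : n%:~R = L.[t].
    rewrite LE expr_div_n -[w ^+ 2]eDl eD hornerZ hornerM horner_exp hornerXsubC.
    by rewrite /alpha; field; rewrite ?c0 ?Tn.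
  have bn : bL.[t] != 0 by rewrite horner_comp -nt bE mulf_neq0.
  split=> //; split=> //.
  have -> : (f \Po L).[t] = f.[n%:~R] by rewrite horner_comp -nt.
  rewrite -e; congr (g.[_]).
  apply: (mulIf bn); rewrite divfK // /a hornerD hornerN hornerM hornerX !horner_comp -nt.
  by rewrite divfK // /w; ring.
have smXb : small X \/ exists P, a = bL * P /\ f \Po L = g \Po P.
  have [[l hl]|] := rational_function_zeros (f \Po L) a sg bL0; [left|by right].
  apply: small_sub (smallU (smallU (small_roots n2) (small_roots T0))
    (small_finite [seq numq L.[t] | t <- l])) => n [y [pt e]].
  have [z|d2n] := eqVneq d2.[n%:~R] 0; first by left; left.
  have [z|Tn] := eqVneq T.[n%:~R] 0; first by left; right.
  right; have [t [nt [bn et]]] := key n y pt e d2n Tn.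
  by apply/mapP; exists t; rewrite ?hl // -nt numq_int.
case: smXb => [|[P [ea eP]]]; first by left.
(* If X is not small, some point avoids the zeros of d2 and T and supplies the integer required by
   [sqrt_param]. *)
have [emp|nemp] := pselect (small X); [by left|right].
have good_or_small : exists n t, n%:~R = beta + alpha * t ^+ 2.
  apply: contrapT => no; apply: nemp.
  apply: small_sub (smallU (small_roots n2) (small_roots T0)) => n [y [pt e]].
  have [z|d2n] := eqVneq d2.[n%:~R] 0; first by left.
  have [z|Tn] := eqVneq T.[n%:~R] 0; first by right.
  case: no; have [t [nt _]] := key n y pt e d2n Tn.
  by exists n, t; rewrite -LE.
split.
  (* An even P would make a, and with it X T(L), even, since L is even; but X T(L) is odd and
     nonzero. *)
  exists alpha, beta, P; split=> //; apply/eqP => evP.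
  have : a \Po (- 'X) = a by rewrite ea comp_polyM evP /bL -comp_polyA Leven.
  rewrite /a comp_polyB comp_polyM comp_polyX -!comp_polyA Leven => /addIr.
  rewrite mulNr => /eqP; rewrite eq_sym -subr_eq0 opprK -mulr2n -scaler_nat.
  rewrite scaler_eq0 pnatr_eq0 /=.
  by rewrite mulf_eq0 polyX_eq0 comp_poly_eq0 ?sL // (negPf T0).
apply: sqrt_bounded_sub (sqrt_boundedU (sqrt_bounded_param beta a0)
  (small_sqrt_bounded (smallU (small_roots n2) (small_roots T0)))) => n [y [pt e]].
have [z|d2n] := eqVneq d2.[n%:~R] 0; first by right; left.
have [z|Tn] := eqVneq T.[n%:~R] 0; first by right; right.
by left; have [t [nt _]] := key n y pt e d2n Tn; exists t; rewrite -LE.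
Qed.

Lemma sqrt_bounded_seq (T : eqType) (l : seq T) (P : T -> int -> Prop) :
  (forall x, x \in l -> sqrt_bounded (P x)) ->
  sqrt_bounded (fun n => exists2 x, x \in l & P x n).
Proof.
elim: l => [|a l IH] sP.
  by apply: sqrt_bounded_sub (small_sqrt_bounded (small_finite [::])) => n [].
apply: sqrt_bounded_sub (sqrt_boundedU (sP a (mem_head _ _)) (IH _)) => [n [x]|x xl].
  by rewrite inE => /orP[/eqP->|xl] Px; [left|right; exists x].
by apply: sP; rewrite inE xl orbT.
Qed.

Lemma graph_poly_neq0 (f g : {poly rat}) : (1 < size g)%N ->
  map_poly polyC g - f%:P != 0.
Proof.
move=> sg; have sgm : size (map_poly polyC g) = size g.
  by apply: size_map_poly_id0; rewrite polyC_eq0 lead_coef_eq0 -size_poly_gt0 ltnW.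
rewrite -size_poly_gt0 size_polyDl ?sgm ?size_polyN; first exact: ltnW.
exact: leq_ltn_trans (size_polyC_leq1 _) sg.
Qed.

Lemma new_points_dichotomy (f g : {poly rat}) : (1 < size f)%N -> (1 < size g)%N ->
  (small (is_new f g) \/ sqrt_param f g) /\ sqrt_bounded (is_new f g).
Proof.
move=> sf sg; pose Phi : {poly {poly rat}} := map_poly polyC g - f%:P.
have PhiE (y x : rat) : Phi.[y%:P].[x] = g.[y] - f.[x].
  by rewrite /Phi hornerD hornerN hornerC horner_map /= hornerD hornerN hornerC.
have Phi0 : Phi != 0 := graph_poly_neq0 f sg.
have [ds [hds sm]] := quadratic_cover sf sg Phi0.
pose X d n := exists y, new_point f g n y /\ d.[y%:P].[n%:~R] = 0.
set rest := (fun n => _) in sm.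
have cover n : is_new f g n -> (exists2 d, d \in ds & X d n) \/ rest n.
  move=> [y [e new]].
  have [ex|nex] := pselect (exists2 d, d \in ds & d.[y%:P].[n%:~R] = 0).
    by left; case: ex => d dd z; exists d => //; exists y.
  right; exists y; split=> //; first by rewrite PhiE e subrr.
  by move=> d dd; apply/eqP => z; apply: nex; exists d.
have an d : d \in ds -> small (X d) \/ sqrt_param f g /\ sqrt_bounded (X d).
  by move=> /hds[d0 sd]; apply: quadratic_analysis.
split.
  have [par|npar] := pselect (sqrt_param f g); [by right|left].
  apply: small_sub cover (smallU (small_seq _) sm) => d /an[//|[par]].
  by case: npar.
apply: sqrt_bounded_sub cover (sqrt_boundedU (sqrt_bounded_seq _) (small_sqrt_bounded sm)).
by move=> d /an[/small_sqrt_bounded|[]].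
Qed.

(** * Right factors and even parts *)

(** All j + 1 terms have the same degree and the same leading coefficient, so nothing cancels in
    characteristic 0. *)
Lemma size_power_sum (p q : {poly rat}) (s j : nat) : size p = s.+1 ->
  size q = s.+1 -> lead_coef p = lead_coef q ->
  size (\sum_(i < j.+1) p ^+ (j - i) * q ^+ i) = (j * s).+1.
Proof.
move=> sp sq lpq; set H := \sum_(i < _) _.
have lp0 : lead_coef p != 0 by rewrite lead_coef_eq0 -size_poly_gt0 sp.
have p0 : p != 0 by rewrite -size_poly_gt0 sp.
have q0 : q != 0 by rewrite -size_poly_gt0 sq.
have st (i : 'I_j.+1) : size (p ^+ (j - i) * q ^+ i) = (j * s).+1.
  rewrite size_mul ?expf_neq0 //.
  have h1 := size_exp p (j - i); have h2 := size_exp q i; rewrite sp sq /= in h1 h2.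
  have k1 : (0 < size (p ^+ (j - i)))%N by rewrite size_poly_gt0 expf_neq0.
  have k2 : (0 < size (q ^+ i))%N by rewrite size_poly_gt0 expf_neq0.
  have ij : (i <= j)%N by rewrite -ltnS.
  have e3 : (s * (j - i) + s * i = j * s)%N by rewrite -mulnDr subnK // mulnC.
  move: h1 h2 k1 k2 e3; move: (s * (j - i))%N (s * i)%N (j * s)%N => u v w.
  have num (a b : nat) : a.-1 = u -> b.-1 = v -> (0 < a)%N -> (0 < b)%N ->
    (u + v = w)%N -> (a + b).-1 = w.+1 by lia.
  exact: num.
have cH : H`_(j * s) = j.+1%:R * lead_coef p ^+ j.
  rewrite coef_sum (eq_bigr (fun=> lead_coef p ^+ j)) => [|i _].
    by rewrite sumr_const card_ord mulr_natl.
  have := lead_coefM (p ^+ (j - i)) (q ^+ i); rewrite !lead_coef_exp -lpq -exprD.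
  have ij : (i <= j)%N by rewrite -ltnS.
  by rewrite subnK // lead_coefE st.
apply/eqP; rewrite eqn_leq; apply/andP; split.
  apply: leq_trans (size_sum _ _ _) _; apply/bigmax_leqP => i _.
  by rewrite st.
rewrite ltnNge; apply/negP => le; have : H`_(j * s) = 0 by rewrite nth_default.
by move=> /eqP; rewrite cH mulf_eq0 pnatr_eq0 expf_eq0 (negPf lp0) andbF.
Qed.

(** In g(p) - g(q) = (p - q) S, the top coefficient of g alone determines the degree of S, so S !=
    0. *)
Lemma comp_poly_inj_lead (g p q : {poly rat}) (s : nat) : (1 < size g)%N ->
  (0 < s)%N -> size p = s.+1 -> size q = s.+1 -> lead_coef p = lead_coef q ->
  g \Po p = g \Po q -> p = q.
Proof.
move=> sg s0 sp sq lpq e; pose l := (size g).-2.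
have el : size g = l.+2 by rewrite /l; case: (size g) sg => [|[]].
pose H j := \sum_(i < j.+1) p ^+ (j - i) * q ^+ i.
have eH j : p ^+ j.+1 - q ^+ j.+1 = (p - q) * H j by rewrite subrXX.
have gE : (g \Po p) - (g \Po q) = (p - q) * \sum_(j < l.+1) g`_j.+1 *: H j.
  rewrite !comp_polyE el -sumrB big_ord_recl /= subrr add0r mulr_sumr.
  by apply: eq_bigr => j _; rewrite -scalerBr eH scalerAr.
move: gE; rewrite e subrr => /esym/eqP; rewrite mulf_eq0 subr_eq0 => /orP[/eqP//|].
rewrite big_ord_recr /= => /eqP h; exfalso.
have gl0 : g`_l.+1 != 0.
  by have := lead_coef_eq0 g; rewrite lead_coefE el /= => ->; rewrite -size_poly_gt0 el.
have sH j : size (H j) = (j * s).+1 by exact: size_power_sum.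
have szl : size (g`_l.+1 *: H l) = (l * s).+1 by rewrite size_scale // sH.
have szr : (size (\sum_(j < l) g`_j.+1 *: H j)%R <= l * s)%N.
  apply: leq_trans (size_sum _ _ _) _; apply/bigmax_leqP => j _.
  apply: leq_trans (size_scale_leq _ _) _; rewrite sH //.
  by have := ltn_ord j; nia.
have : size (\sum_(j < l) g`_j.+1 *: H j + g`_l.+1 *: H l) = (l * s).+1.
  by rewrite addrC size_polyDl szl // ltnS.
by rewrite h size_poly0.
Qed.

(* Once the subleading coefficient of g is killed by a shift, comparing the top
   coefficients of g(A + O) = g(A - O) forces A = 0. *)
Lemma comp_even_odd (g A O : {poly rat}) (l : nat) : size g = l.+1 -> (0 < l)%N ->
  g`_l.-1 = 0 -> O != 0 -> (1 < size O)%N -> size A != size O ->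
  g \Po (A + O) = g \Po (A - O) -> A = 0.
Proof.
move=> el l0 gl1 O0 sO sAO e.
have sg : (1 < size g)%N by rewrite el ltnS.
have gl0 : g`_l != 0.
  by have := lead_coef_eq0 g; rewrite lead_coefE el /= => ->; rewrite -size_poly_gt0 el.
(* If A dominates, A + O and A - O share degree and leading coefficient, and [comp_poly_inj_lead]
   forces O = 0. *)
have [lt|ge] := ltnP (size O) (size A).
  have lt' : (size (- O) < size A)%N by rewrite size_polyN.
  have sA : size A = (size A).-1.+1 by rewrite prednK // (leq_ltn_trans _ lt).
  have h : A + O = A - O.
    apply: (@comp_poly_inj_lead g _ _ (size A).-1) => //.
    - by move: lt sO; clear; lia.
    - by rewrite size_polyDl.
    - by rewrite size_polyDl.
    - by rewrite !lead_coefDl.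
  move: h => /addrI/eqP; rewrite -subr_eq0 opprK -mulr2n -scaler_nat scaler_eq0.
  by rewrite pnatr_eq0 /= (negPf O0).
have lt : (size A < size O)%N by rewrite ltn_neqAle sAO.
pose s := (size O).-1; have es : size O = s.+1 by rewrite prednK // ltnW.
have s0 : (0 < s)%N by rewrite -ltnS -es.
pose q := O - A.
have sp : size (A + O) = s.+1 by rewrite addrC size_polyDl.
have sq : size q = s.+1 by rewrite size_polyDl // size_polyN.
have lp : lead_coef (A + O) = lead_coef O by rewrite addrC lead_coefDl.
have lq : lead_coef q = lead_coef O by rewrite lead_coefDl // size_polyN.
have lO : lead_coef O != 0 by rewrite lead_coef_eq0.
have eq : A - O = - q by rewrite opprB.
(* The leading terms are those of O and of - O, so equality of their l-th powers makes l even. *)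
have lev : ~~ odd l.
  apply/negP => ol; have := congr1 (fun p : {poly rat} => lead_coef p) e.
  rewrite !lead_coef_comp ?sp ?eq ?size_polyN ?sq // lead_coefN lp lq el /=.
  rewrite exprNn -signr_odd ol expr1 mulN1r mulrN => /eqP.
  rewrite -subr_eq0 opprK -mulr2n mulrn_eq0 /= mulf_eq0 expf_eq0.
  by rewrite lead_coef_eq0 -size_poly_eq0 el (negPf lO) andbF.
pose r := g - g`_l *: 'X^l.
have gr : g = g`_l *: 'X^l + r by rewrite addrC subrK.
(* The degree drops by two, as the subleading coefficient of g vanishes. *)
have sr : (size r <= l.-1)%N.
  apply/leq_sizeP => j; rewrite leq_eqVlt => /orP[/eqP<-|lj].
    rewrite coefB coefZ coefXn gl1 (_ : (l.-1 == l) = false) ?mulr0 ?subr0 //.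
    by move: l0; clear; lia.
  rewrite coefB coefZ coefXn; have [->|ne] := eqVneq j l; first by rewrite mulr1 subrr.
  by rewrite mulr0 subr0 nth_default // el; move: lj ne l0; clear; lia.
have src (p : {poly rat}) : size p = s.+1 -> (size (r \Po p) <= l.-2 * s + 1)%N.
  move=> szp; apply: leq_trans (size_comp_poly_leq _ _) _.
  have num (x y : nat) : (x <= y.-1 -> x.-1 <= y.-2)%N by lia.
  by rewrite szp /= addn1 ltnS leq_mul2r; apply/orP; right; apply: num sr.
clearbody r.
pose H := \sum_(i < l.-1.+1) (A + O) ^+ (l.-1 - i) * q ^+ i.
have topE : (A + O) ^+ l - q ^+ l = 2%:R *: (A * H).
  rewrite -{1 2}(prednK l0) subrXX /= -/H scalerAl; congr (_ * _).
  by rewrite /q scaler_nat mulr2n; ring.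
have key : g`_l *: (2%:R *: (A * H)) = (r \Po (A - O)) - (r \Po (A + O)).
  have eAO : (A - O) ^+ l = q ^+ l.
    by rewrite eq exprNn -signr_odd (negPf lev) mul1r.
  have : (g`_l *: 'X^l + r) \Po (A + O) = (g`_l *: 'X^l + r) \Po (A - O).
    by rewrite -gr.
  rewrite !comp_polyD !comp_polyZ !comp_Xn_poly eAO => e'.
  rewrite -topE scalerBr.
  have -> : g`_l *: (A + O) ^+ l = g`_l *: q ^+ l + (r \Po (A - O)) - (r \Po (A + O)).
    by rewrite -e' addrK.
  by move: (g`_l *: q ^+ l) (r \Po _) (r \Po _) => x y z; ring.
(* For A != 0 the left side of [key] has degree at least (l - 1) s and the right side at most (l -
   2) s. *)
apply/eqP; apply/negPn/negP => A0.
have sH : size H = (l.-1 * s).+1 by apply: size_power_sum => //; rewrite lp lq.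
have H0 : H != 0 by rewrite -size_poly_gt0 sH.
have : (size (g`_l *: (2%:R *: (A * H))) <= l.-2 * s + 1)%N.
  rewrite key; apply: leq_trans (size_polyD _ _) _.
  by rewrite size_polyN geq_max !src // eq size_polyN.
rewrite !size_scale ?pnatr_eq0 // size_mul // sH.
have : (0 < size A)%N by rewrite size_poly_gt0.
have l1 : (1 < l)%N by move: lev l0; clear; case: l => [|[|l]].
have num (x y z : nat) : (1 < y)%N -> (0 < z)%N -> (0 < x)%N ->
    ((x + (y.-1 * z).+1).-1 <= y.-2 * z + 1)%N -> False.
  by case: y => [|[|y]] // _ z0 x0 /=; rewrite mulSn; nia.
exact: num.
Qed.

Lemma coef_XaddC_exp (c : rat) (n : nat) :
  (('X + c%:P) ^+ n)`_n = 1 /\ (('X + c%:P) ^+ n.+1)`_n = n.+1%:R * c.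
Proof.
have lead k : (('X + c%:P) ^+ k)`_k = 1.
  have m : ('X + c%:P) ^+ k \is monic by rewrite monic_exp // monicXaddC.
  have := monicP m; rewrite lead_coefE.
  have -> : ('X + c%:P) = 'X - (- c)%:P by rewrite polyCN opprK.
  by rewrite size_exp_XsubC.
split=> //; elim: n => [|n IH]; first by rewrite expr1 coefD coefX coefC mul1r add0r.
rewrite exprSr mulrDr coefD coefMX coefMC /= IH lead.
by rewrite -(natr1 n.+1); ring.
Qed.

(** With P = A + O split into even and odd parts, invariance of beta + alpha t^2 under t -> - t
    gives g(A + O) = g(A - O). Once g is centred at c, this yields A = c, so g is even about c, and
    O^2 = t^2 E(t^2)^2 is read as a polynomial in t^2. *)
Lemma sqrt_param_structure (f g P : {poly rat}) (alpha beta : rat) :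
  (1 < size g)%N -> alpha != 0 ->
  f \Po (alpha *: 'X^2 + beta%:P) = g \Po P -> P \Po (- 'X) != P ->
  exists (c : rat) (E G : {poly rat}),
    let u := alpha^-1 *: ('X - beta%:P) in
    [/\ E != 0, (1 < size G)%N, g = G \Po (('X - c%:P) ^+ 2) &
        f = G \Po (u * (E \Po u) ^+ 2)].
Proof.
move=> sg a0 efg nev.
pose l := (size g).-1; have el : size g = l.+1 by rewrite prednK // ltnW.
have l0 : (0 < l)%N by rewrite -ltnS -el.
have gl0 : g`_l != 0.
  by have := lead_coef_eq0 g; rewrite lead_coefE el /= => ->; rewrite -size_poly_gt0 el.
pose E := odd_poly P; pose O := (E \Po 'X^2) * 'X; pose A := even_poly P \Po 'X^2.
have eP : P = A + O by rewrite /A /O poly_even_odd.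
have X2N : ('X^2 : {poly rat}) \Po (- 'X) = 'X^2 by rewrite comp_Xn_poly sqrrN.
have eP' : P \Po (- 'X) = A - O.
  by rewrite {1}eP comp_polyD comp_polyM -!comp_polyA X2N comp_polyX mulrN.
have O0 : O != 0 by apply: contraNneq nev => z; rewrite eP' eP z addr0 subr0.
have E0 : E != 0 by apply: contraNneq O0 => z; rewrite /O z comp_poly0 mul0r.
have sX2 : size ('X^2 : {poly rat}) = 3%N by rewrite size_polyXn.
have sX21 : (1 < size ('X^2 : {poly rat}))%N by rewrite sX2.
have E20 : E \Po 'X^2 != 0 by rewrite comp_poly_eq0.
have sOE : size O = (size (E \Po 'X^2)).+1 by rewrite /O size_mulX.
have sO : (1 < size O)%N by rewrite sOE ltnS size_poly_gt0.
have sodd (B : {poly rat}) : B != 0 -> odd (size (B \Po 'X^2)).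
  move=> B0; have := size_comp_poly B 'X^2; rewrite sX2 /= => h.
  have b0 : (0 < size (B \Po 'X^2))%N by rewrite size_poly_gt0 comp_poly_eq0.
  by rewrite -(prednK b0) h /= muln2 odd_double.
(* The Tschirnhaus shift that kills the subleading coefficient. *)
pose c := - g`_l.-1 / (l%:R * g`_l).
pose sh : {poly rat} := 'X + c%:P; pose gs := g \Po sh.
have ssh : size sh = 2%N by rewrite size_XaddC.
have sgs : size gs = l.+1 by rewrite /gs size_comp_poly2.
have l1 : l.-1.+1 = l by rewrite prednK.
have gs0 : gs`_l.-1 = 0.
  have sumE m : \sum_(i < m.+1) g`_i * (sh ^+ i)`_m = g`_m.
    rewrite big_ord_recr /= (coef_XaddC_exp c m).1 mulr1 big1 ?add0r // => i _.
    rewrite [(sh ^+ i)`_m]nth_default ?mulr0 //.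
    have -> : sh = 'X - (- c)%:P by rewrite polyCN opprK.
    by rewrite size_exp_XsubC ltn_ord.
  have := sumE l.-1; have := (coef_XaddC_exp c l.-1).2.
  rewrite l1 /gs coef_comp_poly el big_ord_recr /= -/sh => -> ->.
  by rewrite /c; field; rewrite ?gl0 ?pnatr_eq0 -?lt0n ?l0.
have shE (B : {poly rat}) : gs \Po (B - c%:P) = g \Po B.
  by rewrite /gs -comp_polyA comp_polyD comp_polyX comp_polyC subrK.
have gAO : gs \Po ((A - c%:P) + O) = gs \Po ((A - c%:P) - O).
  rewrite addrAC -[A - c%:P - O]addrAC !shE -eP -eP' comp_polyA -efg -comp_polyA.
  by rewrite comp_polyD comp_polyZ comp_polyC X2N.
have Ac : A - c%:P = (even_poly P - c%:P) \Po 'X^2.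
  by rewrite comp_polyB comp_polyC.
(* An odd polynomial has even size, a nonzero even one odd size. *)
have sAO : size (A - c%:P) != size O.
  have [z|nz] := eqVneq (even_poly P - c%:P) 0.
    by rewrite Ac z comp_poly0 size_poly0 sOE.
  apply/eqP => e; have := sodd _ nz; rewrite -Ac e sOE /= => od.
  by have := sodd _ E0; rewrite (negPf od).
have A0 := comp_even_odd sgs l0 gs0 O0 sO sAO gAO.
(* Evenness holds after composition with the nonconstant O, which can be cancelled. *)
have gsO : gs \Po (- 'X) = gs.
  apply/eqP; rewrite -subr_eq0; apply/eqP.
  have : ((gs \Po (- 'X)) - gs) \Po O == 0.
    rewrite comp_polyB -comp_polyA.
    have -> : (- 'X) \Po O = - O by rewrite -scaleN1r comp_polyZ comp_polyX scaleN1r.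
    by move: gAO; rewrite A0 add0r sub0r => ->; rewrite subrr.
  by rewrite comp_poly_eq0 // => /eqP.
pose G := even_poly gs.
have egs : gs = G \Po 'X^2.
  have e1 := poly_even_odd gs; set W := odd_poly gs in e1.
  have : gs \Po (- 'X) = (G \Po 'X^2) - (W \Po 'X^2) * 'X.
    by rewrite -{1}e1 comp_polyD comp_polyM -!comp_polyA X2N comp_polyX mulrN.
  rewrite gsO -{1}e1 => /addrI/eqP.
  rewrite -subr_eq0 opprK -mulr2n -scaler_nat scaler_eq0 pnatr_eq0 /= => /eqP z.
  by rewrite -{1}e1 z addr0.
have eg : g = G \Po (('X - c%:P) ^+ 2).
  have -> : g = gs \Po ('X - c%:P) by rewrite shE comp_polyXr.
  by rewrite egs -comp_polyA comp_Xn_poly.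
have sG : (1 < size G)%N.
  rewrite ltnNge; apply/negP => s1; move: sg; rewrite eg (size1_polyC s1) comp_polyC.
  by rewrite ltnNge size_polyC_leq1.
exists c, E, G => u; split=> //.
pose L1 : {poly rat} := alpha *: 'X + beta%:P.
have eL : L1 \Po 'X^2 = alpha *: 'X^2 + beta%:P.
  by rewrite /L1 comp_polyD comp_polyZ comp_polyX comp_polyC.
have eP2 : P = O + c%:P.
  by rewrite eP; have -> : A = c%:P by [apply/eqP; rewrite -subr_eq0 A0]; rewrite addrC.
have : (f \Po L1) \Po 'X^2 = (G \Po ('X * E ^+ 2)) \Po 'X^2.
  rewrite -!comp_polyA eL efg eg -comp_polyA; congr (_ \Po _).
  rewrite !expr2 !comp_polyM comp_polyB !comp_polyX comp_polyC eP2 addrK /O.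
  by ring.
move=> /eqP; rewrite -subr_eq0 -comp_polyB comp_poly_eq0 // subr_eq0 => /eqP efL.
have eLu : L1 \Po u = 'X.
  rewrite /L1 comp_polyD comp_polyZ comp_polyX comp_polyC scalerA mulfV // scale1r.
  by rewrite subrK.
rewrite -[f in LHS]comp_polyXr -eLu comp_polyA efL -comp_polyA; congr (_ \Po _).
by rewrite !expr2 !comp_polyM comp_polyX.
Qed.

(** * Squarefree parts and the congruence *)

Lemma int_unitE (m : int) : (m \is a GRing.unit) = (`|m| == 1)%N.
Proof.
apply/idP/idP => [/unitrP[y [e _]]|]; last first.
  by rewrite -eqz_nat abszE eqr_norml => /andP[/orP[]/eqP-> _]; rewrite ?unitrN unitr1.
have := congr1 absz e; rewrite abszM => /eqP.
by rewrite muln_eq1 => /andP[].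
Qed.

Lemma squarefree_part_int (N : int) : N != 0 -> exists s m : int,
  [/\ squarefreez s, m != 0 & N = s * m ^+ 2].
Proof.
have [k] := ubnP `|N|; elim: k N => // k IH N; rewrite ltnS => hN N0.
have [sf|nsf] := pselect (squarefreez N).
  by exists N, 1; rewrite expr1n mulr1.
have [m [/dvdzP[N' eN] mu]] : exists m : int, (m ^+ 2 %| N)%Z /\ m \isn't a GRing.unit.
  apply: contrapT => no; apply: nsf => m mN.
  by apply/negPn/negP => mu; apply: no; exists m.
have m0 : m != 0 by apply: contraNneq N0 => z; rewrite eN z expr0n mulr0.
have N'0 : N' != 0 by apply: contraNneq N0 => z; rewrite eN z mul0r.
have m1 : (1 < `|m|)%N.
  have : (0 < `|m|)%N by rewrite absz_gt0.
  rewrite leq_eqVlt => /orP[/eqP e|//]; move: mu; rewrite int_unitE.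
  by rewrite -e.
have lt : (`|N'| < k)%N.
  apply: leq_trans hN; rewrite eN abszM abszX.
  by rewrite ltn_Pmulr ?absz_gt0 // -{1}(exp1n 2) ltn_exp2r.
have [s [m' [sq m'0 e]]] := IH N' lt N'0.
exists s, (m' * m); split=> //; first by rewrite mulf_neq0.
by rewrite eN e; ring.
Qed.

Lemma squarefree_part_rat (x : rat) : x != 0 -> exists (s : int) (q : rat),
  [/\ squarefreez s, q != 0 & x = s%:~R * q ^+ 2].
Proof.
move=> x0; have d0 : (denq x)%:~R != 0 :> rat by rewrite intr_eq0 denq_neq0.
have [|s [m [sf m0 e]]] := @squarefree_part_int (numq x * denq x).
  by rewrite mulf_neq0 ?denq_neq0 // numq_eq0.
exists s, (m%:~R / (denq x)%:~R); split=> //.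
  by rewrite mulf_neq0 ?invr_eq0 ?intr_eq0.
rewrite expr_div_n mulrA -rmorphXn -rmorphM /= -e rmorphM /= numqE.
by field.
Qed.

(** In lowest terms the square of the denominator of r divides s. *)
Lemma squarefree_mul_sqr_int (s k : int) (r : rat) : squarefreez s ->
  s%:~R * r ^+ 2 = k%:~R -> exists z : int, r = z%:~R.
Proof.
move=> sf e; exists (numq r).
have d0 : (denq r)%:~R != 0 :> rat by rewrite intr_eq0 denq_neq0.
have e1 : s * numq r ^+ 2 = k * denq r ^+ 2.
  apply: (intr_inj (R := rat)); by rewrite !rmorphM ?rmorphXn /= -e numqE; ring.
have dv : (denq r ^+ 2 %| s)%Z.
  rewrite dvdzE abszX -(@Gauss_dvdl _ _ (`|numq r| ^ 2)); last first.
    by rewrite coprimeXl // coprimeXr // coprime_sym coprime_num_den.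
  by rewrite -!abszX -abszM e1 abszM dvdn_mull.
have := sf _ dv; rewrite int_unitE => d1.
have e2 : denq r = 1 by have := denq_gt0 r; move/eqP: d1; move: (denq r) => x; lia.
by rewrite -[LHS]divq_num_den e2 divr1.
Qed.

(** With d alpha = s q^2, the number s (q t)^2 = d n - b is an integer; as s is squarefree, z = q t
    is an integer, and reduction modulo d is the congruence. *)
Lemma sqrt_param_congruence (alpha beta : rat) (n : int) (t : rat) : alpha != 0 ->
  n%:~R = beta + alpha * t ^+ 2 ->
  exists s : int, [/\ squarefreez s,
    exists q : rat, q != 0 /\ (denq beta)%:~R * alpha = s%:~R * q ^+ 2 &
    exists z : int, (s * z ^+ 2 = - numq beta %[mod denq beta])%Z].
Proof.
move=> a0 e; have d0 : (denq beta)%:~R != 0 :> rat by rewrite intr_eq0 denq_neq0.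
have [s [q [sf q0 esq]]] := squarefree_part_rat (mulf_neq0 d0 a0).
exists s; split=> //; first by exists q.
have key : s%:~R * (q * t) ^+ 2 = (denq beta * n - numq beta)%:~R.
  by rewrite exprMn mulrA -esq rmorphB rmorphM /= e numqE; ring.
have [z ez] := squarefree_mul_sqr_int sf key; exists z.
apply/eqP; rewrite eqz_mod_dvd opprK.
have -> : s * z ^+ 2 + numq beta = n * denq beta.
  apply: (intr_inj (R := rat)); rewrite rmorphD rmorphM rmorphXn /= -ez key.
  by rewrite rmorphB !rmorphM /=; ring.
exact: dvdz_mull.
Qed.

(** * Upper and lower bounds *)

Lemma N_new_seq (R : realType) (f g : {poly rat}) (B : R) :
  exists s : seq int, [/\ uniq s, size s = N_new f g B &
    forall n, n \in s <-> `|n%:~R : R| <= B /\ is_new f g n].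
Proof.
exists (fset_set (new_set f g B)); split=> [||n]; [exact: fset_uniq|by []|].
have -> : (n \in (fset_set (new_set f g B) : seq int)) =
  (n \in fset_set (new_set f g B)) by [].
rewrite in_fset_set; last exact: finite_new_set.
by rewrite in_setE.
Qed.

Lemma small_not_asymp_sqrt (R : realType) (f g : {poly rat}) :
  small (is_new f g) -> ~ asymp_sqrt (fun B : R => N_new f g B).
Proof.
move=> sm [c [C [B0 [c0 C0 h]]]].
pose K := (Num.truncn c^-1).+1.
have Kc : 1 < c * K%:R.
  have : c^-1 < K%:R by rewrite truncnS_gt.
  by move=> hk; rewrite -[ltLHS](divff (lt0r_neq0 c0)) ltr_pM2l.
have [Q0 hQ] := sm K.
pose Q := (Q0 + (Num.truncn B0).+1)%N.
have Q1 : (0 < Q)%N by rewrite /Q addnS.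
have BQ : B0 <= (Q ^ 2)%:R.
  apply: (@le_trans _ _ Q%:R); last by rewrite ler_nat -mulnn leq_pmulr.
  apply: (@le_trans _ _ (Num.truncn B0).+1%:R); first by rewrite ltW // truncnS_gt.
  by rewrite ler_nat leq_addl.
have /andP[lo _] := h _ BQ.
have [s [us ss sP]] := N_new_seq f g ((Q ^ 2)%:R : R).
have := hQ Q (leq_addr _ _) s us.
have hs : forall n, n \in s -> is_new f g n /\ (`|n| <= Q ^ 2)%N.
  move=> n /sP[nB nn]; split=> //; move: nB.
  by rewrite -intr_norm -[(Q ^ 2)%:R]/((Posz (Q ^ 2))%:~R) ler_int; lia.
move=> /(_ hs); rewrite ss -(ler_nat R) natrM.
move: lo; rewrite natrX sqrtr_sqr ger0_norm ?ler0n // => lo hi.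
have Qp : 0 < Q%:R :> R by rewrite ltr0n.
have : c * K%:R * Q%:R <= Q%:R.
  apply: le_trans hi; rewrite mulrAC mulrC ler_wpM2l //.
by rewrite -ler_pdivlMr // divff ?gt_eqF // leNgt Kc.
Qed.

Lemma N_new_upper_bound (R : realType) (f g : {poly rat}) :
  sqrt_bounded (is_new f g) ->
  exists C : R, 0 < C /\ forall B : R, 1 <= B -> (N_new f g B)%:R <= C * Num.sqrt B.
Proof.
move=> [C hC]; exists (3 * C + 1)%:R; split; first by rewrite ltr0n addn1.
move=> B B1; have B0 : 0 <= B by apply: le_trans B1.
pose x := Num.sqrt B; have x1 : 1 <= x by rewrite -sqrtr1 ler_wsqrtr.
have x0 : 0 <= x := sqrtr_ge0 B.
pose Q := (Num.truncn x).+1.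
have Qx : Q%:R <= 2 * x.
  have : (Num.truncn x)%:R <= x by rewrite truncn_le.
  by rewrite /Q -natr1; lra.
have xQ : x <= Q%:R by rewrite ltW // truncnS_gt.
have [s [us ss sP]] := N_new_seq f g B.
have := hC Q s us.
have hs : forall n, n \in s -> is_new f g n /\ (`|n| <= Q ^ 2)%N.
  move=> n /sP[nB nn]; split=> //.
  have : `|n%:~R : R| <= (Q ^ 2)%:R.
    apply: le_trans nB _; rewrite -[B]sqr_sqrtr // natrX -/x.
    by rewrite ler_pXn2r ?nnegrE.
  by rewrite -intr_norm -[(Q ^ 2)%:R]/((Posz (Q ^ 2))%:~R) ler_int; lia.
move=> /(_ hs); rewrite ss -(ler_nat R) => h; apply: le_trans h _.
rewrite natrD natrM natrD natrM.
have C0 : 0 <= C%:R :> R := ler0n _ _.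
by rewrite -/x; nra.
Qed.

(** A right factor is a root, in the domain Q[X], of the nonzero polynomial g(Y) - f. *)
Lemma finite_right_factors (f g : {poly rat}) : (1 < size g)%N ->
  exists l : seq {poly rat}, forall h, f = g \Po h -> h \in l.
Proof.
move=> sg; pose Phi : {poly {poly rat}} := map_poly polyC g - f%:P.
have Phi0 : Phi != 0 := graph_poly_neq0 f sg.
have [l [_ hl]] := finite_roots Phi0; exists l => h e; apply: hl.
by rewrite /root hornerD hornerN hornerC [X in _ - X]e subrr.
Qed.

(** Bounds the old points among the constructed ones: (h - c)^2 has even degree and U W^2 odd
    degree, so each of the finitely many h meets the equation finitely often. *)
Lemma finite_right_factor_values (f g U W : {poly rat}) (c : rat) : (1 < size g)%N ->
  size U = 2%N -> W != 0 ->
  exists l : seq int, forall n : int,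
    (exists h, f = g \Po h /\ (h.[n%:~R] - c) ^+ 2 = U.[n%:~R] * W.[n%:~R] ^+ 2) ->
    n \in l.
Proof.
move=> sg sU W0; have [hs hhs] := finite_right_factors f sg.
pose D (h : {poly rat}) := (h - c%:P) ^+ 2 - U * W ^+ 2.
have U0 : U != 0 by rewrite -size_poly_gt0 sU.
have D0 h : D h != 0.
  rewrite subr_eq0; apply/eqP => e.
  have hc0 : h - c%:P != 0.
    apply/eqP => z; move/eqP: e; rewrite z expr0n eq_sym mulf_eq0 (negPf U0).
    by rewrite expf_eq0 (negPf W0).
  have := congr1 (fun p : {poly rat} => odd (size p)) e.
  rewrite !expr2 !size_mul ?mulf_neq0 // sU /=.
  have : (0 < size (h - c%:P)%R)%N by rewrite size_poly_gt0.
  have : (0 < size W)%N by rewrite size_poly_gt0.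
  have odd_double_pred (x : nat) : (0 < x)%N -> odd (x + x).-1 = true.
    by case: x => // x _; rewrite addnn doubleS /= odd_double.
  by rewrite add0n => /odd_double_pred-> /odd_double_pred->.
have /choice[L hL] : forall h, exists l : seq int, forall n : int,
    (D h).[n%:~R] = 0 -> n \in l.
  by move=> h; exact: finite_int_roots (D0 h).
exists (flatten [seq L h | h <- hs]) => n [h [e eh]].
apply/flattenP; exists (L h); first by apply/map_f/hhs.
by apply: hL; rewrite /D !(hornerD, hornerN, horner_exp, hornerM, hornerC) eh subrr.
Qed.

Lemma N_new_lower_bound (R : realType) (f g : {poly rat}) (M K0 : nat) (nn : nat -> int) :
  injective nn -> (0 < M)%N -> (forall j, (`|nn j| <= (M * j.+1) ^ 2)%N) ->
  (exists l : seq int, size l = K0 /\ forall j, nn j \notin l -> is_new f g (nn j)) ->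
  exists c B0 : R, 0 < c /\ forall B : R, B0 <= B ->
    c * Num.sqrt B <= (N_new f g B)%:R.
Proof.
move=> inj M0 hn [l [sl hl]].
have MR : 0 < M%:R :> R by rewrite ltr0n.
(* The count is at least x / M - 1 - K0 with x = sqrt B, hence at least x / (2 M) once x >= 2 M (K0
   + 1). *)
exists (2 * M%:R)^-1, ((2 * M%:R * (K0%:R + 1)) ^+ 2); split.
  by rewrite invr_gt0 mulr_gt0.
move=> B hB; set x := Num.sqrt B.
have y0 : 0 <= 2 * M%:R * (K0%:R + 1) :> R by rewrite !mulr_ge0 ?addr_ge0.
have xy : 2 * M%:R * (K0%:R + 1) <= x.
  by rewrite -[leLHS](ger0_norm y0) -sqrtr_sqr ler_wsqrtr.
have x0 : 0 <= x by exact: le_trans xy.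
have B0 : 0 <= B by apply: le_trans hB; rewrite exprn_ge0.
pose J := Num.truncn (x / M%:R).
have JM : M%:R * J%:R <= x.
  rewrite mulrC -ler_pdivlMr //.
  by rewrite truncn_le divr_ge0 // ltW.
have MJ : x < M%:R * (J%:R + 1).
  by rewrite mulrC -ltr_pdivrMr // natr1 truncnS_gt.
have [s [us ss sP]] := N_new_seq f g B.
pose t := [seq n <- [seq nn j | j <- iota 0 J] | n \notin l].
have ut : uniq t by rewrite filter_uniq // map_inj_uniq // iota_uniq.
have ts : (size t <= size s)%N.
  apply: uniq_leq_size => // n; rewrite mem_filter => /andP[nl /mapP[j]].
  rewrite mem_iota /= add0n => jJ en; apply/sP; split; last first.
    by rewrite en; apply: hl; rewrite -en.
  have : `|n%:~R : R| <= ((M * J) ^ 2)%:R.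
    rewrite -intr_norm -[(_ ^ 2)%:R]/((Posz ((M * J) ^ 2))%:~R) ler_int -abszE.
    rewrite lez_nat en; apply: leq_trans (hn j) _.
    by rewrite leq_exp2r // leq_mul2l jJ orbT.
  move=> /le_trans; apply; rewrite -[B]sqr_sqrtr // natrX natrM.
  by rewrite ler_pXn2r ?nnegrE ?mulr_ge0.
have Js : (J <= size t + K0)%N.
  have e : (size t + count (fun n => n \in l) [seq nn j | j <- iota 0 J] = J)%N.
    rewrite /t size_filter addnC -[RHS](size_iota 0 J) -(size_map nn).
    exact: count_predC.
  rewrite -{1}e leq_add2l -size_filter -sl; apply: uniq_leq_size.
    by rewrite filter_uniq // map_inj_uniq // iota_uniq.
  by move=> n; rewrite mem_filter => /andP[].
have : J%:R <= (N_new f g B)%:R + K0%:R :> R.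
  by rewrite -natrD ler_nat -ss (leq_trans Js) // leq_add2r.
move=> h; rewrite mulrC ler_pdivrMr ?mulr_gt0 //.
set N := (N_new f g B)%:R in h *.
have N0 : 0 <= N by exact: ler0n.
have h1 : M%:R * (J%:R + 1) <= M%:R * (N + K0%:R + 1) by rewrite ler_pM2l // lerD2r.
lra.
Qed.

(** Let z run through its class modulo d and n = (s z^2 + b) / d. Then (n - beta) / alpha = s z^2 /
    (d alpha) = (z / q)^2, so t = z / q gives the solution y = c + t E(t^2). *)
Lemma structure_points (f g E G : {poly rat}) (c beta alpha : rat) (s z : int) (q : rat) :
  (1 < size g)%N -> alpha != 0 -> E != 0 -> q != 0 ->
  g = G \Po (('X - c%:P) ^+ 2) ->
  f = G \Po ((alpha^-1 *: ('X - beta%:P)) * (E \Po (alpha^-1 *: ('X - beta%:P))) ^+ 2) ->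
  (denq beta)%:~R * alpha = s%:~R * q ^+ 2 ->
  (s * z ^+ 2 = - numq beta %[mod denq beta])%Z ->
  exists (nn : nat -> int) (M : nat) (l : seq int), [/\ injective nn, (0 < M)%N,
    forall j, (`|nn j| <= (M * j.+1) ^ 2)%N &
    forall j, nn j \notin l -> is_new f g (nn j)].
Proof.
move=> sg a0 E0 q0 eg ef es ez.
set d := denq beta; set b := numq beta.
have d0 : 0 < d by exact: denq_gt0.
have dR : d%:~R != 0 :> rat by rewrite intr_eq0 gt_eqF.
have s0 : s != 0.
  apply: contra_eq_neq es => ->; rewrite mul0r mulf_neq0 //.
set u := alpha^-1 *: ('X - beta%:P) in ef.
have su : size u = 2%N by rewrite size_scale ?invr_eq0 // size_XsubC.
(* A nonnegative representative makes the squares along the progression, and hence the n,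
   distinct. *)
pose z0 := (z %% d)%Z.
have z00 : 0 <= z0 by rewrite modz_ge0 // gt_eqF.
pose zz (j : nat) : int := z0 + j%:Z * d.
have dvd j : (d %| s * zz j ^+ 2 + b)%Z.
  move/eqP: ez; rewrite eqz_mod_dvd opprK -/d -/b => ez.
  have zd : (d %| zz j - z)%Z.
    have -> : zz j - z = (z0 - z) + j%:Z * d by rewrite /zz; ring.
    by rewrite rpredD ?dvdz_mull // -eqz_mod_dvd modz_mod.
  have -> : s * zz j ^+ 2 + b = s * (zz j + z) * (zz j - z) + (s * z ^+ 2 + b) by ring.
  by rewrite rpredD // dvdz_mull.
have /choice[nn hnn] : forall j, exists n : int, s * zz j ^+ 2 + b = n * d.
  by move=> j; apply/dvdzP.
have zinc j : zz j.+1 = zz j + d by rewrite /zz -addn1 PoszD; ring.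
have zpos j : 0 <= zz j by rewrite /zz addr_ge0 // mulr_ge0 // ltW.
have inj : injective nn.
  move=> i j e; have := hnn i; rewrite e -hnn => /addIr /(mulfI s0) /eqP.
  rewrite eqrXn2 // => /eqP /addrI /(mulIf _) h.
  by have := h (_ : d != 0); rewrite gt_eqF // => /(_ isT) [].
have EU0 : E \Po u != 0 by rewrite comp_poly_eq0 // su.
have [l hl] := finite_right_factor_values f c sg su EU0.
exists nn, (`|s| * `|d| + `|b| + 1)%N, l; split=> //; first by rewrite addn1.
- move=> j; have s1 : (0 < `|s|)%N by rewrite absz_gt0.
  have d1 : (0 < `|d|)%N by rewrite absz_gt0 gt_eqF.
  have zle : (`|zz j| <= `|d| * j.+1)%N.
    have zd : z0 < d by rewrite ltz_pmod.
    rewrite -lez_nat abszE ger0_norm // PoszM abszE gtr0_norm // /zz.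
    by rewrite -addn1 PoszD mulrDr mulr1 addrC mulrC lerD2l ltW.
  have : (`|nn j| * `|d| <= `|s| * `|zz j| ^ 2 + `|b|)%N.
    have absD (v w : int) : (`|(v + w)%R| <= `|v| + `|w|)%N by clear; lia.
    by rewrite -abszM -hnn -abszX -abszM absD.
  have : (`|zz j| ^ 2 <= (`|d| * j.+1) ^ 2)%N by rewrite leq_exp2r.
  rewrite !expnMn -!mulnn; move: (`|zz j| * `|zz j|)%N (`|nn j|)%N => v nj.
  move: (`|s|)%N (`|d|)%N (`|b|)%N s1 d1 j.+1 (ltn0Sn j) => s' d' b' s1 d1 i i0 h1 h2.
  apply: (@leq_trans (nj * d')); first by rewrite leq_pmulr.
  apply: (leq_trans h2); apply: (@leq_trans (s' * (d' * d' * (i * i)) + b')).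
    by rewrite leq_add2r leq_mul2l h1 orbT.
  apply: (@leq_trans ((s' * (d' * d') + b') * (i * i))).
    by rewrite mulnDl mulnA leq_add2l leq_pmulr // muln_gt0 i0.
  rewrite leq_mul2r; apply/orP; right.
  apply: (@leq_trans (s' * d' * (s' * d') + b')).
    by rewrite leq_add2r mulnACA leq_mul2r leq_pmulr ?orbT.
  by move: (s' * d')%N => w; clear; nia.
move=> j njl; pose t : rat := (zz j)%:~R / q.
have un : u.[(nn j)%:~R] = t ^+ 2.
  rewrite /u hornerZ hornerXsubC; apply: (mulfI (mulf_neq0 dR a0)).
  rewrite {2}es /t expr_div_n.
  transitivity (((nn j)%:~R * d%:~R) - beta * d%:~R); first by field.
  rewrite -numqE -/b -rmorphM /= -hnn rmorphD rmorphM rmorphXn /=.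
  by field.
pose y := c + t * E.[t ^+ 2].
exists y; split.
  rewrite eg horner_comp horner_exp hornerXsubC ef horner_comp hornerM horner_exp.
  rewrite horner_comp un.
  by congr (G.[_]); rewrite /y; ring.
move=> h eh; apply/eqP => ey; move/negP: njl; apply; apply: hl; exists h; split=> //.
by rewrite -ey /y horner_comp un; ring.
Qed.

Theorem corollary8p11 (R : realType) (f g : {poly rat})
    (hf : (1 < size f)%N) (hg : (1 < size g)%N) :
  asymp_sqrt (fun B : R => N_new f g B) <->
  exists (c beta alpha : rat) (E G : {poly rat}),
    let u : {poly rat} := alpha^-1 *: ('X - beta%:P) in
    let b : int := numq beta in
    let d : int := denq beta in
    [/\ alpha != 0, E != 0, (1 < size G)%N &
      [/\ g = G \Po (('X - c%:P) ^+ 2),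
          f = G \Po (u * (E \Po u) ^+ 2) &
          exists s : int,
            [/\ squarefreez s,
                exists q : rat, q != 0 /\ d%:~R * alpha = s%:~R * q ^+ 2 &
                exists z : int, (s * z ^+ 2 = - b %[mod d])%Z]]].
Proof.
have [dich bounded] := new_points_dichotomy hf hg; split.
  move=> asy; case: dich => [/small_not_asymp_sqrt/(_ asy)//|].
  move=> [alpha [beta [P [a0 efg nev [n [t ent]]]]]].
  have [c [E [G [E0 sG eg ef]]]] := sqrt_param_structure hg a0 efg nev.
  exists c, beta, alpha, E, G; split=> //; split=> //.
  exact: sqrt_param_congruence ent.
move=> [c [beta [alpha [E [G [a0 E0 _ [eg ef [s [_ [q [q0 es]] [z ez]]]]]]]]]].
have [nn [M [l [inj M0 hn hl]]]] := structure_points hg a0 E0 q0 eg ef es ez.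
have [c1 [B1 [c10 low]]] := @N_new_lower_bound R f g M (size l) nn inj M0 hn
  (ex_intro _ l (conj erefl hl)).
have [C [C0 up]] := @N_new_upper_bound R f g bounded.
exists c1, C, (Num.max 1 B1); split=> // B; rewrite ge_max => /andP[B1' B1''].
by rewrite low // up.
Qed.
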